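(* Let $\widehat f_n^{(block)}$ be a block estimator with the lattice design $V=[\mathbf 1,\mathbf n]$. Assume the $\varepsilon_i$ are independent with $\mathbb E\varepsilon_i=0$ and $\mathbb E|\varepsilon_i|^{q\vee2}\le\sigma^{q\vee2}$. Let $a\le b$ be integer vectors in $[\mathbf 1,\mathbf n]$ and $\tilde n_j=b_j-a_j+1$; suppose $\tilde n_1\ge\cdots\ge\tilde n_d$. Define $\tilde n=n_{a,b}=\prod_{j=1}^d\tilde n_j$, $\tilde n_{d+1}=1$, $\tilde n_s^*=\prod_{j=1}^s\tilde n_j$ and $t_s=\tilde n_s^*/\tilde n_s^s$ (with $1=t_1\le\cdots\le t_d\le t_{d+1}=\tilde n$). Then for $q\ge1$ and any non-decreasing $f$ with $\{f(b)-f(a)\}/\sigma\le\Delta_n^*$, $$\sum_{x_i\in[a,b]}\mathbb E\big|\widehat f_n^{(block)}(x_i)-f(x_i)\big|^q\le C^*_{q,d}\,n_{a,b}\,\sigma^q\bigg(\widetilde H(1)+\int_1^{n_{a,b}}\frac{\widetilde H(dt)}{t^{q/2}}+\frac1{n_{a,b}}\prod_{j=1}^d\int_0^{\tilde n_j}\frac{dt}{(t\vee1)^{q/2}}\bigg),$$ where $\widetilde H$ is the non-decreasing continuous function defined piecewise by $\widetilde H(t)=\min\{1,\Delta_n^*t^{1/2}(t/\tilde n_s^* )^{1/s}\}$ for $t_s\le t\le t_{s+1}$, $s=1,\ldots,d$, and $C^*_{q,d}$ is a constant depending only on $(q,d)$, continuous in $q\in[1,\infty)$ and non-decreasing in $d$.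 Moreover, with $s_q=\lceil2/(q-1)\rceil\wedge(d+1)$ (and $s_1=d+1$), $$\widetilde H(1)+\int_1^{n_{a,b}}t^{-q/2}\widetilde H(dt)\ \lesssim_{q,d}\ \begin{cases}1,&\tilde n_1\le\Delta_n^*,\\ \big(\Delta_n^*/(\tilde n_s^* )^{1/s}\big)^{qs/(2+s)},&\tilde n_{s+1}/t_{s+1}^{1/2}\le\Delta_n^*\le\tilde n_s/t_s^{1/2},\ 1\le s<s_q,\\ \big(\Delta_n^*/(\tilde n_st_s^{(q-1)/2})\big)\Lambda_s,&\Delta_n^*\le\tilde n_s/t_s^{1/2},\ s=s_q\le d,\end{cases}$$ where $$\Lambda_s=\bigg[\log_+\Big(\min\Big\{\frac{\tilde n_s}{\tilde n_{s+1}},\ \frac{\tilde n_s/(\tilde n_s^* )^{1/(s+2)}}{(\Delta_n^* )^{2/(s+2)}}\Big\}\Big)\bigg]^{I\{2/(q-1)=s\}}.$$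
   Context: Lattice design: for positive integers $n_1,\ldots,n_d$, $V=[\mathbf 1,\mathbf n]=\prod_{j=1}^d\{1,\ldots,n_j\}$, $n=\prod_jn_j$, and the design points $x_1,\ldots,x_n$ enumerate $V$, each once. We observe $y_i=f(x_i)+\varepsilon_i$. Vectors are ordered coordinatewise; $[u,v]=\{x\in V:u\le x\le v\}$, $n_{u,v}=\#\{i:x_i\in[u,v]\}$. Non-decreasing means $f(u)\le f(v)$ for $u\le v$ in $V$. $\overline y_{[u,v]}$ is the average of the $y_i$ with $x_i\in[u,v]$. Max-min and min-max estimators on the lattice: $\widehat f_n^{(max-min)}(x)=\max_{u\le x}\min_{v\ge x}\overline y_{[u,v]}$, $\widehat f_n^{(min-max)}(x)=\min_{v\ge x}\max_{u\le x}\overline y_{[u,v]}$ ($u,v\in V$). A block estimator is any estimator $\widehat f_n^{(block)}$ lying, for every $x\in V$, between the minimum and the maximum of $\widehat f_n^{(max-min)}(x)$ and $\widehat f_n^{(min-max)}(x)$. $a\vee b=\max(a,b)$, $a\wedge b=\min(a,b)$, $\log_+x=1\vee\log x$, $I\{\cdot\}$ is an indicator, $\widetilde H(dt)$ denotes Stieltjes integration, $2/0=\infty$, and a quotient with zero denominator inside a minimum is $+\infty$. $A\lesssim_{q,d}B$ means $A\le C_{q,d}B$ with $C_{q,d}$ depending only on $(q,d)$. *)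

(* Defs.v *)
From HB Require Import structures.
From mathcomp Require Import all_boot all_order all_algebra.
From mathcomp Require Import all_classical all_reals all_analysis.
From mathcomp Require Import ring.

Set Implicit Arguments.
Unset Strict Implicit.
Unset Printing Implicit Defensive.

Import Order.TTheory GRing.Theory Num.Theory.
Import numFieldNormedType.Exports.

Local Open Scope classical_set_scope.
Local Open Scope ring_scope.

(* The lattice prod_j {1, ..., n_j}, with coordinates counted from 0: only the
   order and the differences of coordinates are ever used. *)
Definition lattice (d : nat) (n : 'I_d -> nat) : finType :=
  {dffun forall j : 'I_d, 'I_(n j)}.

Section Lattice.
Variables (d : nat) (n : 'I_d -> nat).
Implicit Types u v a b : lattice n.

Definition lle u v : bool := [forall j : 'I_d, (u j <= v j)%N].

Definition box u v : {set lattice n} := [set z | lle u z && lle z v]%SET.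

(* The j-th side length b_j - a_j + 1, for j counted from 1 (j = 0 is never
   used), extended by 1 beyond d. *)
Definition side a b (j : nat) : nat :=
  if @insub nat (fun i => (i < d)%N) 'I_d j.-1 is Some i then (b i - a i).+1 else 1%N.

End Lattice.

Section Independence.
Context {disp : measure_display} {T : measurableType disp} {R : realType}.
Variable P : probability T R.

Definition independent_rvs (I : finType) (X : I -> {RV P >-> R}) : Prop :=
  forall (J : {set I}) (B : I -> set R),
    (forall i, i \in J -> measurable (B i)) ->
    P (\bigcap_(i in [set` J]) (X i @^-1` B i))
    = (\prod_(i in J) P (X i @^-1` B i))%E.

End Independence.

Section BlockEstimators.
Variables (R : realType) (d : nat) (n : 'I_d -> nat) (N : nat).
Variable x : 'I_N -> lattice n.
Implicit Types (u v z : lattice n) (y : 'I_N -> R).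

Definition npts u v : nat := #|[set i | x i \in box u v]%SET|.

Definition ybar y u v : R := (\sum_(i | x i \in box u v) y i) / (npts u v)%:R.

(* The default value of each iterated max or min below is the term at z, which
   is in the range, so it does not alter the extremum over the finite set. *)
Definition max_below (F : lattice n -> R) z : R :=
  \big[Num.max/F z]_(u | lle u z) F u.

Definition min_above (F : lattice n -> R) z : R :=
  \big[Num.min/F z]_(v | lle z v) F v.

Definition fmaxmin y z : R :=
  max_below (fun u => min_above (fun v => ybar y u v) z) z.

Definition fminmax y z : R :=
  min_above (fun v => max_below (fun u => ybar y u v) z) z.

Definition is_block_value y z (r : R) : Prop :=
  Num.min (fmaxmin y z) (fminmax y z) <= r
    <= Num.max (fmaxmin y z) (fminmax y z).

End BlockEstimators.

Section Knots.
Variables (R : realType) (d : nat) (m : nat -> nat).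
Implicit Types (t D : R) (s k : nat).

Definition cumside s : nat := \prod_(1 <= j < s.+1) m j.

Definition knot s : R := (cumside s)%:R / (m s)%:R ^+ s.

Definition Hpiece D s t : R :=
  Num.min 1 (D * Num.sqrt t * (t / (cumside s)%:R) `^ s%:R^-1).

(* The argument is clamped to [1, prod_j m_j], so that the function is constant
   outside this interval; the piece used is the first s with t <= t_{s+1}. *)
Definition Hfun D t : R :=
  let t' := Num.max 1 (Num.min t (cumside d)%:R) in
  let s := (find (fun k => t' <= knot k.+1) (iota 1 d)).+1 in
  Hpiece D s t'.

Hypothesis m_gt0 : forall s, (0 < m s)%N.
Hypothesis m_end : m d.+1 = 1%N.
Hypothesis m_sorted : forall s, (1 <= s < d)%N -> (m s.+1 <= m s)%N.

Let m_le s : (1 <= s <= d)%N -> (m s.+1 <= m s)%N.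
Proof.
move=> /andP[s1]; rewrite leq_eqVlt => /orP[/eqP ->|sd]; first by rewrite m_end.
by apply: m_sorted; rewrite s1.
Qed.

Let cum_gt0 s : 0 < (cumside s)%:R :> R.
Proof. by rewrite ltr0n /cumside prodn_gt0. Qed.

Let mR_gt0 s : 0 < (m s)%:R :> R.
Proof. by rewrite ltr0n. Qed.

Let cumS s : cumside s.+1 = (cumside s * m s.+1)%N.
Proof. by rewrite /cumside big_nat_recr. Qed.

Let knotS s : knot s.+1 = (cumside s)%:R / (m s.+1)%:R ^+ s.
Proof.
rewrite /knot cumS natrM exprS invfM mulrA; congr (_ / _).
by rewrite mulfK// gt_eqF.
Qed.

Lemma knot_1 : knot 1 = 1.
Proof.
by rewrite /knot /cumside big_nat1 expr1 divff// gt_eqF.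
Qed.

Lemma knot_end : knot d.+1 = (cumside d)%:R.
Proof. by rewrite knotS m_end expr1n divr1. Qed.

Lemma knot_leS s : (1 <= s <= d)%N -> knot s <= knot s.+1.
Proof.
move=> hs; rewrite knotS /knot ler_pM2l//.
rewrite lef_pV2 ?posrE ?exprn_gt0//.
by rewrite lerXn2r ?nnegrE ?ler0n// ler_nat m_le.
Qed.

Let knot_le i j : (1 <= i)%N -> (i <= j)%N -> (j <= d.+1)%N -> knot i <= knot j.
Proof.
move=> i1; elim: j => [|j IH]; first by rewrite leqn0 => /eqP ->.
rewrite leq_eqVlt => /orP[/eqP ->//|]; rewrite ltnS => ij jd.
apply: le_trans (IH ij (ltnW jd)) _; apply: knot_leS.
by rewrite (leq_trans i1 ij) -ltnS.
Qed.

Let g s t : R := (t / (cumside s)%:R) `^ s%:R^-1.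

Let g_ge0 s t : 0 <= g s t. Proof. exact: powR_ge0. Qed.

Let gX s t : (0 < s)%N -> 0 < t -> g s t ^+ s = t / (cumside s)%:R.
Proof.
move=> s0 t0; rewrite -powR_mulrn ?g_ge0// /g -powRrM mulVf ?pnatr_eq0 -?lt0n//.
by rewrite powRr1// divr_ge0 ?ltW.
Qed.

Let gXX s t : (0 < s)%N -> 0 < t ->
  g s t ^+ (s * s.+1) = g s.+1 t ^+ (s * s.+1) * (t / knot s.+1).
Proof.
move=> s0 t0; rewrite exprM gX// mulnC [in RHS]exprM gX// knotS cumS natrM.
have c0 := lt0r_neq0 (cum_gt0 s); have m0 := lt0r_neq0 (mR_gt0 s.+1).
have cs := expf_neq0 s c0; have ms := expf_neq0 s m0.
rewrite exprSr !expr_div_n exprMn; move: (t ^+ s) (_ ^+ s) (_ ^+ s) cs ms => T C M C0 M0.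
by field; rewrite c0 C0 M0.
Qed.

Let g_le s t : (0 < s)%N -> 0 < t -> t <= knot s.+1 -> g s t <= g s.+1 t.
Proof.
move=> s0 t0 tk; have p0 : (0 < s * s.+1)%N by rewrite muln_gt0 s0.
rewrite -(ler_pXn2r p0) ?nnegrE ?g_ge0// gXX// ler_piMr ?exprn_ge0 ?g_ge0//.
by rewrite ler_pdivrMr ?mul1r// (lt_le_trans t0 tk).
Qed.

Let g_ge s t : (0 < s)%N -> 0 < t -> knot s.+1 <= t -> g s.+1 t <= g s t.
Proof.
move=> s0 t0 tk; have p0 : (0 < s * s.+1)%N by rewrite muln_gt0 s0.
rewrite -(ler_pXn2r p0) ?nnegrE ?g_ge0// gXX// ler_peMr ?exprn_ge0 ?g_ge0//.
by rewrite ler_pdivlMr ?mul1r// knotS divr_gt0// exprn_gt0.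
Qed.

Let g_min s k t : (1 <= s <= d)%N -> (1 <= k <= d)%N ->
  0 < t -> knot s <= t <= knot s.+1 -> g s t <= g k t.
Proof.
move=> /andP[s1 sd] /andP[k1 kd] t0 /andP[ts tS].
have [sk|/ltnW ks] := leqP s k.
  elim: k sk {k1} kd => [|k IH].
    by rewrite leqn0 => /eqP ->.
  rewrite leq_eqVlt => /orP[/eqP <- //|]; rewrite ltnS => sk kd.
  apply: le_trans (IH sk (ltnW kd)) _; apply: g_le => //.
    exact: leq_trans sk.
  by apply: le_trans tS _; apply: knot_le => //; rewrite ltnS // ltnW.
have H j : (j <= s - k)%N -> g s t <= g (s - j) t.
  elim: j => [|j IH]; first by rewrite subn0.
  move=> jk; apply: le_trans (IH (ltnW jk)) _.
  have js : (j < s)%N by apply: leq_trans jk _; exact: leq_subr.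
  have e : (s - j = (s - j.+1).+1)%N by rewrite subnSK.
  have pos : (0 < s - j.+1)%N.
    by rewrite subn_gt0; apply: (leq_ltn_trans jk); rewrite ltn_subrL k1 s1.
  rewrite e; apply: g_ge => //; apply: le_trans ts.
  rewrite -e; apply: knot_le => //; first by rewrite e.
    exact: leq_subr.
  exact: leq_trans sd (leqnSn d).
by have := H _ (leqnn _); rewrite subKn.
Qed.

Variable D : R.
Hypothesis D0 : 0 <= D.

Let Hpiece_min s k t : (1 <= s <= d)%N -> (1 <= k <= d)%N ->
  0 < t -> knot s <= t <= knot s.+1 -> Hpiece D s t <= Hpiece D k t.
Proof.
move=> hs hk t0 st; rewrite /Hpiece le_min ge_min lexx/=.
rewrite ge_min; apply/orP; right; apply: ler_wpM2l.
  by rewrite mulr_ge0// sqrtr_ge0.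
exact: g_min.
Qed.

Let Hpiece_nd s u t : 0 <= u -> u <= t -> Hpiece D s u <= Hpiece D s t.
Proof.
move=> u0 ut; rewrite /Hpiece le_min ge_min lexx/= ge_min; apply/orP; right.
apply: ler_pM; rewrite ?powR_ge0 ?mulr_ge0 ?sqrtr_ge0 ?ler_wpM2l ?ler_wsqrtr//.
apply: ge0_ler_powR; rewrite ?nnegrE ?divr_ge0 ?invr_ge0 ?ler0n ?(le_trans u0)//.
by rewrite ler_pM2r ?invr_gt0.
Qed.

Let clamp t : R := Num.max 1 (Num.min t (cumside d)%:R).

Let clamp_ge1 t : 1 <= clamp t. Proof. by rewrite le_max lexx. Qed.

Let clamp_gt0 t : 0 < clamp t. Proof. exact: lt_le_trans (clamp_ge1 t). Qed.

Let clamp_le t : clamp t <= knot d.+1.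
Proof.
rewrite knot_end /clamp ge_max; apply/andP; split; last by rewrite ge_min lexx orbT.
by rewrite (ler_nat _ 1) -(ltr0n R).
Qed.

Let index t := (find (fun k => clamp t <= knot k.+1) (iota 1 d)).+1.

Hypothesis d_gt0 : (0 < d)%N.

Let index_bound t : (1 <= index t <= d)%N.
Proof.
rewrite /index /= -[X in (_ < X)%N](size_iota 1 d) -has_find.
apply/hasP; exists d; last exact: clamp_le.
by rewrite mem_iota d_gt0 add1n ltnSn.
Qed.

Let index_knot t : knot (index t) <= clamp t <= knot (index t).+1.
Proof.
have /andP[_ id] := index_bound t; apply/andP; split; last first.
  have hs : has (fun k => clamp t <= knot k.+1) (iota 1 d).
    by rewrite has_find size_iota.
  by have := nth_find 0%N hs; rewrite nth_iota ?add1n.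
rewrite /index; set i := find _ _.
case E : i => [|j]; first by rewrite knot_1.
have ji : (j < i)%N by rewrite E.
have := before_find 0%N ji; rewrite nth_iota; first by rewrite add1n => /negbT; rewrite -ltNge => /ltW.
by apply: leq_trans ji _; exact: ltnW.
Qed.

Lemma HfunE s t : (1 <= s <= d)%N -> knot s <= t <= knot s.+1 ->
  Hfun D t = Hpiece D s t.
Proof.
move=> hs st; have /andP[s1 sd] := hs; have /andP[st1 st2] := st.
have ct : clamp t = t.
  rewrite /clamp (min_idPl _); last first.
    by apply: le_trans st2 _; rewrite -knot_end; apply: knot_le.
  by apply/max_idPr; apply: le_trans st1; rewrite -knot_1; apply: knot_le => //; exact: ltnW.
have := index_knot t; have := index_bound t; have := clamp_gt0 t.
rewrite /Hfun -/(clamp t) -/(index t) ct => t0 hi it.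
by apply/eqP; rewrite eq_le !Hpiece_min.
Qed.

Let HfunEmin t : Hfun D t = \big[Num.min/1]_(k <- iota 1 d) Hpiece D k (clamp t).
Proof.
rewrite /Hfun -/(clamp t) -/(index t); apply/eqP; rewrite eq_le; apply/andP; split.
  rewrite big_seq; elim/big_ind: _ => [|u v hu hv|k].
  - by rewrite ge_min lexx.
  - by rewrite le_min hu.
  - rewrite mem_iota add1n ltnS => hk; apply: Hpiece_min => //.
have hi : index t \in iota 1 d by rewrite mem_iota add1n ltnS.
elim: (iota 1 d) hi => [//|k l IH]; rewrite in_cons big_cons ge_min.
by case: eqVneq => [<-|_ /IH ->]; rewrite ?lexx ?orbT.
Qed.

Lemma Hfun_nd : {homo Hfun D : u t / u <= t}.
Proof.
move=> u t ut; rewrite /Hfun -!/(clamp _) -!/(index _).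
have ct : clamp u <= clamp t.
  rewrite /clamp ge_max le_max lexx /= le_max; apply/orP; right.
  by rewrite le_min !ge_min ut lexx orbT.
apply: le_trans (Hpiece_nd _ _ ct); last exact: ltW.
exact: Hpiece_min.
Qed.

Let clamp_continuous : continuous clamp.
Proof.
move=> t.
apply: (@continuous_max R R (cst 1) (idfun \min cst (cumside d)%:R)).
  exact: cvg_cst.
by apply: continuous_min; [exact: cvg_id | exact: cvg_cst].
Qed.

Let Hpiece_continuous k t : 0 < t -> {for t, continuous (Hpiece D k)}.
Proof.
move=> t0; apply: (@continuous_min R R (cst 1)
  (fun t => D * Num.sqrt t * (t / (cumside k)%:R) `^ k%:R^-1)).
  exact: cvg_cst.
apply: cvgM; first by apply: cvgM; [exact: cvg_cst | exact: sqrt_continuous].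
have cf : {for t, continuous (fun u : R => u / (cumside k)%:R)}.
  by apply: cvgM; [exact: cvg_id|exact: cvg_cst].
have cg : {for t / (cumside k)%:R, continuous (fun u : R => u `^ k%:R^-1)}.
  apply/differentiable_continuous/derivable1_diffP/derivable_powR.
  by rewrite in_itv/= andbT divr_gt0.
exact: (continuous_comp cf cg).
Qed.

Lemma Hfun_continuous : continuous (Hfun D).
Proof.
rewrite (funext HfunEmin) => t; elim: (iota 1 d) => [|k l IH].
  by under eq_fun do rewrite big_nil; exact: cvg_cst.
under eq_fun do rewrite big_cons.
apply: (@continuous_min R R (Hpiece D k \o clamp)
  (fun t => \big[Num.min/1]_(j <- l) Hpiece D j (clamp t))) => //.
by apply: continuous_comp; [exact: clamp_continuous | exact: Hpiece_continuous].
Qed.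

End Knots.

Section Htilde.
Variables (R : realType) (d : nat) (n : 'I_d -> nat) (a b : lattice n).

Definition sides_sorted : Prop :=
  forall s, (1 <= s < d)%N -> (side a b s.+1 <= side a b s)%N.

Lemma side_gt0 s : (0 < side a b s)%N.
Proof. by rewrite /side; case: insub. Qed.

Lemma side_end : side a b d.+1 = 1%N.
Proof. by rewrite /side insubF//= ltnn. Qed.

(* The proof hs does not enter the values of the function; it is what makes it
   monotone, hence a Stieltjes integrator (Cumulative instance below). *)
Definition Htilde (hs : sides_sorted) (Delta : {nonneg R}) (t : R) : R :=
  Hfun d (side a b) Delta%:num t.

Variables (hs : sides_sorted) (Delta : {nonneg R}).

Let Htilde_const : d = 0%N -> Htilde hs Delta = cst (Htilde hs Delta 1).
Proof.
move=> d0; apply/funext => t; rewrite /Htilde /cst.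
move: (side a b) (Delta%:num) => m D; rewrite d0 /Hfun.
have c : cumside m 0 = 1%N by rewrite /cumside big_geq.
have e u : Num.max 1 (Num.min u (cumside m 0)%:R) = 1 :> R.
  by rewrite c; apply/max_idPl; rewrite ge_min lexx orbT.
by rewrite !e.
Qed.

Lemma Htilde_nondecreasing : {homo Htilde hs Delta : u t / u <= t}.
Proof.
case: (posnP d) => [/Htilde_const -> //|d0]; apply: Hfun_nd => //.
- exact: side_gt0.
- exact: side_end.
Qed.

Lemma Htilde_continuous : continuous (Htilde hs Delta).
Proof.
case: (posnP d) => [/Htilde_const -> t|d0]; first exact: cvg_cst.
apply: Hfun_continuous => //.
- exact: side_gt0.
- exact: side_end.
Qed.

Let Htilde_right_continuous : right_continuous (Htilde hs Delta).
Proof. exact/right_continuousW/Htilde_continuous. Qed.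

HB.instance Definition _ := isCumulative.Build R _ R (Htilde hs Delta)
  Htilde_nondecreasing Htilde_right_continuous.

Lemma HtildeE s t : (1 <= s <= d)%N ->
  knot R (side a b) s <= t <= knot R (side a b) s.+1 ->
  Htilde hs Delta t =
    Num.min 1 (Delta%:num * Num.sqrt t *
               (t / (cumside (side a b) s)%:R) `^ s%:R^-1).
Proof.
move=> sd st; have /andP[s1 s2] := sd.
have d0 : (0 < d)%N by exact: leq_trans s2.
by apply: HfunE => //; [exact: side_gt0 | exact: side_end].
Qed.

Definition Hmass (q : R) : R :=
  Htilde hs Delta 1
  + \int[lebesgue_stieltjes_measure (Htilde hs Delta)]_(t in
      `[1, (cumside (side a b) d)%:R]) t `^ (- (q / 2)).

End Htilde.

Section Rates.
Variables (R : realType).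

(* 2 / (q - 1) is +oo for q = 1, hence s_1 = d + 1. *)
Definition s_crit (q : R) (d : nat) : nat :=
  if q == 1 then d.+1 else minn `|Num.ceil (2 / (q - 1))| d.+1.

Definition log_plus (r : R) : R := Num.max 1 (ln r).

(* For Delta = 0 the second quotient is +oo and drops out of the minimum. *)
Definition Lambda (m : nat -> nat) (q Delta : R) (s : nat) : R :=
  let r1 := (m s)%:R / (m s.+1)%:R in
  let r2 := ((m s)%:R / (cumside m s)%:R `^ (s + 2)%:R^-1)
            / Delta `^ (2 / (s + 2)%:R) in
  log_plus (if Delta == 0 then r1 else Num.min r1 r2)
    ^+ ((q != 1) && (2 / (q - 1) == s%:R)).

End Rates.

(* Main.v *)
Require Import Defs.
From HB Require Import structures.
From mathcomp Require Import all_boot all_order all_algebra.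
From mathcomp Require Import all_classical all_reals all_analysis measurable_realfun.
From mathcomp Require Import ring lra zify.

Set Implicit Arguments.
Unset Strict Implicit.
Unset Printing Implicit Defensive.

Import Order.TTheory GRing.Theory Num.Theory.
Import numFieldNormedType.Exports.

Local Open Scope classical_set_scope.
Local Open Scope ring_scope.

(** Why the risk bound holds. Write [p] for the maximum of [q] and 2, and let [z]
    be a point of the box [a, b]. For any [v] above [z], choosing [v] as upper corner
    in the minima bounds the block estimator at [z] by [f v] plus the largest average
    of the noise over the boxes [u, v] with [u] below [z] ([block_value_le]). All
    these boxes contain [z, v], and their maximal average has [p]-th moment of the
    order of [(sigma / Num.sqrt (volume z v)) `^ p], as if there were no maximum
    ([maximal_inequality]). The best [v] is the upper corner of the largest box on
    which [f] increases by at most [sigma / Num.sqrt (volume z v)]; calling the volume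
    of this box the span of [z], the positive part of the error at [z] has [q]-th
    moment of the order of [sigma `^ q * span z `^ (- (q / 2))]. Lower corners treat
    the negative part in the same way.

    The maximal inequality is proved one coordinate at a time. With the other side
    lengths fixed, the noise summed over a box grows by independent increments as
    one side length grows, so that the maximum of the absolute sums over all the other
    side lengths is a submartingale ([submart_maxfun]). Doob's inequality handles the
    lengths of a dyadic range, and the ranges add up geometrically ([maxfun_step]).
    After all coordinates there remains the moment of a single sum, given by the
    Marcinkiewicz--Zygmund inequality ([moment_sum_le]). Independence is only used
    through products of functions of disjoint sets of variables
    ([growth_expectationM]).

    It remains to count the points whose span is less than [t] ([card_span_lt]).
    The level [t] is the volume of a copy of [a, b] scaled by some [lam], with the
    sides that become shorter than one cut off at one. Shift the points by
    [floor (lam * m j)] in each direction [j]. For a point with small span, either the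
    shift leaves the box, which happens for a proportion of the order of [lam] of the
    points, or [f] increases by more than [sigma / sqrt t] along the shift; as the
    increases along a shift telescope, there are not many points of the second kind
    either. Both counts are governed by [Htilde], and summation by parts over the
    levels turns them into the Stieltjes integral ([sum_span_le]). The points for
    which the whole box above them already has a small increase are set apart: they
    give the product of Lebesgue integrals.

    Why the rates hold. [Htilde] lies below each of the powers that define its
    pieces, on the whole half-line of levels at least one ([Htilde_le_power]). Against
    the weight [t `^ (- (q / 2))], a power with a larger exponent is dominated by the
    upper end of the range, a power with a smaller exponent by the lower end, and
    at equal exponents every dyadic range contributes the same amount, whence the
    logarithm ([integral_growth], [integral_decay], [integral_critical]). The [s]-th
    piece has exponent [1 / 2 + 1 / s], so that the comparison with [q / 2] is that of
    [s] with [2 / (q - 1)]. *)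

(** * Independence from the past *)

Section Cylinders.
Context {disp : measure_display} {T : measurableType disp} {R : realType}.
Variables (P : probability T R) (I : finType) (X : I -> {RV P >-> R}).

Definition cylinder (A : {set I}) : set (set T) :=
  [set E | exists2 B : I -> set R, (forall i, measurable (B i)) &
     E = \bigcap_(i in [set` A]) (X i @^-1` B i)].

(** The sigma-algebra generated by the variables in [A]. The cylinders that
    generate it are closed under intersection, as Dynkin's theorem requires. *)
Definition past (A : {set I}) := g_sigma_algebraType (cylinder A).

Lemma cylinder_setI A : setI_closed (cylinder A).
Proof.
move=> _ _ [B mB ->] [C mC ->]; exists (fun i => B i `&` C i).
  by move=> i; exact: measurableI.
by rewrite -bigcapI; apply: eq_bigcapr => i _; rewrite preimage_setI.
Qed.

Lemma past_sub A : <<s cylinder A >> `<=` @measurable _ T.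
Proof.
apply: smallest_sub; first exact: sigma_algebra_measurable.
move=> _ [B mB ->]; apply: fin_bigcap_measurable; first exact: finite_finset.
by move=> i _; rewrite -[X in measurable X]setTI; exact: measurable_funPT.
Qed.

Lemma past_measurable_fun A d' (U : measurableType d') (G : T -> U) :
  measurable_fun (setT : set (past A)) G -> measurable_fun (setT : set T) G.
Proof. by move=> mG _ B mB; apply: past_sub; exact: mG. Qed.

Lemma past_coord (A : {set I}) i : i \in A -> measurable_fun (setT : set (past A)) (X i).
Proof.
move=> iA _ B mB; rewrite setTI; apply: sub_gen_smallest.
exists (fun j => if j == i then B else setT); first by move=> j; case: eqP.
apply/seteqP; split=> [w Bw j _|w]; first by rewrite /preimage/=; case: eqP => [->|].
by move=> /(_ i iA); rewrite /preimage/= eqxx.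
Qed.

Hypothesis indX : independent_rvs X.

Local Open Scope ereal_scope.

(** By Dynkin's theorem: on cylinders the product rule is the hypothesis of
    independence, and the events that satisfy it are stable under complements
    and countable disjoint unions. *)
Lemma indep_event (A : {set I}) i (B : set R) : i \notin A -> measurable B ->
  forall E, <<s cylinder A >> E ->
  P (E `&` X i @^-1` B) = P E * P (X i @^-1` B).
Proof.
move=> iA mB.
have mF : measurable (X i @^-1` B).
  by rewrite -[X in measurable X]setTI; exact: measurable_funPT.
pose Q (E : set T) := P (E `&` X i @^-1` B) = P E * P (X i @^-1` B).
have QT : Q setT by rewrite /Q setTI probability_setT mul1e.
have QG : cylinder A `<=` Q.
  move=> _ [C mC ->]; pose D j := if j == i then B else C j.
  have mD j : measurable (D j) by rewrite /D; case: eqP.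
  have e (J : {set I}) : i \notin J ->
      \bigcap_(j in [set` J]) (X j @^-1` D j) = \bigcap_(j in [set` J]) (X j @^-1` C j).
    move=> iJ; apply: eq_bigcapr => j /= jJ; rewrite /D; case: eqP => // ji.
    by move: iJ; rewrite -ji jJ.
  rewrite /Q; have -> : \bigcap_(j in [set` A]) (X j @^-1` C j) `&` X i @^-1` B =
      \bigcap_(j in [set` (i |: A)%SET]) (X j @^-1` D j).
    rewrite -e//; apply/seteqP; split=> [w [h1 h2] j /=|w h].
      rewrite in_setU1 => /predU1P[->|jA]; first by rewrite /D /preimage/= eqxx.
      exact: h1.
    split; first by move=> j jA; apply: h; rewrite /= in_setU1 jA orbT.
    by have := h i; rewrite /= setU11 /D /preimage/= eqxx; exact.
  rewrite (indX (fun j _ => mD j)) big_setU1//= -e// (indX (fun j _ => mD j)) muleC.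
  by have -> : D i = B by rewrite /D eqxx.
have QC (S : set T) : measurable S -> Q S -> Q (~` S).
  rewrite /Q => mS PS.
  have fS : P (S `&` X i @^-1` B) \is a fin_num by apply: fin_num_measure; exact: measurableI.
  rewrite (setIC (~` S)) -setDE measureD//; last by rewrite ltey_eq fin_num_measure.
  rewrite probability_setC// (setIC _ S) [X in _ - X]PS muleBl ?fin_num_adde_defr ?fin_num_measure//.
  by rewrite mul1e.
have QU (F : (set T)^nat) : (forall k, measurable (F k)) -> trivIset setT F ->
    (forall k, Q (F k)) -> Q (\bigcup_k F k).
  rewrite /Q => mF' tF PF; rewrite setI_bigcupl.
  rewrite (measure_bigcup P setT F)// measure_bigcup//=; last 2 first.
  - by move=> k _; exact: measurableI.
  - by move=> k l _ _ [w [[w1 _] [w2 _]]]; apply: tF => //; exists w.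
  have fB : P (X i @^-1` B) \is a fin_num by exact: fin_num_measure.
  rewrite muleC -(fineK fB) -nneseriesZl//.
  by apply: eq_eseriesr => k _; rewrite fineK// muleC; exact: PF.
apply: (@dynkin_induction _ (past A) (cylinder A) Q) => //.
- exact: cylinder_setI.
- by move=> S /past_sub; exact: QC.
- by move=> F mF' tF PF; apply: QU => // k; apply: past_sub; exact: mF'.
Qed.
End Cylinders.

(** * Expectation of a product *)

Section ProductExpectation.
Context {disp : measure_display} {T : measurableType disp} {R : realType}.
Variable P : probability T R.
Implicit Types U V : T -> R.

Definition indep2 U V := forall B C : set R, measurable B -> measurable C ->
  P (U @^-1` B `&` V @^-1` C) = (P (U @^-1` B) * P (V @^-1` C))%E.

Lemma indep2_comp U V (g h : R -> R) : measurable_fun setT g -> measurable_fun setT h ->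
  indep2 U V -> indep2 (g \o U) (h \o V).
Proof.
move=> mg mh UV B C mB mC; apply: (UV (g @^-1` B) (h @^-1` C)).
  by rewrite -[X in measurable X]setTI; exact: mg.
by rewrite -[X in measurable X]setTI; exact: mh.
Qed.

(** Independence makes the joint law the product of the marginal laws, to which
    Tonelli's theorem applies. *)
Lemma indep2_ge0_expectationM U V : measurable_fun setT U -> measurable_fun setT V ->
  (forall w, 0 <= U w) -> (forall w, 0 <= V w) -> indep2 U V ->
  (\int[P]_w (U w * V w)%:E = (\int[P]_w (U w)%:E) * \int[P]_w (V w)%:E)%E.
Proof.
move=> mU mV U0 V0 UV.
pose U' : {RV P >-> R} := HB.pack U (isMeasurableFun.Build _ _ _ _ _ mU).
pose V' : {RV P >-> R} := HB.pack V (isMeasurableFun.Build _ _ _ _ _ mV).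
pose W w := (U w, V w).
have mW : measurable_fun setT W by exact: measurable_fun_pair.
pose W' : {mfun T >-> (R * R)%type} := HB.pack W (isMeasurableFun.Build _ _ _ _ _ mW).
pose f (z : (R * R)%type) : \bar R := (`|z.1| * `|z.2|)%:E.
have mf : measurable_fun setT f.
  apply/measurable_EFinP; apply: measurable_funM; exact: measurableT_comp.
have f0 z : (0 <= f z)%E by rewrite lee_fin mulr_ge0.
transitivity (\int[distribution P W']_z f z)%E.
  rewrite ge0_integral_pushforward//; apply: eq_integral => w _.
  by rewrite /f /W /= !ger0_norm.
transitivity (\int[distribution P U' \x distribution P V']_z f z)%E.
  apply: eq_measure_integral => A mA _.
  apply/esym; apply: (@product_measure_unique _ _ _ _ _ (distribution P U') (distribution P V')) => //.
rewrite fubini_tonelli1// /fubini_F /f /=.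
have mn : measurable_fun setT (fun y : R => (`|y|)%:E) by apply/measurable_EFinP; exact: normr_measurable.
under eq_integral => x _.
  under eq_integral do rewrite EFinM.
  rewrite ge0_integralZl//.
  over.
rewrite ge0_integralZr//; last by apply: integral_ge0.
by congr (_ * _)%E; rewrite ge0_integral_pushforward//; apply: eq_integral => w _ /=;
  rewrite ger0_norm.
Qed.

Lemma indep2_integrableM U V : P.-integrable setT (EFin \o U) ->
  P.-integrable setT (EFin \o V) -> indep2 U V ->
  P.-integrable setT (EFin \o (U \* V)).
Proof.
move=> iU iV UV.
have mU : measurable_fun setT U by apply/measurable_EFinP; exact: (measurable_int P).
have mV : measurable_fun setT V by apply/measurable_EFinP; exact: (measurable_int P).
apply/integrableP; split; first by apply/measurable_EFinP; exact: measurable_funM.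
have := @indep2_ge0_expectationM (Num.norm \o U) (Num.norm \o V).
rewrite (_ : (\int[P]_w _)%E = (\int[P]_w `|(EFin \o (U \* V)%R) w|)%E); last first.
  by apply: eq_integral => w _ /=; rewrite normrM.
move=> -> //=.
- case/integrableP: iU => _ /= iU; case/integrableP: iV => _ /= iV.
  by apply: lte_mul_pinfty => //; [exact: integral_ge0|rewrite ge0_fin_numE//; exact: integral_ge0].
- exact: measurableT_comp.
- exact: measurableT_comp.
- by apply: indep2_comp => //; exact: measurableT_comp.
Qed.

Lemma indep2_expectationM U V : P.-integrable setT (EFin \o U) ->
  P.-integrable setT (EFin \o V) -> indep2 U V ->
  \int[P]_w (U w * V w) = (\int[P]_w U w) * \int[P]_w V w.
Proof.
move=> iU iV UV.
have mU : measurable_fun setT U by apply/measurable_EFinP; exact: (measurable_int P).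
have mV : measurable_fun setT V by apply/measurable_EFinP; exact: (measurable_int P).
pose p (x : R) := Num.max x 0; pose m (x : R) := Num.max (- x) 0.
have mp : measurable_fun setT p by exact: measurable_maxr.
have mm : measurable_fun setT m by apply: measurable_maxr => //; exact: measurable_funN.
have pm x : x = p x - m x by rewrite /p /m; case: (lerP x 0); case: (lerP (-x) 0); lra.
have p0 x : 0 <= p x by rewrite le_max lexx orbT.
have m0 x : 0 <= m x by rewrite le_max lexx orbT.
have dom (Z : T -> R) (g : R -> R) : P.-integrable setT (EFin \o Z) ->
    measurable_fun setT g -> (forall x, 0 <= g x <= `|x|) -> P.-integrable setT (EFin \o (g \o Z)).
  move=> iZ mg g0; have mZ : measurable_fun setT Z by apply/measurable_EFinP; exact: (measurable_int P).
  apply: le_integrable iZ => //; first by apply/measurable_EFinP; exact: measurableT_comp.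
  by move=> w _ /=; rewrite lee_fin; have /andP[h1 h2] := g0 (Z w); rewrite ger0_norm.
have pP x : 0 <= p x <= `|x| by rewrite p0 /p ge_max ler_norm normr_ge0.
have mP x : 0 <= m x <= `|x| by rewrite m0 /m ge_max -normrN ler_norm normr_ge0.
have E (g h : R -> R) : measurable_fun setT g -> measurable_fun setT h ->
    (forall x, 0 <= g x <= `|x|) -> (forall x, 0 <= h x <= `|x|) ->
    P.-integrable setT (EFin \o (fun w => g (U w) * h (V w))) /\
    \int[P]_w (g (U w) * h (V w)) = (\int[P]_w g (U w)) * \int[P]_w h (V w).
  move=> mg mh g0 h0.
  have iG := dom _ _ iU mg g0; have iH := dom _ _ iV mh h0.
  have GH := indep2_comp mg mh UV.
  split; first exact: indep2_integrableM iG iH GH.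
  rewrite /Rintegral -fineM ?integrable_fin_num//; congr fine.
  apply: indep2_ge0_expectationM => //.
  - exact: measurableT_comp.
  - exact: measurableT_comp.
  - by move=> w; case/andP: (g0 (U w)).
  - by move=> w; case/andP: (h0 (V w)).
have [i1 e1] := E p p mp mp pP pP.
have [i2 e2] := E p m mp mm pP mP.
have [i3 e3] := E m p mm mp mP pP.
have [i4 e4] := E m m mm mm mP mP.
have EU : \int[P]_w U w = \int[P]_w p (U w) - \int[P]_w m (U w).
  rewrite -RintegralB//; last 2 first.
    exact: dom.
    exact: dom.
  by apply: eq_Rintegral => w _; rewrite -pm.
have EV : \int[P]_w V w = \int[P]_w p (V w) - \int[P]_w m (V w).
  rewrite -RintegralB//; last 2 first.
    exact: dom.
    exact: dom.
  by apply: eq_Rintegral => w _; rewrite -pm.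
have -> : \int[P]_w (U w * V w) =
    \int[P]_w ((p (U w) * p (V w) - p (U w) * m (V w)) - (m (U w) * p (V w) - m (U w) * m (V w))).
  by apply: eq_Rintegral => w _; rewrite {1}(pm (U w)) {1}(pm (V w)); ring.
have i12 := integrableB measurableT i1 i2.
have i34 := integrableB measurableT i3 i4.
rewrite RintegralB// RintegralB// RintegralB// e1 e2 e3 e4 EU EV; ring.
Qed.
End ProductExpectation.

(** * Powers and growth classes *)

Section PowerInequalities.
Context {R : realType}.
Implicit Types x y s p r : R.

Lemma powR_addr_le x y p : 0 <= x -> 0 <= y -> 0 <= p ->
  (x + y) `^ p <= 2 `^ p * (x `^ p + y `^ p).
Proof.
move=> x0 y0 p0.
have h : (x + y) `^ p <= (2 * Num.max x y) `^ p.
  apply: ge0_ler_powR => //; rewrite ?nnegrE; [lra| |].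
  - by rewrite mulr_ge0// le_max x0.
  - by case: (lerP x y); lra.
apply: le_trans h _; rewrite powRM// ?le_max ?x0//.
apply: ler_wpM2l; first exact: powR_ge0.
by case: (lerP x y) => _; rewrite ?lerDr ?lerDl powR_ge0.
Qed.

(** Trading an exponent for a larger one at the scale [s]; this is what replaces
    Lyapunov's inequality between moments. *)
Lemma powR_interp y s r p : 0 <= y -> 0 < s -> 0 <= r -> r <= p ->
  y `^ r <= s `^ r * (1 + (y / s) `^ p).
Proof.
move=> y0 s0 r0 rp.
have ys : 0 <= y / s by rewrite divr_ge0 // ltW.
have -> : y `^ r = s `^ r * (y / s) `^ r.
  by rewrite -powRM ?(ltW s0)// mulrC divfK// gt_eqF.
apply: ler_wpM2l; first exact: powR_ge0.
have [h|h] := lerP (y / s) 1.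
  apply: (@le_trans _ _ 1); last by rewrite lerDl powR_ge0.
  have <- : 1 `^ r = 1 :> R by rewrite powR1.
  by apply: ge0_ler_powR => //; rewrite nnegrE.
apply: (@le_trans _ _ ((y / s) `^ p)); last by rewrite lerDr.
by apply: ler_powR => //; exact: ltW.
Qed.

Lemma powR_pred x r : 0 <= x -> 0 < r -> x * x `^ (r - 1) = x `^ r.
Proof.
move=> x0 r0; have [->|xn] := eqVneq x 0; first by rewrite mul0r powR0// gt_eqF.
rewrite -{1}(@powRr1 _ x)// -powRD; first by congr (_ `^ _); lra.
by rewrite xn implybT.
Qed.

End PowerInequalities.

Section Domination.
Context {disp : measure_display} {T : measurableType disp} {R : realType}.
Variables (P : probability T R) (I : finType) (X : I -> {RV P >-> R}).

Lemma past_subset (A B : {set I}) d' (U : measurableType d') (G : T -> U) :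
  A \subset B -> measurable_fun (setT : set (past X A)) G ->
  measurable_fun (setT : set (past X B)) G.
Proof.
move=> /fintype.subsetP AB mG _ C mC; have := mG measurableT C mC.
rewrite !setTI; apply: smallest_sub; first exact: smallest_sigma_algebra.
move=> _ [D mD ->]; apply: sub_gen_smallest.
exists (fun i => if i \in A then D i else setT); first by move=> i; case: ifP.
apply/seteqP; split=> w Dw i /= iA.
  by rewrite /preimage/=; case: ifP => // iA'; exact: Dw.
by have := Dw i (AB _ iA); rewrite /preimage/= iA.
Qed.

Definition envelope (w : T) : R := 1 + \sum_i `|X i w|.

Lemma envelope_ge1 w : 1 <= envelope w.
Proof. by rewrite lerDl sumr_ge0. Qed.

Lemma envelope_ge0 w : 0 <= envelope w.
Proof. exact: le_trans (envelope_ge1 w). Qed.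

Lemma envelope_neq0 w : envelope w != 0.
Proof. exact/lt0r_neq0/(lt_le_trans ltr01 (envelope_ge1 w)). Qed.

(** Functions of the variables in [A] with growth of order [r]: the class in
    which every random variable below lives, so that measurability and
    integrability follow from closure properties. *)
Definition growth (A : {set I}) (r : R) (Z : T -> R) :=
  measurable_fun (setT : set (past X A)) Z /\
  exists2 c : R, 0 <= c & forall w, `|Z w| <= c * envelope w `^ r.

Implicit Types (A B : {set I}) (Z Y : T -> R) (r s : R).

Lemma growth_subset A B r Z : A \subset B -> growth A r Z -> growth B r Z.
Proof. by move=> AB [mZ h]; split => //; exact: past_subset mZ. Qed.

Lemma growth_setT A r Z : growth A r Z -> growth [set: I] r Z.
Proof. by apply: growth_subset; exact: finset.subsetT. Qed.

Lemma growth_le A r s Z : r <= s -> growth A r Z -> growth A s Z.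
Proof.
move=> rs [mZ [c c0 h]]; split => //; exists c => // w.
apply: le_trans (h w) _; apply: ler_wpM2l => //; apply: ler_powR => //.
exact: envelope_ge1.
Qed.

Lemma growth_cst A c : growth A 0 (cst c).
Proof.
split; first exact: measurable_cst.
by exists `|c| => // w; rewrite powRr0 mulr1.
Qed.

Lemma growth_coord A i : i \in A -> growth A 1 (X i).
Proof.
move=> iA; split; first exact: past_coord.
exists 1 => // w; rewrite mul1r powRr1 ?envelope_ge0//.
rewrite /envelope (bigD1 i)//= addrCA lerDl addr_ge0// sumr_ge0//.
Qed.

Lemma growthD A r Z Y : growth A r Z -> growth A r Y -> growth A r (fun w => Z w + Y w).
Proof.
move=> [mZ [c c0 hc]] [mY [e e0 he]]; split; first exact: measurable_funD.
exists (c + e); first exact: addr_ge0.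
by move=> w; rewrite mulrDl; apply: le_trans (ler_normD _ _) _; exact: lerD.
Qed.

Lemma growthM A r s Z Y : growth A r Z -> growth A s Y -> growth A (r + s) (fun w => Z w * Y w).
Proof.
move=> [mZ [c c0 hc]] [mY [e e0 he]]; split; first exact: measurable_funM.
exists (c * e); first exact: mulr_ge0.
move=> w; rewrite powRD; last by rewrite envelope_neq0 implybT.
by rewrite mulrACA normrM; apply: ler_pM.
Qed.

Lemma growthMl A r c Z : growth A r Z -> growth A r (fun w => c * Z w).
Proof. by move=> gZ; have := growthM (growth_cst A c) gZ; rewrite add0r. Qed.

Lemma growthN A r Z : growth A r Z -> growth A r (fun w => - Z w).
Proof.
move=> [mZ [c c0 hc]]; split; first exact: measurable_funN.
by exists c => // w; rewrite normrN.
Qed.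

Lemma growth_norm A r Z : growth A r Z -> growth A r (fun w => `|Z w|).
Proof.
move=> [mZ [c c0 hc]]; split; first exact: measurableT_comp.
by exists c => // w; rewrite normr_id.
Qed.

Lemma growth_max A r Z Y : growth A r Z -> growth A r Y ->
  growth A r (fun w => Num.max (Z w) (Y w)).
Proof.
move=> [mZ [c c0 hc]] [mY [e e0 he]]; split; first exact: measurable_maxr.
exists (c + e); first exact: addr_ge0.
move=> w; rewrite mulrDl.
have E0 := powR_ge0 (envelope w) r.
by case: (lerP (Z w) (Y w)) => _; [apply: le_trans (he w) _ | apply: le_trans (hc w) _];
  rewrite ?lerDl ?lerDr mulr_ge0.
Qed.

Lemma growth_sum A r (J : Type) (l : seq J) (Q : pred J) (Z : J -> T -> R) :
  (forall j, Q j -> growth A r (Z j)) -> 0 <= r ->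
  growth A r (fun w => \sum_(j <- l | Q j) Z j w).
Proof.
move=> gZ r0; elim: l => [|j l IH].
  apply: growth_le r0 _; have := growth_cst A 0; congr growth.
  by apply/funext => w; rewrite big_nil.
case Qj : (Q j); last first.
  by move: IH; congr growth; apply/funext => w; rewrite big_cons Qj.
rewrite (_ : (fun _ => _) = (fun w => Z j w + \sum_(k <- l | Q k) Z k w)).
  by apply: growthD => //; exact: gZ.
by apply/funext => w; rewrite big_cons Qj.
Qed.

Lemma growth_powR A r s Z : growth A r Z -> 0 <= s ->
  growth A (r * s) (fun w => `|Z w| `^ s).
Proof.
move=> [mZ [c c0 hc]] s0; split.
  by apply: (measurableT_comp (measurable_powR s)); exact: measurableT_comp.
exists (c `^ s); first exact: powR_ge0.
move=> w; have -> : c `^ s * envelope w `^ (r * s) = (c * envelope w `^ r) `^ s.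
  by rewrite powRM ?powR_ge0// powRrM.
rewrite ger0_norm; last exact: powR_ge0.
by apply: ge0_ler_powR => //; rewrite ?nnegrE// mulr_ge0 ?powR_ge0.
Qed.

Lemma growth_le_indic A r Z Y : growth A r Z -> growth A r Y ->
  growth A 0 (fun w => (Z w <= Y w)%R%:R).
Proof.
move=> [mZ _] [mY _]; split; last first.
  by exists 1 => // w; rewrite powRr0 mulr1; rewrite ger0_norm ?ler0n ?lern1 ?leq_b1.
have m1 : measurable_fun (setT : set (past X A)) (fun w => Z w <= Y w).
  exact: measurable_fun_ler.
have -> : (fun w => (Z w <= Y w)%R%:R) = (fun w => if Z w <= Y w then 1 else 0 : R).
  by apply/funext => w; case: (_ <= _).
by apply: (measurable_fun_ifT m1) => //; exact: measurable_cst.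
Qed.

Variables (p : R).
Hypothesis p1 : 1 <= p.
Hypothesis Xp : forall i, P.-integrable setT (EFin \o (fun w => `|X i w| `^ p)).

Lemma envelope_integrable : P.-integrable setT (EFin \o (fun w => envelope w `^ p)).
Proof.
have p0 : 0 <= p by exact: le_trans p1.
have ms (l : seq I) : measurable_fun setT (fun w => 1 + \sum_(i <- l) `|X i w|).
  apply: measurable_funD => //; apply: measurable_sum => i.
  exact: measurableT_comp.
have H (l : seq I) : P.-integrable setT (EFin \o (fun w => (1 + \sum_(i <- l) `|X i w|) `^ p)).
  elim: l => [|i l IH].
    rewrite (_ : _ \o _ = cst 1%E); last by apply/funext => w /=; rewrite big_nil addr0 powR1.
    exact: finite_measure_integrable_cst.
  have b0 w : 0 <= 1 + \sum_(j <- l) `|X j w| by rewrite addr_ge0// sumr_ge0.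
  pose Z w := 2 `^ p * (`|X i w| `^ p + (1 + \sum_(j <- l) `|X j w|) `^ p).
  have iZ : P.-integrable setT (EFin \o Z).
    rewrite (_ : _ \o _ = (fun w => (2 `^ p)%:E * ((`|X i w| `^ p)%:E + ((1 + \sum_(j <- l) `|X j w|) `^ p)%:E))%E).
      by apply: integrableZl => //; apply: integrableD => //; exact: Xp.
    by apply/funext => w; rewrite /Z/= EFinM.
  apply: le_integrable iZ => //.
    apply/measurable_EFinP; apply: (measurableT_comp (measurable_powR p)).
    exact: ms.
  move=> w _; rewrite /= lee_fin big_cons addrCA ger0_norm ?powR_ge0//.
  rewrite [leRHS]ger0_norm; first by apply: powR_addr_le.
  by rewrite mulr_ge0 ?powR_ge0// addr_ge0 ?powR_ge0.
exact: H.
Qed.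

Lemma growth_measurable A r Z : growth A r Z -> measurable_fun (setT : set T) Z.
Proof. by case=> mZ _; exact: past_measurable_fun mZ. Qed.

Lemma growth_integrable A r Z : growth A r Z -> r <= p -> P.-integrable setT (EFin \o Z).
Proof.
move=> gZ rp; have [mZ [c c0 hc]] := growth_le rp gZ.
have iE : P.-integrable setT (EFin \o (fun w => c * envelope w `^ p)).
  rewrite (_ : _ \o _ = (fun w => c%:E * (envelope w `^ p)%:E)%E).
    by apply: integrableZl => //; exact: envelope_integrable.
  by apply/funext => w; rewrite /= EFinM.
apply: le_integrable iE => //.
  by apply/measurable_EFinP; exact: growth_measurable gZ.
move=> w _ /=; rewrite lee_fin (le_trans (hc w))// ler_norm//.
Qed.

Hypothesis indX : independent_rvs X.

Lemma growth_indep2 A r Z i (h : R -> R) : growth A r Z -> i \notin A ->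
  measurable_fun setT h -> indep2 P Z (h \o X i).
Proof.
move=> [mZ _] iA mh B C mB mC.
apply: (@indep_event _ _ _ _ _ _ indX A i (h @^-1` C) iA); first by rewrite -[X in measurable X]setTI; exact: mh.
by rewrite -[X in _ X]setTI; exact: mZ.
Qed.

Lemma growth_expectationM A r s Z i (h : R -> R) : growth A r Z -> i \notin A ->
  r <= p -> s <= p -> growth [set: I] s (h \o X i) -> measurable_fun setT h ->
  \int[P]_w (Z w * h (X i w)) = (\int[P]_w Z w) * \int[P]_w h (X i w).
Proof.
move=> gZ iA rp sp gh mh.
have iZ := growth_integrable gZ rp; have ih := growth_integrable gh sp.
exact: indep2_expectationM iZ ih (growth_indep2 gZ iA mh).
Qed.

Hypothesis X0 : forall i, ('E_P[X i] = 0)%E.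

(** The martingale property, without conditional expectations: a centred variable
    is orthogonal to every function of the other ones. *)
Lemma growth_orthogonal A r Z i : growth A r Z -> i \notin A -> r <= p ->
  \int[P]_w (Z w * X i w) = 0.
Proof.
move=> gZ iA rp.
have gX : growth [set: I] 1 (id \o X i) by exact: growth_coord.
rewrite (growth_expectationM gZ iA rp p1 gX)//.
have := X0 i; rewrite unlock /Rintegral => ->/=.
by rewrite mulr0.
Qed.

End Domination.

(** * A Taylor bound for powers *)

Section TaylorBound.
Context {R : realType}.
Implicit Types p s e x y : R.

Lemma expR_ge2 x : 1 <= x -> 2 <= expR x.
Proof. by move=> x1; apply: le_trans (expR_ge1Dx x); lra. Qed.

Lemma le_expR_id x : x <= expR x.
Proof. by apply: le_trans (expR_ge1Dx x); lra. Qed.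

Lemma powR_le_expR a k p : 0 < a -> a <= expR k -> 0 <= p -> a `^ p <= expR (k * p).
Proof.
move=> a0 ak p0; rewrite expRM; apply: ge0_ler_powR => //; rewrite nnegrE ltW//.
exact: expR_gt0.
Qed.

Lemma expR_quadratic_bound x m : x <= m -> 0 <= m ->
  expR x <= 1 + x + x ^+ 2 * expR m.
Proof.
move=> xm m0.
have h : expR x - 1 <= x * expR x.
  have := expR_ge1Dx (- x); rewrite -(ler_pM2r (expR_gt0 x)) -expRD addNr expR0.
  by rewrite mulrDl mul1r mulNr; lra.
have e0 := expR_gt0 x; have em : expR x <= expR m by rewrite ler_expR.
have m1 : 1 <= expR m by rewrite -expR0 ler_expR.
have x2 := sqr_ge0 x.
have [x0|x0] := lerP 0 x.
  have : x * (expR x - 1) <= x * (x * expR x) by rewrite ler_wpM2l.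
  have : x ^+ 2 * expR x <= x ^+ 2 * expR m by rewrite ler_wpM2l.
  by rewrite expr2; nra.
have : x ^+ 2 <= x ^+ 2 * expR m by rewrite ler_peMr.
have := expR_ge1Dx x.
by nra.
Qed.

(** When [e] is small with respect to [s], expand [(1 + e / s) `^ p] to the
    second order; otherwise every term is dominated by [`|e| `^ p]. *)
Lemma powR_taylor p s e : 2 <= p ->
  `|s + e| `^ p <= `|s| `^ p + p * (`|s| `^ (p - 2) * s * e)
     + expR (3 * p) * (`|s| `^ (p - 2) * e ^+ 2 + `|e| `^ p).
Proof.
move=> p2; have p0 : 0 <= p by lra.
have pp0 : 0 <= p - 2 by lra.
have E2 : 2 <= expR p by apply: expR_ge2; lra.
have E0 := expR_gt0 p.
have e1 : 2 <= expR 1 :> R by exact: expR_ge2.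
have e2 : 4 <= expR 2 :> R.
  by rewrite (_ : 2 = 1 + 1)// expRD; nra.
have E3 : expR (3 * p) = expR p * expR p * expR p by rewrite -!expRD; congr expR; lra.
have pE := le_expR_id p.
have ep := powR_ge0 `|e| p.
have [h|h] := lerP `|s| (2 * `|e|).
  have L : `|s + e| `^ p <= expR p * expR p * `|e| `^ p.
    apply: (@le_trans _ _ ((4 * `|e|) `^ p)).
      apply: ge0_ler_powR; rewrite ?nnegrE ?mulr_ge0//.
      by apply: le_trans (ler_normD _ _) _; have := normr_ge0 e; lra.
    rewrite powRM//; apply: ler_wpM2r => //.
    by rewrite -expRD -[p + p]/(p + p) (_ : p + p = 2 * p); [exact: powR_le_expR|lra].
  have M : `|s| `^ (p - 2) * `|s| * `|e| <= expR p * `|e| `^ p.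
    have : `|s| `^ (p - 2) * `|s| * `|e| <= (2 * `|e|) `^ (p - 2) * (2 * `|e|) * (2 * `|e|).
      apply: ler_pM; rewrite ?mulr_ge0 ?powR_ge0//; last by have := normr_ge0 e; lra.
      apply: ler_pM; rewrite ?powR_ge0//.
      by apply: ge0_ler_powR; rewrite ?nnegrE ?mulr_ge0.
    have b0 : 0 <= 2 * `|e| by rewrite mulr_ge0.
    move/le_trans; apply; rewrite -mulrA mulrC -mulrA -(_ : p - 1 - 1 = p - 2); last by lra.
    rewrite powR_pred//; last by lra.
    rewrite powR_pred//; last by lra.
    rewrite powRM//; apply: ler_wpM2r => //.
    by rewrite -[p in leRHS]mul1r; apply: powR_le_expR.
  have N : - (expR p * (expR p * `|e| `^ p)) <= p * (`|s| `^ (p - 2) * s * e).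
    rewrite lerNl -mulrN.
    apply: (@le_trans _ _ (p * (`|s| `^ (p - 2) * `|s| * `|e|))).
      apply: ler_wpM2l => //; apply: le_trans (ler_norm _) _.
      by rewrite normrN !normrM ger0_norm// powR_ge0.
    by apply: ler_pM => //; rewrite !mulr_ge0// powR_ge0.
  have S0 := powR_ge0 `|s| p.
  have Q0 : 0 <= `|s| `^ (p - 2) * e ^+ 2 by rewrite mulr_ge0 ?powR_ge0 ?sqr_ge0.
  have E30 : 0 <= expR (3 * p) by exact: expR_ge0.
  have F1 : 0 <= expR (3 * p) * (`|s| `^ (p - 2) * e ^+ 2) by exact: mulr_ge0.
  have F2 : 0 <= (expR p - 2) * (expR p * expR p * `|e| `^ p) by rewrite !mulr_ge0//; lra.
  rewrite mulrDr.
  have -> : expR (3 * p) * `|e| `^ p = (expR p - 2) * (expR p * expR p * `|e| `^ p)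
      + 2 * (expR p * expR p * `|e| `^ p) by rewrite E3; ring.
  rewrite mulrA in N; lra.
have sn : 0 < `|s| by apply: le_lt_trans h; rewrite mulr_ge0.
have s0 : s != 0 by rewrite -normr_gt0.
pose y := e / s.
have ey : e = s * y by rewrite /y mulrCA divff// mulr1.
have yh : `|y| < 2^-1.
  by rewrite /y normf_div ltr_pdivrMr//; lra.
have /andP[y1 y2] : - 2^-1 < y < 2^-1 by rewrite -ltr_norml.
have key : (1 + y) `^ p <= 1 + p * y + expR (3 * p) * y ^+ 2.
  have y10 : 0 < 1 + y by lra.
  rewrite /powR gt_eqF//.
  apply: (@le_trans _ _ (expR (p * y))).
    rewrite ler_expR ler_wpM2l//.
    have := @le_ln1Dx R y; apply; lra.
  apply: le_trans (@expR_quadratic_bound _ p _ p0) _; first by nra.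
  rewrite exprMn mulrAC lerD2l ler_wpM2r ?sqr_ge0// E3 expr2.
  by apply: ler_pM => //; [exact: mulr_ge0|exact: ler_pM].
have ss : `|s| `^ (p - 2) * s ^+ 2 = `|s| `^ p.
  have <- : `|s| ^+ 2 = s ^+ 2 by rewrite real_normK// num_real.
  rewrite -powR_mulrn// -powRD; first by congr (_ `^ _); lra.
  by rewrite normr_eq0 s0 implybT.
have -> : `|s + e| `^ p = `|s| `^ p * (1 + y) `^ p.
  rewrite ey -[X in X + _]mulr1 -mulrDr normrM (ger0_norm (_ : 0 <= 1 + y)); last by lra.
  by rewrite powRM//; lra.
have T1 : `|s| `^ (p - 2) * s * e = `|s| `^ p * y by rewrite -ss ey expr2; ring.
have T2 : `|s| `^ (p - 2) * e ^+ 2 = `|s| `^ p * y ^+ 2 by rewrite -ss ey; ring.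
rewrite T1 T2.
have : `|s| `^ p * (1 + y) `^ p <= `|s| `^ p * (1 + p * y + expR (3 * p) * y ^+ 2).
  by rewrite ler_wpM2l ?powR_ge0.
have : 0 <= expR (3 * p) * `|e| `^ p by rewrite mulr_ge0 ?expR_ge0.
move=> ? /le_trans; apply; nra.
Qed.

End TaylorBound.

(** * Moments of sums *)

Section Moments.
Context {disp : measure_display} {T : measurableType disp} {R : realType}.
Variables (P : probability T R) (I : finType) (X : I -> {RV P >-> R}).
Variables (p sigma : R).
Hypothesis p2 : 2 <= p.
Hypothesis indX : independent_rvs X.
Hypothesis X0 : forall i, ('E_P[X i] = 0)%E.
Hypothesis sigma0 : 0 < sigma.
Hypothesis Xp : forall i, P.-integrable setT (EFin \o (fun w => `|X i w| `^ p)).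
Hypothesis Xm : forall i, \int[P]_w `|X i w| `^ p <= sigma `^ p.

Notation Ex Z := (\int[P]_w Z w).
Notation g := (growth X [set: I]).
Let p1 : 1 <= p. Proof. by apply: le_trans p2; rewrite ler1n. Qed.
Let p0 : 0 <= p. Proof. exact: le_trans p2. Qed.

Lemma growth_int r (Z : T -> R) : g r Z -> r <= p -> P.-integrable setT (EFin \o Z).
Proof. by move=> gZ; exact: growth_integrable gZ. Qed.

Lemma Ex_le r (Z Y : T -> R) : r <= p -> g r Z -> g r Y -> (forall w, Z w <= Y w) ->
  Ex Z <= Ex Y.
Proof.
by move=> rp gZ gY ZY; apply: le_Rintegral => //; [exact: growth_int gZ rp|exact: growth_int gY rp].
Qed.

Lemma Ex_D r (Z Y : T -> R) : r <= p -> g r Z -> g r Y ->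
  \int[P]_w (Z w + Y w) = Ex Z + Ex Y.
Proof.
by move=> rp gZ gY; rewrite RintegralD//; [exact: growth_int gZ rp|exact: growth_int gY rp].
Qed.

Lemma Ex_Zl r c (Z : T -> R) : r <= p -> g r Z -> \int[P]_w (c * Z w) = c * Ex Z.
Proof. by move=> rp gZ; rewrite RintegralZl//; exact: growth_int gZ rp. Qed.

Lemma Ex_sum r (J : Type) (l : seq J) (Q : pred J) (Z : J -> T -> R) : 0 <= r -> r <= p ->
  (forall j, Q j -> g r (Z j)) ->
  \int[P]_w (\sum_(j <- l | Q j) Z j w) = \sum_(j <- l | Q j) Ex (Z j).
Proof.
move=> r0 rp gZ; elim: l => [|j l IH].
  rewrite big_nil (@eq_Rintegral _ _ _ _ _ (cst 0)); last first.
    by move=> w _; rewrite big_nil.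
  by rewrite Rintegral_cst// mul0r.
rewrite big_cons; case: ifP => Qj.
  rewrite -IH -(@Ex_D r)//; first by apply: eq_Rintegral => w _; rewrite big_cons Qj.
    exact: gZ.
  exact: growth_sum.
by rewrite -IH; apply: eq_Rintegral => w _; rewrite big_cons Qj.
Qed.

Lemma Ex_ge0 (Z : T -> R) : (forall w, 0 <= Z w) -> 0 <= Ex Z.
Proof. by move=> Z0; apply: Rintegral_ge0. Qed.

Lemma Ex_interp r t (Z : T -> R) : g 1 Z -> 0 < t -> 0 <= r <= p ->
  Ex (fun w => `|Z w| `^ p) <= t `^ p ->
  Ex (fun w => `|Z w| `^ r) <= 2 * t `^ r.
Proof.
move=> gZ t0 /andP[r0 rp] h.
have tp0 : 0 < t `^ p by exact: powR_gt0.
have gZp : g p (fun w => `|Z w| `^ p) by rewrite -[p in g p]mul1r; exact: growth_powR.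
have gZr : g r (fun w => `|Z w| `^ r) by rewrite -[r in g r]mul1r; exact: growth_powR.
have g1 : g p (cst 1) by apply: growth_le (growth_cst _ _ 1).
apply: (@le_trans _ _ (Ex (fun w => t `^ r * (1 + (t `^ p)^-1 * `|Z w| `^ p)))).
  apply: (@Ex_le p) => //; first exact: growth_le gZr.
    by apply: growthMl; apply: growthD => //; exact: growthMl.
  move=> w; apply: le_trans (powR_interp (normr_ge0 (Z w)) t0 r0 rp) _.
  rewrite powRM ?invr_ge0 ?(ltW t0)// [X in 1 + X]mulrC.
  by rewrite -(powR_inv1 (ltW t0)) -powRrM mulN1r powRN.
rewrite (@Ex_Zl p)//; last by apply: growthD => //; exact: growthMl.
rewrite (@Ex_D p)//; last exact: growthMl.
rewrite (@Ex_Zl p)// Rintegral_cst//= probability_setT/= mulr1 mulrC.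
rewrite ler_wpM2r ?powR_ge0// lerD2l.
by rewrite mulrC ler_pdivrMr// mul1r.
Qed.

(** Enlarging the variance budget from [K * k * sigma ^+ 2] to
    [K * (k + 1) * sigma ^+ 2] pays for the second-order terms of the Taylor
    expansion when one summand is added. *)
Lemma budget_step k t (K := expR (5 * p)) : 1 <= k -> 0 < t ->
  t ^+ 2 = K * k * sigma ^+ 2 ->
  t `^ p + expR (3 * p) * (4 * (t `^ (p - 2) * sigma ^+ 2) + sigma `^ p)
  <= (K * (k + 1) * sigma ^+ 2) `^ (p / 2).
Proof.
move=> k1 t0 t2; have t0' := ltW t0; have p2' := p2; have s0 := ltW sigma0.
have K1 : 1 <= K by rewrite /K -expR0 ler_expR mulr_ge0.
have half (x : R) : 0 <= x -> (x ^+ 2) `^ (p / 2) = x `^ p.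
  by move=> x0; rewrite -powR_mulrn// -powRrM; congr (_ `^ _); lra.
have st : sigma `^ p <= t `^ (p - 2) * sigma ^+ 2.
  have -> : sigma `^ p = sigma `^ (p - 2) * sigma ^+ 2.
    rewrite -(@powR_mulrn _ sigma 2)// -powRD; first by congr (_ `^ _); lra.
    by rewrite (gt_eqF sigma0) implybT.
  rewrite ler_wpM2r ?sqr_ge0//; apply: ge0_ler_powR; rewrite ?nnegrE//; first by lra.
  rewrite -(@ler_pXn2r _ 2) ?nnegrE// t2.
  by rewrite ler_peMl ?sqr_ge0//; nra.
have KE : 5 * expR (3 * p) <= K.
  have -> : K = expR (3 * p) * (expR p * expR p) by rewrite -!expRD; congr expR; lra.
  have e0 := expR_gt0 (3 * p).
  have : 5 <= expR p * expR p.
    have : expR (1 + 1 : R) <= expR p by rewrite ler_expR; lra.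
    rewrite expRD; have := @expR_ge2 R 1 (lexx _); move: (expR 1) (expR p) => u v u2 uv.
    have v4 : 4 <= v by apply: le_trans uv; nra.
    by nra.
  by nra.
apply: (@le_trans _ _ (t `^ p + K * (t `^ (p - 2) * sigma ^+ 2))).
  have u0 : 0 <= t `^ (p - 2) * sigma ^+ 2 by rewrite mulr_ge0 ?powR_ge0 ?sqr_ge0.
  rewrite lerD2l; have e0 := expR_gt0 (3 * p).
  apply: (@le_trans _ _ (expR (3 * p) * (5 * (t `^ (p - 2) * sigma ^+ 2)))).
    by rewrite ler_wpM2l ?expR_ge0//; lra.
  by rewrite mulrCA mulrA ler_wpM2r.
have -> : K * (k + 1) * sigma ^+ 2 = t ^+ 2 + K * sigma ^+ 2.
  by rewrite t2; ring.
have b0 : 0 <= t ^+ 2 + K * sigma ^+ 2.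
  by rewrite addr_ge0 ?sqr_ge0// mulr_ge0 ?sqr_ge0 ?expR_ge0.
rewrite -[leRHS]powR_pred//; last by lra.
have -> : t `^ (p - 2) = (t ^+ 2) `^ (p / 2 - 1).
  by rewrite -(@powR_mulrn _ t 2)// -powRrM; congr (_ `^ _); lra.
have -> : t `^ p = t ^+ 2 * (t ^+ 2) `^ (p / 2 - 1).
  by rewrite powR_pred ?half ?sqr_ge0//; lra.
have -> : forall a b c : R, a * b + c * (b * sigma ^+ 2) = (a + c * sigma ^+ 2) * b.
  by move=> *; ring.
rewrite ler_wpM2l//; apply: ge0_ler_powR; rewrite ?nnegrE ?sqr_ge0//; first by lra.
by rewrite lerDl mulr_ge0 ?sqr_ge0 ?expR_ge0.
Qed.

(** The Marcinkiewicz--Zygmund inequality, one summand at a time: in the Taylor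
    expansion of the sum the first-order term has mean zero, and the second-order
    term factorizes into moments that the induction hypothesis controls. *)
Lemma moment_sum_le (s : seq I) : uniq s ->
  Ex (fun w => `|\sum_(i <- s) X i w| `^ p) <=
  (expR (5 * p) * (size s)%:R * sigma ^+ 2) `^ (p / 2).
Proof.
set K := expR (5 * p); have p2' := p2; have p1' := p1.
have s0 := ltW sigma0.
have s20 : 0 < sigma ^+ 2 by exact: exprn_gt0.
have p20 : 0 <= p - 2 <= p by apply/andP; split; lra.
have K1 : 1 <= K by rewrite /K -expR0 ler_expR mulr_ge0.
have p22 : 0 <= (2 : R) <= p by rewrite ler0n.
have half (x : R) : 0 <= x -> (x ^+ 2) `^ (p / 2) = x `^ p.
  by move=> x0; rewrite -powR_mulrn// -powRrM; congr (_ `^ _); lra.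
elim: s => [_|i s IH /= /andP[si us]].
  rewrite (@eq_Rintegral _ _ _ _ _ (cst 0)).
    by rewrite Rintegral_cst// mul0r powR_ge0.
  by move=> w _ /=; rewrite big_nil normr0 powR0//; lra.
have [sn|sn] := posnP (size s).
  case: s sn {IH us si} => //= _; rewrite mulr1.
  apply: (@le_trans _ _ (sigma `^ p)).
    apply: le_trans (Xm i).
    by rewrite (@eq_Rintegral _ _ _ _ _ (fun w => `|X i w| `^ p))// => w _; rewrite big_seq1.
  rewrite -(half _ s0); apply: ge0_ler_powR; rewrite ?nnegrE ?sqr_ge0 ?divr_ge0//.
    by rewrite mulr_ge0 ?sqr_ge0// expR_ge0.
  by rewrite ler_peMl ?sqr_ge0.
have k1 : 1 <= (size s)%:R :> R by rewrite ler1n.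
move: {IH}(IH us); set k : R := (size s)%:R => IH.
set S := fun w => \sum_(j <- s) X j w in IH *.
pose A := [set j in s]%SET.
have iA : i \notin A by rewrite inE.
have gS : growth X A 1 S.
  rewrite /S; have -> : (fun w => \sum_(j <- s) X j w) = (fun w => \sum_(j <- s | j \in A) X j w).
    apply/funext => w; rewrite big_seq [RHS]big_seq_cond; apply: eq_bigl => j.
    by rewrite /A inE andbb.
  by apply: growth_sum => // j jA; exact: growth_coord.
have gST := growth_setT gS.
have gX : g 1 (X i) by apply: growth_coord; rewrite inE.
have gXp : g p (fun w => `|X i w| `^ p) by rewrite -[p in g p]mul1r; exact: growth_powR.
have gSp : g p (fun w => `|S w| `^ p) by rewrite -[p in g p]mul1r; exact: growth_powR.
have gS2 : growth X A (p - 2) (fun w => `|S w| `^ (p - 2)).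
  by rewrite -[X in growth _ _ X]mul1r; apply: growth_powR => //; lra.
have gS1 : growth X A (p - 1) (fun w => `|S w| `^ (p - 2) * S w).
  by rewrite (_ : p - 1 = p - 2 + 1); [exact: growthM|lra].
pose t := Num.sqrt (K * k * sigma ^+ 2).
have q0 : 0 < K * k * sigma ^+ 2 by rewrite mulr_gt0// mulr_gt0 ?expR_gt0//; lra.
have t0 : 0 < t by rewrite sqrtr_gt0.
have t2 : t ^+ 2 = K * k * sigma ^+ 2 by rewrite sqr_sqrtr// ltW.
have t0' := ltW t0.
have IH' : Ex (fun w => `|S w| `^ p) <= t `^ p by rewrite -(half _ t0') t2.
have ES : Ex (fun w => `|S w| `^ (p - 2)) <= 2 * t `^ (p - 2).
  exact: Ex_interp.
have sq (x : R) : 0 <= x -> x `^ 2 = x ^+ 2 by move=> x0; rewrite -powR_mulrn.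
have EX : Ex (fun w => X i w ^+ 2) <= 2 * sigma ^+ 2.
  have : Ex (fun w => `|X i w| `^ 2) <= 2 * sigma `^ 2.
    exact: Ex_interp.
  rewrite (sq _ s0); congr (_ <= _); apply: eq_Rintegral => w _.
  by rewrite sq// real_normK ?num_real.
have gX2 : g 2 (fun w => X i w ^+ 2).
  by rewrite (_ : 2 = 1 + 1)//; under eq_fun do rewrite expr2; exact: growthM.
have gSX : g p (fun w => `|S w| `^ (p - 2) * X i w ^+ 2).
  by have := growthM (growth_setT gS2) gX2; rewrite subrK.
have gSX1 : g p (fun w => `|S w| `^ (p - 2) * S w * X i w).
  by have := growthM (growth_setT gS1) gX; rewrite subrK.
have E2 : Ex (fun w => `|S w| `^ (p - 2) * X i w ^+ 2) <= 4 * (t `^ (p - 2) * sigma ^+ 2).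
  have -> := @growth_expectationM _ _ _ P I X p p1 Xp indX A (p - 2) 2 _ i (fun x => x ^+ 2) gS2 iA.
  - have := ler_pM (Ex_ge0 (fun w => powR_ge0 `|S w| (p - 2))) (Ex_ge0 (fun w => sqr_ge0 (X i w))) ES EX.
    by move/le_trans; apply; rewrite le_eqVlt; apply/orP; left; apply/eqP; ring.
  - by lra.
  - by lra.
  - exact: gX2.
  - exact: exprn_measurable.
have E1' := growth_orthogonal p1 Xp indX X0 gS1 iA.
have {}E1' : Ex (fun w => `|S w| `^ (p - 2) * S w * X i w) = 0 by apply: E1'; lra.
have gB : g p (fun w => `|S w| `^ (p - 2) * X i w ^+ 2 + `|X i w| `^ p) by exact: growthD.
have gSum : g p (fun w => `|S w + X i w| `^ p).
  by rewrite -[p in g p]mul1r; apply: growth_powR => //; exact: growthD.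
have main : Ex (fun w => `|S w + X i w| `^ p) <= t `^ p + expR (3 * p) * (4 * (t `^ (p - 2) * sigma ^+ 2) + sigma `^ p).
  apply: (@le_trans _ _ (Ex (fun w => `|S w| `^ p + p * (`|S w| `^ (p - 2) * S w * X i w)
     + expR (3 * p) * (`|S w| `^ (p - 2) * X i w ^+ 2 + `|X i w| `^ p)))).
    apply: (@Ex_le p) => //; last by move=> w; exact: powR_taylor.
    by apply: growthD; [apply: growthD => //; exact: growthMl | exact: growthMl].
  rewrite (@Ex_D p)//; [|by apply: growthD => //; exact: growthMl|exact: growthMl].
  rewrite (@Ex_D p)//; last exact: growthMl.
  rewrite (@Ex_Zl p)// E1' mulr0 addr0 (@Ex_Zl p)// (@Ex_D p)//.
  by apply: lerD => //; rewrite ler_wpM2l ?expR_ge0// lerD.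
rewrite (@eq_Rintegral _ _ _ _ _ (fun w => `|S w + X i w| `^ p)); last first.
  by move=> w _; rewrite big_cons addrC.
apply: le_trans main _; rewrite -[(size s).+1%:R]natr1.
exact: (@budget_step k t).
Qed.
End Moments.

(** * Doob's inequality for maxima over boxes *)

Section DoobPathwise.
Context {R : realType}.
Implicit Types (N : nat -> R) (p : R).

Fixpoint runmax N L : R :=
  if L is l.+1 then Num.max (runmax N l) (N l.+1) else N 0%N.

Lemma runmax_ge N L l : (l <= L)%N -> N l <= runmax N L.
Proof.
elim: L => [|L IH]; first by rewrite leqn0 => /eqP ->.
by rewrite leq_eqVlt => /predU1P[->|/IH] /=; rewrite le_max ?lexx ?orbT// => ->.
Qed.

(** A pathwise form of Doob's maximal inequality: the sum on the right is a
    transform of [N] by a nonnegative predictable factor. *)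
Lemma doob_pathwise N p L : 2 <= p -> N 0%N = 0 -> (forall l, 0 <= N l) ->
  runmax N L `^ p <= expR (2 * p) * N L `^ p
    - 4 * \sum_(0 <= l < L) runmax N l `^ (p - 1) * (N l.+1 - N l).
Proof.
move=> p2 N0 Nge; have p0 : 0 < p by lra.
have M0 l : 0 <= runmax N l by apply: le_trans (runmax_ge N (leqnn l)).
have H : 2^-1 * runmax N L `^ p <= runmax N L `^ (p - 1) * N L
    - \sum_(0 <= l < L) runmax N l `^ (p - 1) * (N l.+1 - N l).
  elim: L => [|L IH]; first by rewrite /= N0 big_geq// powR0 ?gt_eqF// !mulr0 subr0.
  rewrite big_nat_recr//=; case: (lerP (runmax N L)) => h; last by move: IH; lra.
  have x0 := M0 L; set x := runmax N L in h x0 IH *; set y := N L.+1 in h *.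
  have y0 : 0 <= y by exact: Nge.
  have : y * x `^ (p - 1) <= 2^-1 * (y `^ p + x `^ p).
    have -> : x `^ (p - 1) = x * x `^ (p - 2).
      by rewrite -[in LHS](powR_pred x0) ?subr_gt0; [congr (_ * _ `^ _); lra|lra].
    have pw (z : R) : 0 <= z -> z `^ p = z ^+ 2 * z `^ (p - 2).
      move=> z0; rewrite expr2 -mulrA -(powR_pred z0 p0) -(@powR_pred _ z (p - 1))//; last by lra.
      by congr (_ * (_ * _ `^ _)); lra.
    rewrite !pw//.
    have le : x `^ (p - 2) <= y `^ (p - 2).
      by apply: ge0_ler_powR; rewrite ?nnegrE//; lra.
    have u0 := powR_ge0 x (p - 2).
    have : (x - y) ^+ 2 * x `^ (p - 2) >= 0 by rewrite mulr_ge0 ?sqr_ge0.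
    have : y ^+ 2 * x `^ (p - 2) <= y ^+ 2 * y `^ (p - 2) by rewrite ler_wpM2l ?sqr_ge0.
    by move: (x `^ _) (y `^ _) => u v; rewrite !expr2; nra.
  have : y * y `^ (p - 1) = y `^ p by exact: powR_pred.
  by move: IH; move: (\sum_(_ <= _ < _) _) => s; lra.
have K : runmax N L `^ (p - 1) * N L <= 4^-1 * runmax N L `^ p + 4^-1 * (4 `^ p * N L `^ p).
  set m := runmax N L; have m0 : 0 <= m by exact: M0.
  have n0 := Nge L.
  rewrite -powRM//.
  have [h|h] := lerP (4 * N L) m.
    have : m * m `^ (p - 1) = m `^ p by exact: powR_pred.
    have := powR_ge0 m (p - 1); have := powR_ge0 (4 * N L) p.
    by move: (m `^ (p - 1)) (m `^ p) => u v; nra.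
  have : m `^ (p - 1) * (4 * N L) <= (4 * N L) `^ p.
    rewrite mulrC -[leRHS]powR_pred ?mulr_ge0//.
    by rewrite ler_wpM2l ?mulr_ge0//; apply: ge0_ler_powR; rewrite ?nnegrE ?mulr_ge0 ?(ltW h)//; lra.
  by have := powR_ge0 m p; lra.
have E4 : 4 `^ p <= expR (2 * p) :> R.
  apply: powR_le_expR => //; last exact: ltW.
  by rewrite (_ : 2 = 1 + 1)// expRD; have := @expR_ge2 R 1 (lexx _); nra.
have : 4 `^ p * N L `^ p <= expR (2 * p) * N L `^ p by rewrite ler_wpM2r ?powR_ge0.
by move: H K; lra.
Qed.
End DoobPathwise.

Section MaximalInequality.
Context {disp : measure_display} {T : measurableType disp} {R : realType}.
Variables (P : probability T R) (I : finType) (X : I -> {RV P >-> R}).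
Variables (p sigma : R).
Hypothesis p2 : 2 <= p.
Hypothesis indX : independent_rvs X.
Hypothesis X0 : forall i, ('E_P[X i] = 0)%E.
Hypothesis sigma0 : 0 < sigma.
Hypothesis Xp : forall i, P.-integrable setT (EFin \o (fun w => `|X i w| `^ p)).
Hypothesis Xm : forall i, \int[P]_w `|X i w| `^ p <= sigma `^ p.

Notation Ex Z := (\int[P]_w Z w).
Notation g := (growth X [set: I]).
Let p1 : 1 <= p. Proof. by apply: le_trans p2; rewrite ler1n. Qed.
Let p0 : 0 <= p. Proof. by apply: le_trans p2; rewrite ler0n. Qed.

(** A submartingale step, tested against the nonnegative functions of the past
    instead of being expressed by a conditional expectation. *)
Definition submart A (Y Z : T -> R) := forall h, growth X A (p - 1) h ->
  (forall w, 0 <= h w) -> \int[P]_w (h w * Y w) <= \int[P]_w (h w * Z w).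

Let gh A h Y : growth X A (p - 1) h -> g 1 Y -> g p (fun w => h w * Y w).
Proof. by move=> gh gY; have := growthM (growth_setT gh) gY; rewrite subrK. Qed.

(** The test function is split along the event [Y1 <= Y2], which depends on the
    past only and on which the maximum is [Y2]. *)
Lemma submart_max A Y1 Y2 Z1 Z2 : growth X A 1 Y1 -> growth X A 1 Y2 -> g 1 Z1 -> g 1 Z2 ->
  submart A Y1 Z1 -> submart A Y2 Z2 ->
  submart A (fun w => Num.max (Y1 w) (Y2 w)) (fun w => Num.max (Z1 w) (Z2 w)).
Proof.
move=> gY1 gY2 gZ1 gZ2 s1 s2 h hg h0.
pose e w : R := (Y1 w <= Y2 w)%R%:R.
have ge : growth X A 0 e := growth_le_indic gY1 gY2.
have ge' : growth X A 0 (fun w => 1 - e w).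
  by apply: growthD; [exact: growth_cst|exact: growthN].
have e01 w : 0 <= e w <= 1 by rewrite /e ler0n lern1 leq_b1.
have g1 : growth X A (p - 1) (fun w => h w * (1 - e w)).
  by rewrite -[X in growth _ _ X]addr0; exact: growthM.
have g2 : growth X A (p - 1) (fun w => h w * e w).
  by rewrite -[X in growth _ _ X]addr0; exact: growthM.
have gS1 := growth_setT gY1; have gS2 := growth_setT gY2.
apply: (@le_trans _ _ (\int[P]_w (h w * (1 - e w) * Z1 w + h w * e w * Z2 w))); last first.
  apply: (@Ex_le _ _ _ P I X p p2 Xp p) => //.
  - by apply: growthD; [exact: gh g1 gZ1|exact: gh g2 gZ2].
  - by apply: gh hg _; exact: growth_max.
  - move=> w; have /andP[e0 e1] := e01 w; have := h0 w.
    have a1 : 0 <= h w * (1 - e w) by rewrite mulr_ge0//; lra.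
    have a2 : 0 <= h w * e w by rewrite mulr_ge0.
    move=> _; rewrite (_ : h w * Num.max _ _ = h w * (1 - e w) * Num.max (Z1 w) (Z2 w)
      + h w * e w * Num.max (Z1 w) (Z2 w)); last by ring.
    by apply: lerD; rewrite ler_wpM2l// le_max lexx ?orbT.
rewrite (@Ex_D _ _ _ P I X p p2 Xp p)//; [|exact: gh g1 gZ1|exact: gh g2 gZ2].
apply: (@le_trans _ _ (\int[P]_w (h w * (1 - e w) * Y1 w) + \int[P]_w (h w * e w * Y2 w))).
  rewrite -(@Ex_D _ _ _ P I X p p2 Xp p)//; [|exact: gh g1 gS1|exact: gh g2 gS2].
  rewrite le_eqVlt; apply/orP; left; apply/eqP; apply: eq_Rintegral => w _.
  by rewrite /e; case: lerP => _ /=; ring.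
apply: lerD; [apply: s1 => // w|apply: s2 => // w]; rewrite mulr_ge0//.
  by have /andP[_] := e01 w; lra.
Qed.

Lemma submart_Zl A c Y Z : 0 <= c -> growth X A 1 Y -> g 1 Z -> submart A Y Z ->
  submart A (fun w => c * Y w) (fun w => c * Z w).
Proof.
move=> c0 gY gZ s h hg h0.
under eq_Rintegral do rewrite mulrCA.
under [leRHS]eq_Rintegral do rewrite mulrCA.
have g1 := gh hg (growth_setT gY); have g2 := gh hg gZ.
by rewrite !(@Ex_Zl _ _ _ P I X p p2 Xp p)// ler_wpM2l//; exact: s.
Qed.

Lemma submart_refl A Y : submart A Y Y.
Proof. by move=> h. Qed.

Lemma submart_bigmax A (J : Type) (l : seq J) (Y Z : J -> T -> R) :
  (forall j, growth X A 1 (Y j)) -> (forall j, g 1 (Z j)) ->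
  (forall j, submart A (Y j) (Z j)) ->
  submart A (fun w => \big[Num.max/0]_(j <- l) Y j w) (fun w => \big[Num.max/0]_(j <- l) Z j w).
Proof.
have gb B (U : J -> T -> R) (k : seq J) : (forall j, growth X B 1 (U j)) ->
    growth X B 1 (fun w => \big[Num.max/0]_(j <- k) U j w).
  move=> gU; elim: k => [|j k IH].
    under eq_fun do rewrite big_nil.
    by apply: growth_le (growth_cst _ _ 0).
  by under eq_fun do rewrite big_cons; exact: growth_max.
move=> gY gZ s; elim: l => [|j l IH].
  have b0 (U : J -> T -> R) : (fun w => \big[Num.max/0]_(j <- [::]) U j w) = cst 0.
    by apply/funext => w; rewrite big_nil.
  by rewrite !b0; exact: submart_refl.
have bS (U : J -> T -> R) : (fun w => \big[Num.max/0]_(i <- j :: l) U i w) =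
    (fun w => Num.max (U j w) (\big[Num.max/0]_(i <- l) U i w)).
  by apply/funext => w; rewrite big_cons.
by rewrite !bS; apply: submart_max => //; exact: gb.
Qed.

Definition psum (B : {set I}) w : R := \sum_(i in B) X i w.

Lemma growth_psum (A B : {set I}) : B \subset A -> growth X A 1 (psum B).
Proof.
move=> /fintype.subsetP BA; apply: growth_sum => // i /BA iA; exact: growth_coord.
Qed.

(** The absolute value is the maximum of the sum and of its opposite, and both are
    martingales. *)
Lemma submart_abs_psum (A B C : {set I}) : B \subset A -> B \subset C ->
  (forall i, i \in C -> i \notin B -> i \notin A) ->
  submart A (fun w => `|psum B w|) (fun w => `|psum C w|).
Proof.
move=> BA BC dA.
have gB := growth_psum BA; have gC : g 1 (psum C) by apply: growth_psum; exact: finset.subsetT.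
have nE (Z : T -> R) : (fun w => `|Z w|) = (fun w => Num.max (Z w) (- Z w)).
  apply/funext => w; have [h|h] := lerP 0 (Z w).
    by rewrite ger0_norm//; apply/esym/max_idPl; lra.
  by rewrite ltr0_norm//; apply/esym/max_idPr; lra.
have E h : growth X A (p - 1) h -> \int[P]_w (h w * psum C w) = \int[P]_w (h w * psum B w).
  move=> hg.
  have -> : (fun w => h w * psum C w) = (fun w => h w * psum B w + \sum_(i in (C :\: B)%SET) h w * X i w).
    apply/funext => w; rewrite -mulr_sumr -mulrDr /psum; congr (_ * _).
    by rewrite (big_setID B)/= (finset.setIidPr BC).
  have gX i : g 1 (X i) by apply: growth_coord; rewrite inE.
  rewrite (@Ex_D _ _ _ P I X p p2 Xp p)//; last 2 first.
  - by apply: gh hg _; exact: growth_setT gB.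
  - by apply: growth_sum => // i _; exact: gh hg (gX i).
  rewrite (@Ex_sum _ _ _ P I X p p2 Xp p)//; last by move=> i _; exact: gh hg (gX i).
  rewrite big1 ?addr0// => i iCB.
  apply: (growth_orthogonal p1 Xp indX X0 hg); last by rewrite gerBl.
  by move: iCB; rewrite finset.in_setD => /andP[iB iC]; exact: dA.
rewrite !nE; apply: submart_max => //; [exact: growthN|exact: growthN| |].
  by move=> h hg h0; rewrite E.
move=> h hg h0.
under eq_Rintegral do rewrite mulrN -mulNr.
under [leRHS]eq_Rintegral do rewrite mulrN -mulNr.
by rewrite E//; exact: growthN.
Qed.

Definition level (c : I -> nat) (l : nat) : {set I} := [set i | (c i < l)%N]%SET.

Variables (J : eqType) (c : J -> I -> nat) (lo : J -> nat) (L : nat).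

(** The maximum of [`|psum|] over the boxes cut out of [B] by the coordinates in
    [js], each divided by its side lengths; one coordinate is handled at a time. *)
Fixpoint maxfun (js : seq J) (B : {set I}) (w : T) : R :=
  if js is j :: js' then
    \big[Num.max/0]_(l <- index_iota (lo j) L)
      (l%:R^-1 * maxfun js' (B :&: level (c j) l) w)
  else `|psum B w|.

Lemma maxfun_ge0 js B w : 0 <= maxfun js B w.
Proof.
case: js => [|j js] /=; first exact: normr_ge0.
by elim: (index_iota _ _) => [|l s IH]; rewrite ?big_nil// big_cons le_max IH orbT.
Qed.

Lemma growth_maxfun js B : growth X B 1 (maxfun js B).
Proof.
elim: js B => [|j js IH] B /=; first by apply: growth_norm; exact: growth_psum.
elim: (index_iota _ _) => [|l s IHs].
  under eq_fun do rewrite big_nil.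
  by apply: growth_le (growth_cst _ _ 0).
under eq_fun do rewrite big_cons; apply: growth_max => //; apply: growthMl.
by apply: growth_subset (IH _); exact: subsetIl.
Qed.

(** Raising the level of one coordinate adds new variables to all the boxes at
    once; the submartingale property passes to the weighted maximum. *)
Lemma submart_maxfun c' js B l :
  submart (level c' l) (maxfun js (B :&: level c' l)) (maxfun js (B :&: level c' l.+1)).
Proof.
elim: js B => [|j js IH] B /=.
  apply: submart_abs_psum; first exact: subsetIr.
    by apply: finset.setIS; apply/fintype.subsetP => i; rewrite !inE => /ltnW.
  by move=> i; rewrite !inE; case: (i \in B) => //=.
apply: submart_bigmax => k.
- by apply: growthMl; apply: growth_subset (growth_maxfun _ _); rewrite finset.setIAC; exact: subsetIr.
- by apply: growthMl; apply: growth_setT; exact: growth_maxfun.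
apply: submart_Zl => //.
- by apply: growth_subset (growth_maxfun _ _); rewrite finset.setIAC; exact: subsetIr.
- by apply: growth_setT; exact: growth_maxfun.
by rewrite [X in maxfun js X]finset.setIAC [X in submart _ _ (maxfun js X)]finset.setIAC; exact: IH.
Qed.

Lemma maxfun_set0 js w : maxfun js finset.set0 w = 0.
Proof.
elim: js => [|j js IH] /=; first by rewrite /psum big_set0 normr0.
by elim: (index_iota _ _) => [|l s IHs]; rewrite ?big_nil// big_cons IHs finset.set0I IH mulr0 maxxx.
Qed.

(** The transform in [doob_pathwise] has nonnegative mean, because each increment
    is tested against a function of the past. *)
Lemma doob_maxfun c' js B m :
  \int[P]_w (runmax (fun l => maxfun js (B :&: level c' l) w) m `^ p) <=
  expR (2 * p) * \int[P]_w (maxfun js (B :&: level c' m) w `^ p).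
Proof.
set N := fun l w => maxfun js (B :&: level c' l) w.
have N0 w : N 0%N w = 0.
  rewrite /N (_ : _ :&: _ = finset.set0) ?maxfun_set0//.
  by apply/setP => i; rewrite !inE andbF.
have Nge l w : 0 <= N l w by exact: maxfun_ge0.
have gN l : growth X (level c' l) 1 (N l).
  by apply: growth_subset (growth_maxfun _ _); exact: subsetIr.
have lev l : level c' l \subset level c' l.+1.
  by apply/fintype.subsetP => i; rewrite !inE => /ltnW.
pose M l w := runmax (fun k => N k w) l.
have gM l : growth X (level c' l) 1 (M l).
  elim: l => [|l IH]; first exact: gN.
  by apply: growth_max => //; apply: growth_subset IH.
have M0 l w : 0 <= M l w by apply: le_trans (runmax_ge (fun k => N k w) (leqnn l)).
have pw A r (Z : T -> R) : 0 <= r -> growth X A 1 Z -> (forall w, 0 <= Z w) ->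
    growth X A r (fun w => Z w `^ r).
  move=> r0 gZ Z0; have := growth_powR gZ r0; rewrite mul1r; congr growth.
  by apply/funext => w; rewrite ger0_norm.
have p10 : 0 <= p - 1 by have := p2; lra.
have gT l := growth_setT (gN l).
have gMp l := pw _ _ _ p10 (gM l) (M0 l).
have gterm l : g p (fun w => M l w `^ (p - 1) * (N l.+1 w - N l w)).
  by apply: gh (gMp l) _; apply: growthD => //; exact: growthN.
have gsum : g p (fun w => \sum_(0 <= l < m) M l w `^ (p - 1) * (N l.+1 w - N l w)).
  exact: growth_sum.
have gNp : g p (fun w => N m w `^ p) := pw _ _ _ p0 (gT m) (Nge m).
apply: (@le_trans _ _ (\int[P]_w (expR (2 * p) * N m w `^ p
    + (- 4) * \sum_(0 <= l < m) M l w `^ (p - 1) * (N l.+1 w - N l w)))).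
  apply: (@Ex_le _ _ _ P I X p p2 Xp p) => //.
  - exact: (pw _ _ _ p0 (growth_setT (gM m)) (M0 m)).
  - by apply: growthD; exact: growthMl.
  - by move=> w; rewrite mulNr; apply: (doob_pathwise m p2 (N0 w) (fun l => Nge l w)).
rewrite (@Ex_D _ _ _ P I X p p2 Xp p)//; [|exact: growthMl|exact: growthMl].
rewrite !(@Ex_Zl _ _ _ P I X p p2 Xp p)//.
rewrite gerDl mulNr oppr_le0 mulr_ge0//.
rewrite (@Ex_sum _ _ _ P I X p p2 Xp p)//.
apply: sumr_ge0 => l _.
under eq_Rintegral do rewrite mulrBr.
rewrite RintegralB//.
- rewrite subr_ge0. have SM : submart (level c' l) (N l) (N l.+1) by exact: submart_maxfun.
  by apply: (SM _ (gMp l)) => w; exact: powR_ge0.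
- by apply: (growth_int p2 Xp (r := p)) => //; exact: gh (gMp l) (gT _).
- by apply: (growth_int p2 Xp (r := p)) => //; exact: gh (gMp l) (gT _).
Qed.

End MaximalInequality.

(** * The maximal inequality for averages *)

Section MaximalInequalityAverages.
Context {disp : measure_display} {T : measurableType disp} {R : realType}.
Variables (P : probability T R) (I : finType) (X : I -> {RV P >-> R}).
Variables (p sigma : R).
Hypothesis p2 : 2 <= p.
Hypothesis indX : independent_rvs X.
Hypothesis X0 : forall i, ('E_P[X i] = 0)%E.
Hypothesis sigma0 : 0 < sigma.
Hypothesis Xp : forall i, P.-integrable setT (EFin \o (fun w => `|X i w| `^ p)).
Hypothesis Xm : forall i, \int[P]_w `|X i w| `^ p <= sigma `^ p.
Variables (J : eqType) (c : J -> I -> nat) (lo : J -> nat) (L : nat).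

Notation Ex Z := (\int[P]_w Z w).
Notation g := (growth X [set: I]).
Notation maxfun := (maxfun X c lo L).
Let p0 : 0 <= p. Proof. by apply: le_trans p2; rewrite ler0n. Qed.

Lemma powR_bigmax_le (K : eqType) (s : seq K) (F : K -> R) b : 0 <= b ->
  (forall l, l \in s -> F l `^ p <= b) ->
  (\big[Num.max/0]_(l <- s) F l) `^ p <= b.
Proof.
move=> b0; elim: s => [|l s IH] h.
  by rewrite big_nil powR0// gt_eqF//; have := p2; lra.
rewrite big_cons; case: (lerP (F l)) => _; last by apply: h; rewrite inE eqxx.
by apply: IH => k ks; apply: h; rewrite inE ks orbT.
Qed.

Lemma growth_maxfun_powR js B : g p (fun w => maxfun js B w `^ p).
Proof.
have := growth_powR (growth_setT (growth_maxfun X c lo L js B)) p0.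
by rewrite mul1r; congr growth; apply/funext => w; rewrite ger0_norm// maxfun_ge0.
Qed.

Lemma growth_runmax_maxfun c' js B m :
  g p (fun w => runmax (fun l => maxfun js (B :&: level c' l) w) m `^ p).
Proof.
have gM : g 1 (fun w => runmax (fun l => maxfun js (B :&: level c' l) w) m).
  elim: m => [|m IH] /=; first exact: growth_setT (growth_maxfun _ _ _ _ _ _).
  by apply: growth_max => //; exact: growth_setT (growth_maxfun _ _ _ _ _ _).
have := growth_powR gM p0; rewrite mul1r; congr growth; apply/funext => w.
rewrite ger0_norm//; apply: le_trans (runmax_ge _ (leqnn m)); exact: maxfun_ge0.
Qed.

(** Side lengths in a dyadic range [[2^r lo j, 2^(r+1) lo j)] are handled by
    Doob's inequality, and the ranges contribute geometrically. *)
Lemma maxfun_step j js B (D : R) : (0 < lo j)%N -> 0 <= D ->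
  (forall m, (0 < m)%N ->
     Ex (fun w => maxfun js (B :&: level (c j) m) w `^ p) <= D * m%:R `^ (p / 2)) ->
  Ex (fun w => maxfun (j :: js) B w `^ p) <=
    expR (4 * p) * (D * (lo j)%:R^-1 `^ (p / 2)).
Proof.
move=> l0 D0 HD; have p2' := p2.
pose N l w := maxfun js (B :&: level (c j) l) w.
pose y r := (2 ^ r * lo j)%N.
have y0 r : (0 < y r)%N by rewrite muln_gt0 expn_gt0.
have yR0 r : 0 < (y r)%:R :> R by rewrite ltr0n.
pose M r w := runmax (fun l => N l w) (2 * y r) `^ p.
have M0 r w : 0 <= M r w by exact: powR_ge0.
have gM r : g p (M r) by exact: growth_runmax_maxfun.
have pt w : maxfun (j :: js) B w `^ p <= \sum_(0 <= r < L) ((y r)%:R^-1 `^ p) * M r w.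
  apply: powR_bigmax_le; first by apply: sumr_ge0 => r _; rewrite mulr_ge0 ?powR_ge0.
  move=> l; rewrite mem_index_iota => /andP[ll lL].
  have ld : (0 < l %/ lo j)%N by rewrite divn_gt0.
  pose r := trunc_log 2 (l %/ lo j).
  have r1 : (y r <= l)%N by rewrite /y -leq_divRL// trunc_logP.
  have r2 : (l <= 2 * y r)%N.
    by rewrite /y mulnA -expnS ltnW// -ltn_divLR// trunc_log_ltn.
  have rL : (r < L)%N.
    apply: leq_ltn_trans lL; apply: leq_trans r1.
    by apply: leq_trans (ltnW (ltn_expl r (ltnSn 1))) _; rewrite leq_pmulr.
  rewrite (bigD1_seq r)/=; [|by rewrite mem_index_iota|exact: iota_uniq].
  apply: le_trans (_ : _ <= (y r)%:R^-1 `^ p * M r w) _; last first.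
    by rewrite lerDl; apply: sumr_ge0 => k _; rewrite mulr_ge0 ?powR_ge0.
  have R0 : 0 <= runmax (N^~ w) (2 * y r).
    by apply: le_trans (runmax_ge _ (leqnn _)); exact: maxfun_ge0.
  rewrite -powRM ?invr_ge0 ?ler0n//; apply: ge0_ler_powR; rewrite ?nnegrE ?mulr_ge0 ?invr_ge0 ?maxfun_ge0 ?(ltW (yR0 r))//.
  apply: ler_pM; rewrite ?invr_ge0 ?maxfun_ge0//.
    by rewrite lef_pV2 ?posrE ?ltr0n ?ler_nat// (leq_trans (y0 r)).
  exact: (runmax_ge (N^~ w)).
apply: (@le_trans _ _ (Ex (fun w => \sum_(0 <= r < L) ((y r)%:R^-1 `^ p) * M r w))).
  apply: (@Ex_le _ _ _ P I X p p2 Xp p) => //; first exact: growth_maxfun_powR.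
  by apply: growth_sum => // r _; exact: growthMl.
rewrite (@Ex_sum _ _ _ P I X p p2 Xp p)//; last by move=> r _; exact: growthMl.
under eq_bigr => r _ do rewrite (@Ex_Zl _ _ _ P I X p p2 Xp p)//.
have E0 := expR_gt0 p; have E1 : 2 <= expR p by apply: expR_ge2; lra.
have E4 : expR (4 * p) = expR (2 * p) * expR p * expR p by rewrite -!expRD; congr expR; lra.
have lo0 := powR_ge0 (lo j)%:R^-1 (p / 2).
have tm r : (y r)%:R^-1 `^ p * Ex (M r) <=
    expR (2 * p) * expR p * (D * (lo j)%:R^-1 `^ (p / 2)) * 2^-1 ^+ r.
  apply: (@le_trans _ _ ((y r)%:R^-1 `^ p * (expR (2 * p) * (D * (2 * y r)%:R `^ (p / 2))))).
    rewrite ler_wpM2l ?powR_ge0//.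
    apply: le_trans (doob_maxfun p2 indX X0 Xp c lo L (c j) js B (2 * y r)) _.
    by rewrite ler_wpM2l ?expR_ge0//; apply: HD; rewrite muln_gt0 y0.
  have -> : (2 * y r)%:R `^ (p / 2) = 2 `^ (p / 2) * (y r)%:R `^ (p / 2) :> R.
    by rewrite natrM powRM// ltW.
  have -> : (y r)%:R^-1 `^ p = (y r)%:R^-1 `^ (p / 2) * (y r)%:R^-1 `^ (p / 2) :> R.
    rewrite -powRD; first by congr (_ `^ _); lra.
    by rewrite invr_eq0 (gt_eqF (yR0 r)) implybT.
  have yy : (y r)%:R^-1 `^ (p / 2) * (y r)%:R `^ (p / 2) = 1 :> R.
    by rewrite -powRM ?invr_ge0 ?(ltW (yR0 r))// mulVf ?gt_eqF// powR1.
  have -> : (y r)%:R^-1 `^ (p / 2) = (2^-1 ^+ r) `^ (p / 2) * (lo j)%:R^-1 `^ (p / 2) :> R.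
    by rewrite /y natrM natrX invfM exprVn powRM ?invr_ge0 ?exprn_ge0.
  move: yy.
  have -> : (y r)%:R^-1 `^ (p / 2) = (2^-1 ^+ r) `^ (p / 2) * (lo j)%:R^-1 `^ (p / 2) :> R.
    by rewrite /y natrM natrX invfM exprVn powRM ?invr_ge0 ?exprn_ge0.
  set u := (2^-1 ^+ r) `^ (p / 2); set v := (lo j)%:R^-1 `^ (p / 2) => yy.
  have -> : forall a b, u * v * (u * v) * (a * (D * (b * (y r)%:R `^ (p / 2)))) =
      (a * b * (D * v)) * u * (u * v * (y r)%:R `^ (p / 2)) by move=> a b; ring.
  rewrite yy mulr1.
  have Dv : 0 <= D * v by rewrite mulr_ge0.
  have i0 : 0 <= 2^-1 :> R by rewrite invr_ge0.
  have u1 : u <= 2^-1 ^+ r.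
    rewrite /u -(@powR_pred _ _ (p / 2)) ?exprn_ge0//; last by lra.
    rewrite ler_piMr ?exprn_ge0//.
    apply: (@le_trans _ _ (1 `^ (p / 2 - 1))); last by rewrite powR1.
    apply: ge0_ler_powR; rewrite ?nnegrE ?exprn_ge0//; first by lra.
    by rewrite exprn_ile1//; lra.
  have h2 : 2 `^ (p / 2) <= expR p :> R.
    apply: le_trans (@powR_le_expR _ 2 1 (p / 2) _ _ _) _ => //; first exact: expR_ge2.
      by lra.
    by rewrite ler_expR; lra.
  apply: ler_pM => //; rewrite ?mulr_ge0 ?powR_ge0 ?expR_ge0//.
  by rewrite ler_wpM2r// ler_wpM2l ?expR_ge0.
apply: le_trans (ler_sum _ (fun r _ => tm r)) _.
rewrite -mulr_sumr E4.
have geo (k : nat) : \sum_(0 <= r < k) 2^-1 ^+ r = 2 - 2 * 2^-1 ^+ k :> R.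
  elim: k => [|k IH]; first by rewrite big_geq// expr0; lra.
  by rewrite big_nat_recr//= IH exprS; lra.
rewrite geo.
have g2 : 2 - 2 * 2^-1 ^+ L <= expR p :> R.
  have : 0 <= 2^-1 ^+ L :> R by rewrite exprn_ge0// invr_ge0.
  by lra.
rewrite [leRHS](_ : _ = expR (2 * p) * expR p * (D * (lo j)%:R^-1 `^ (p / 2)) * expR p); last by ring.
by rewrite ler_wpM2l// !mulr_ge0// expR_ge0.
Qed.

(** The recursion follows that of [maxfun], so that the cardinality bound can be
    carried through the induction of [maximal_inequality]. *)
Fixpoint bounded (js : seq J) (B : {set I}) (Q : nat) : Prop :=
  if js is j :: js' then forall m, bounded js' (B :&: level (c j) m) (Q * m)
  else (#|B| <= Q)%N.

Lemma bounded_card js B Q : uniq js ->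
  (forall k : J -> nat,
     (#|B :&: [set i | all (fun j => (c j i < k j)%N) js]%SET| <= Q * \prod_(j <- js) k j)%N) ->
  bounded js B Q.
Proof.
elim: js B Q => [|j js IH] B Q /=.
  move=> _ /(_ (fun=> 0%N)); rewrite big_nil muln1.
  by rewrite (_ : [set i | true]%SET = [set: I]%SET) ?finset.setIT//; apply/finset.setP => i; rewrite !inE.
move=> /andP[jn ju] h m; apply: IH => // k.
have := h (fun j' => if j' == j then m else k j').
rewrite big_cons eqxx mulnA.
have -> : (\prod_(i <- js) (if i == j then m else k i) = \prod_(i <- js) k i)%N.
  by rewrite big_seq [RHS]big_seq; apply: eq_bigr => i ij; case: eqP => // e; rewrite -e ij in jn.
congr (_ <= _)%N; congr #|pred_of_set _|; apply/finset.setP => i; rewrite !inE.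
rewrite -andbA; congr (_ && (_ && _)).
by apply: eq_in_all => j' j'j; case: eqP => // e; rewrite -e j'j in jn.
Qed.

Lemma maxfun_ge js B k w : (forall j, j \in js -> (lo j <= k j < L)%N) ->
  (\prod_(j <- js) k j)%N%:R^-1 *
    `|psum X (B :&: [set i | all (fun j => (c j i < k j)%N) js]%SET) w| <= maxfun js B w.
Proof.
elim: js B => [|j js IH] B h /=.
  rewrite big_nil invr1 mul1r (_ : [set i | true]%SET = [set: I]%SET) ?finset.setIT//.
have kin : k j \in index_iota (lo j) L.
  by rewrite mem_index_iota; apply: h; rewrite inE eqxx.
apply: le_trans (_ : _ <= (k j)%:R^-1 * maxfun js (B :&: level (c j) (k j)) w) _; last first.
  exact: (le_bigmax_seq 0 (k j) xpredT (fun l => l%:R^-1 * maxfun js (B :&: level (c j) l) w)).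
rewrite big_cons natrM invfM -mulrA ler_wpM2l ?invr_ge0//.
apply: le_trans (IH _ _); last by move=> j' j'j; apply: h; rewrite inE j'j orbT.
rewrite le_eqVlt; apply/orP; left; apply/eqP; congr (_ * `|psum X _ w|).
by apply/finset.setP => i; rewrite !inE andbA.
Qed.

(** Each coordinate costs a constant factor only: the moment of the sum grows with
    the level to the power [p / 2], and averaging divides it by the level to the
    power [p]. *)
Lemma maximal_inequality js B Q : all (fun j => (0 < lo j)%N) js -> bounded js B Q ->
  Ex (fun w => maxfun js B w `^ p) <=
  expR (4 * p) ^+ size js * (expR (5 * p) * Q%:R * sigma ^+ 2) `^ (p / 2)
    * \prod_(j <- js) (lo j)%:R^-1 `^ (p / 2).
Proof.
have p20 : 0 <= p / 2 by rewrite divr_ge0.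
elim: js B Q => [|j js IH] B Q /=.
  move=> _ BQ; rewrite expr0 mul1r big_nil mulr1.
  apply: (@le_trans _ _ ((expR (5 * p) * (size (enum B))%:R * sigma ^+ 2) `^ (p / 2))).
    rewrite (@eq_Rintegral _ _ _ _ _ (fun w => `|\sum_(i <- enum B) X i w| `^ p)); last first.
      by move=> w _; rewrite /psum big_enum.
    by apply: (moment_sum_le p2 indX X0 sigma0 Xp Xm); exact: enum_uniq.
  apply: ge0_ler_powR => //.
    exact: mulr_ge0 (mulr_ge0 (expR_ge0 _) (ler0n _ _)) (sqr_ge0 _).
    exact: mulr_ge0 (mulr_ge0 (expR_ge0 _) (ler0n _ _)) (sqr_ge0 _).
  by rewrite ler_wpM2r ?sqr_ge0// ler_wpM2l ?expR_ge0// ler_nat -cardE.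
move=> /andP[l0 ljs] BQ; rewrite big_cons exprS.
set D := expR (4 * p) ^+ size js * (expR (5 * p) * Q%:R * sigma ^+ 2) `^ (p / 2)
    * \prod_(j <- js) (lo j)%:R^-1 `^ (p / 2).
have D0 : 0 <= D.
  by rewrite !mulr_ge0 ?exprn_ge0 ?expR_ge0 ?powR_ge0// prodr_ge0// => i _; rewrite powR_ge0.
have H m : (0 < m)%N ->
     Ex (fun w => maxfun js (B :&: level (c j) m) w `^ p) <= D * m%:R `^ (p / 2).
  move=> _; apply: le_trans (IH _ _ ljs (BQ m)) _.
  have -> : expR (5 * p) * (Q * m)%:R * sigma ^+ 2 = expR (5 * p) * Q%:R * sigma ^+ 2 * m%:R.
    by rewrite natrM; ring.
  rewrite powRM//; last exact: mulr_ge0 (mulr_ge0 (expR_ge0 _) (ler0n _ _)) (sqr_ge0 _).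
  rewrite /D.
  by rewrite le_eqVlt; apply/orP; left; apply/eqP; ring.
apply: le_trans (maxfun_step l0 D0 H) _.
by rewrite le_eqVlt /D; apply/orP; left; apply/eqP; ring.
Qed.
End MaximalInequalityAverages.

(** * Boxes and shifts in a lattice *)

Section LatticeSums.
Context {d : nat}.
Implicit Type n : 'I_d -> nat.

Lemma sum_lattice_prod (R : comPzSemiRingType) n (F : forall j, 'I_(n j) -> R) :
  \sum_(z : lattice n) \prod_j F j (z j) = \prod_j \sum_k F j k.
Proof.
pose T_ (j : 'I_d) : finType := 'I_(n j).
rewrite (reindex (@dffun_of_fprod _ T_))/=; last exact/onW_bij/dffun_of_fprod_bij.
transitivity (\sum_(t : fprod T_) \prod_(j in 'I_d)
    ([ffun k => F j k] : {ffun T_ j -> R}) (t j)).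
  by apply: eq_bigr => t _; apply: eq_bigr => j _; rewrite !ffunE.
rewrite (@big_fprod R 0 1 *%R +%R 'I_d T_ (fun j => [ffun k => F j k])).
under [RHS]eq_bigr => j _ do rewrite (@big_tag _ _ _ _ T_ (fun j => F j) j).
rewrite bigA_distr_big_dep; apply: eq_bigr => g _; apply: eq_bigr => j _.
rewrite /untag; case: eqP => // e; by rewrite ffunE.
Qed.

Lemma card_lattice_prod n (Q : forall j, pred 'I_(n j)) :
  #|[set z : lattice n | [forall j, Q j (z j)]]%SET| = (\prod_j #|Q j|)%N.
Proof.
apply/eqP; rewrite -(eqr_nat rat); apply/eqP.
rewrite natr_prod -sum1_card natr_sum.
under [RHS]eq_bigr => j _ do rewrite -sum1_card natr_sum.
have -> : \prod_(j < d) \sum_(i in Q j) 1 = \prod_(j < d) \sum_(i : 'I_(n j)) (Q j i)%:R :> rat.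
  by apply: eq_bigr => j _; rewrite big_mkcond; apply: eq_bigr => i _; rewrite unfold_in; case: (Q j i).
rewrite -sum_lattice_prod big_mkcond; apply: eq_bigr => z _; rewrite inE.
case: ifPn => [/forallP h|]; first by rewrite big1// => j _; rewrite h.
by rewrite negb_forall => /existsP[j /negbTE h]; rewrite (bigD1 j)//= h mul0r.
Qed.

Lemma card_lattice n : #|lattice n| = (\prod_j n j)%N.
Proof.
have := @card_lattice_prod n (fun j => predT).
under [RHS]eq_bigr do rewrite card_ord.
move=> <-; rewrite -cardsT; congr #|pred_of_set _|; apply/finset.setP => z.
by rewrite !inE; apply/esym/forallP.
Qed.

Lemma lleP n (u v : lattice n) : reflect (forall j, u j <= v j)%N (lle u v).
Proof. exact: forallP. Qed.

Lemma lle_refl n (u : lattice n) : lle u u.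
Proof. exact/lleP. Qed.

Lemma lle_trans n (u v w : lattice n) : lle u v -> lle v w -> lle u w.
Proof. by move=> /lleP h1 /lleP h2; apply/lleP => j; exact: leq_trans (h1 j) (h2 j). Qed.

Definition volume n (u v : lattice n) : nat := (\prod_j (v j - u j).+1)%N.

Lemma volume_gt0 n (u v : lattice n) : (0 < volume u v)%N.
Proof. exact: prodn_gt0. Qed.

Lemma card_ord_interval k (i j : 'I_k) : (i <= j)%N ->
  #|[pred l : 'I_k | (i <= l <= j)%N]| = (j - i).+1.
Proof.
move=> ij; rewrite -sum1_card.
rewrite -(big_mkord (fun l => (i <= l <= j)%N) (fun=> 1%N)).
have := big_nat_widen 0 j.+1 k (fun l => (i <= l)%N) (fun=> 1%N) (ltn_ord j) (op := addn) (idx := 0%N).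
rewrite -(big_nat_widenl i 0 j.+1 xpredT)//= => <-.
by rewrite sum_nat_const_nat muln1 subSn.
Qed.

Lemma card_box n (u v : lattice n) : lle u v -> #|box u v| = volume u v.
Proof.
move=> /lleP uv; rewrite /volume.
have := @card_lattice_prod n (fun j => [pred l : 'I_(n j) | (u j <= l <= v j)%N]).
under [RHS]eq_bigr => j _ do rewrite card_ord_interval//.
move=> <-; congr #|pred_of_set _|; apply/finset.setP => z; rewrite !inE.
apply/andP/forallP => [[/lleP h1 /lleP h2] j|h] /=; first by rewrite h1 h2.
by split; apply/lleP => j; case/andP: (h j).
Qed.

End LatticeSums.

Section Shift.
Context {R : realType} {d : nat} (n : 'I_d -> nat) (e : 'I_d -> nat).

Definition shiftable (z : lattice n) : bool := [forall j, (z j + e j < n j)%N].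

Definition shift (z : lattice n) : lattice n :=
  [ffun j => insubd (z j) (z j + e j)%N] : {dffun forall j : 'I_d, 'I_(n j)}.

Lemma shiftE z j : shiftable z -> shift z j = (z j + e j)%N :> nat.
Proof. by move=> /forallP/(_ j) h; rewrite ffunE val_insubd h. Qed.

Lemma shift_inj : {in shiftable &, injective shift}.
Proof.
move=> y z ys zs yz; apply/ffunP => j; apply: val_inj => /=.
by apply: (@addIn (e j)); rewrite -!shiftE// yz.
Qed.

Lemma lle_shift z : shiftable z -> lle z (shift z).
Proof. by move=> zs; apply/lleP => j; rewrite shiftE// leq_addr. Qed.

(** The shift is injective, so that the sum over the shifted points does not exceed
    the sum over all points; only those that cannot be shifted are left over. *)
Lemma sum_shift_le (g : lattice n -> R) W : (forall z, 0 <= g z <= W) ->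
  \sum_(z | shiftable z) (g (shift z) - g z) <= #|[set z | ~~ shiftable z]%SET|%:R * W.
Proof.
move=> gW; rewrite sumrB lerBlDr.
have -> : \sum_(z | shiftable z) g (shift z) = \sum_(z in shift @: shiftable) g z.
  by rewrite big_imset//=; exact: shift_inj.
apply: (@le_trans _ _ (\sum_z g z)).
  by rewrite [leRHS](bigID (mem (shift @: shiftable)))/= lerDl sumr_ge0// => z _; case/andP: (gW z).
rewrite (bigID shiftable)/= addrC lerD2r.
apply: (@le_trans _ _ (\sum_(z | ~~ shiftable z) W)).
  by apply: ler_sum => z _; case/andP: (gW z).
rewrite sumr_const mulr_natl le_eqVlt; apply/orP; left; apply/eqP.
by congr (_ *+ _); apply: eq_card => z; rewrite !inE.
Qed.

(** A point that cannot be shifted has, in some direction [j], its coordinate in a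
    slab of thickness [e j]. *)
Lemma card_unshiftable : (forall j, 0 < n j)%N ->
  #|[set z | ~~ shiftable z]%SET|%:R <= (\prod_j n j)%N%:R * \sum_j (e j)%:R / (n j)%:R :> R.
Proof.
move=> n0; pose U j := [set z : lattice n | (n j <= z j + e j)%N]%SET.
have cU j : #|U j|%:R <= (\prod_j n j)%N%:R * ((e j)%:R / (n j)%:R) :> R.
  have -> : U j = [set z : lattice n | [forall i, (i == j) ==> (n i <= z i + e i)%N]]%SET.
    apply/finset.setP => z; rewrite !inE; apply/idP/forallP => [h i|/(_ j)].
      by apply/implyP => /eqP ->.
    by rewrite eqxx.
  rewrite (@card_lattice_prod _ n (fun i k => (i == j) ==> (n i <= k + e i)%N)).
  rewrite (bigD1 j)//= [in leRHS](bigD1 j)//= natrM.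
  have nj : (n j)%:R != 0 :> R by rewrite pnatr_eq0 -lt0n.
  rewrite [leRHS](_ : _ = (e j)%:R * (\prod_(i < d | i != j) n i)%N%:R); last first.
    by rewrite natrM; field.
  apply: ler_pM => //.
    rewrite ler_nat; apply: (@leq_trans #|[pred k : 'I_(n j) | (n j - e j <= k)%N]|).
      by apply: subset_leq_card; apply/fintype.subsetP => k; rewrite !unfold_in /= eqxx /= leq_subLR addnC.
    rewrite -sum1_card -(big_mkord (fun l => (n j - e j <= l)%N) (fun=> 1%N)).
    rewrite -(@big_nat_widenl _ _ _ _ _ _ xpredT)// sum_nat_const_nat muln1.
    by rewrite leq_subCl.
  rewrite ler_nat; apply: leq_prod => i ij.
  by rewrite -[leqRHS]card_ord max_card.
have : [set z | ~~ shiftable z]%SET \subset (\bigcup_j U j)%SET.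
  apply/fintype.subsetP => z; rewrite inE negb_forall => /existsP[j].
  by rewrite -leqNgt => h; apply/bigcupP; exists j; rewrite ?inE.
move/subset_leq_card => h.
apply: (@le_trans _ _ (\sum_j #|U j|%:R)).
  rewrite -natr_sum ler_nat; apply: leq_trans h _.
  elim/big_rec2: _ => [|j A s _ h]; first by rewrite cards0.
  by apply: leq_trans (leq_card_setU _ _) _; rewrite leq_add2l.
by rewrite mulr_sumr; apply: ler_sum.
Qed.
End Shift.

(** * Counting points with small span *)

Section Levels.
Context {R : realType} (d : nat) (m : nat -> nat).
Hypothesis m_gt0 : forall s, (0 < m s)%N.
Hypothesis m_end : m d.+1 = 1%N.
Hypothesis m_sorted : forall s, (1 <= s < d)%N -> (m s.+1 <= m s)%N.
Hypothesis d_gt0 : (0 < d)%N.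
Implicit Types (t D lam : R) (s k : nat).

Lemma cumside_gt0 s : (0 < cumside m s)%N.
Proof. by rewrite /cumside prodn_gt0. Qed.

Lemma knotS s : knot R m s.+1 = (cumside m s)%:R / (m s.+1)%:R ^+ s.
Proof.
rewrite /knot /cumside big_nat_recr//= natrM exprS invfM mulrA; congr (_ / _).
by rewrite mulfK// pnatr_eq0 -lt0n.
Qed.

Lemma side_antitone i j : (1 <= i)%N -> (i <= j)%N -> (j <= d)%N -> (m j <= m i)%N.
Proof.
move=> i1; elim: j => [|j IH]; first by rewrite leqn0 => /eqP ->.
rewrite leq_eqVlt => /predU1P[->//|]; rewrite ltnS => ij jd.
apply: leq_trans (IH ij (ltnW jd)); apply: m_sorted; rewrite jd andbT.
exact: leq_trans ij.
Qed.

Lemma knot_bracket t : 1 <= t <= (cumside m d)%:R ->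
  exists2 s, (1 <= s <= d)%N & knot R m s <= t <= knot R m s.+1.
Proof.
move=> /andP[t1 tN].
have H k : (1 <= k <= d)%N -> t <= knot R m k.+1 ->
    exists2 s, (1 <= s <= d)%N & knot R m s <= t <= knot R m s.+1.
  elim: k => [//|[|k] IH] kd tk; first by exists 1%N => //; rewrite tk knot_1// t1.
  have [h|h] := lerP (knot R m k.+2) t; first by exists k.+2 => //; rewrite h tk.
  by apply: IH (ltW h); rewrite /= ltnW//; case/andP: kd.
by apply: (H d); rewrite ?d_gt0 ?leqnn// knot_end.
Qed.

(** The level [t] corresponds to the box with sides [max(1, lam m_j)], a scaled
    copy of the whole box cut off at side length one; its volume is [t]. *)
Lemma Hfun_level t : 1 <= t <= (cumside m d)%:R ->
  exists s lam, [/\ (1 <= s <= d)%N, 0 < lam,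
    lam ^+ s * (cumside m s)%:R = t,
    (forall j, (1 <= j <= s)%N -> 1 <= lam * (m j)%:R) /\
    (forall j, (s < j <= d)%N -> lam * (m j)%:R <= 1) &
    forall D, 0 <= D -> Hfun d m D t = Num.min 1 (D * Num.sqrt t * lam)].
Proof.
move=> ht; have [s hs /andP[st1 st2]] := knot_bracket ht.
have /andP[t1 _] := ht; have t0 : 0 < t by exact: lt_le_trans t1.
have /andP[s1 sd] := hs; have sn0 : s%:R != 0 :> R by rewrite pnatr_eq0 -lt0n.
have c0 : 0 < (cumside m s)%:R :> R by rewrite ltr0n cumside_gt0.
pose lam := (t / (cumside m s)%:R) `^ s%:R^-1.
have lam0 : 0 < lam by rewrite powR_gt0// divr_gt0.
have lamX : lam ^+ s = t / (cumside m s)%:R.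
  by rewrite -powR_mulrn ?powR_ge0// /lam -powRrM mulVf// powRr1// divr_ge0// ltW.
have mR k : 0 < (m k)%:R :> R by rewrite ltr0n.
have l1 : 1 <= lam * (m s)%:R.
  rewrite -(@ler_pXn2r _ s) ?nnegrE ?mulr_ge0 ?(ltW lam0)// expr1n exprMn lamX.
  by move: st1; rewrite /knot ler_pdivrMr ?exprn_gt0// mulrAC ler_pdivlMr// mul1r.
have l2 : lam * (m s.+1)%:R <= 1.
  rewrite -(@ler_pXn2r _ s) ?nnegrE ?mulr_ge0 ?(ltW lam0)// expr1n exprMn lamX.
  by move: st2; rewrite knotS ler_pdivlMr ?exprn_gt0// mulrAC ler_pdivrMr// mul1r.
exists s, lam; split => //.
- by rewrite lamX divfK// gt_eqF.
- split=> j /andP[j1 j2].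
    by apply: le_trans l1 _; rewrite ler_pM2l// ler_nat side_antitone.
  by apply: le_trans l2; rewrite ler_pM2l// ler_nat side_antitone.
- by move=> D D0; rewrite (@HfunE R d m m_gt0 m_end m_sorted D D0 d_gt0 s t hs) ?st1.
Qed.

Lemma cumsideS s : cumside m s.+1 = (cumside m s * m s.+1)%N.
Proof. by rewrite /cumside big_nat_recr. Qed.

(** With [lam] the scale of the level [t], the volume [lam ^+ k * cumside m k] is
    largest where the active piece is, since the factors [lam * m j] are at least
    one before this index and at most one after it. *)
Lemma Hfun_le_piece D t k : 0 <= D -> (1 <= k <= d)%N -> 1 <= t <= (cumside m d)%:R ->
  Hfun d m D t <= D * Num.sqrt t * (t / (cumside m k)%:R) `^ k%:R^-1.
Proof.
move=> D0 /andP[k1 kd] ht.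
have [s [lam [/andP[s1 sd] lam0 lt [la lb] ->]]] := Hfun_level ht; last by [].
have /andP[t1 _] := ht; have t0 : 0 < t by exact: lt_le_trans t1.
rewrite ge_min; apply/orP; right; rewrite ler_wpM2l ?mulr_ge0 ?sqrtr_ge0//.
have c0 : 0 < (cumside m k)%:R :> R by rewrite ltr0n cumside_gt0.
have base : lam ^+ k * (cumside m k)%:R <= t.
  have [ks|/ltnW sk] := leqP k s.
    have H i : (i <= s - k)%N -> lam ^+ k * (cumside m k)%:R <= lam ^+ (k + i) * (cumside m (k + i))%:R.
      elim: i => [|i IH] ik; first by rewrite addn0.
      apply: le_trans (IH (ltnW ik)) _; rewrite addnS cumsideS exprSr natrM.
      rewrite [leRHS](_ : _ = lam ^+ (k + i) * (cumside m (k + i))%:R * (lam * (m (k + i).+1)%:R)); last by ring.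
      rewrite ler_peMr//; first by rewrite mulr_ge0// exprn_ge0// ltW.
      by apply: la; rewrite /= -addnS -leq_subRL.
    by have := H _ (leqnn _); rewrite subnKC// lt.
  have H i : (i <= k - s)%N -> lam ^+ (s + i) * (cumside m (s + i))%:R <= t.
    elim: i => [|i IH] ik; first by rewrite addn0 lt.
    apply: le_trans (IH (ltnW ik)); rewrite addnS cumsideS exprSr natrM.
    rewrite [leLHS](_ : _ = lam ^+ (s + i) * (cumside m (s + i))%:R * (lam * (m (s + i).+1)%:R)); last by ring.
    rewrite ler_piMr//; first by rewrite mulr_ge0// exprn_ge0// ltW.
    apply: lb; rewrite ltnS leq_addr /= -addnS.
    by apply: leq_trans kd; rewrite -leq_subRL.
  by have := H _ (leqnn _); rewrite subnKC.
have kn0 : k%:R != 0 :> R by rewrite pnatr_eq0 -lt0n.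
have lamE : lam = (lam ^+ k) `^ k%:R^-1.
  by rewrite -powR_mulrn ?(ltW lam0)// -powRrM mulfV// powRr1// ltW.
rewrite lamE.
apply: ge0_ler_powR; rewrite ?nnegrE ?invr_ge0 ?exprn_ge0 ?divr_ge0 ?(ltW lam0) ?(ltW t0)//.
by rewrite ler_pdivlMr.
Qed.

Lemma cumside_ord s : (s <= d)%N ->
  \prod_(j < d) (if (j < s)%N then (m j.+1)%:R else 1) = (cumside m s)%:R :> R.
Proof.
move=> sd; rewrite -(big_mkord xpredT (fun j => if (j < s)%N then (m j.+1)%:R else 1 : R)).
rewrite -big_mkcond -(big_nat_widen 0 s d xpredT)//.
by rewrite /cumside natr_prod big_add1.
Qed.

Lemma cumside_full : cumside m d = (\prod_(j < d) m j.+1)%N.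
Proof. by rewrite /cumside big_add1 /= big_mkord. Qed.

Notation n := (fun j : 'I_d => m j.+1).
Variables (D : R) (g : lattice n -> R) (top : lattice n).
Hypothesis D0 : 0 <= D.
Hypothesis gD : forall z, 0 <= g z <= D.
Hypothesis gm : forall u v, lle u v -> g u <= g v.
Hypothesis topP : forall z, lle z top.

Implicit Types (z v u : lattice n).

Definition good (z v : lattice n) : bool :=
  lle z v && (g v - g z <= (Num.sqrt (volume z v)%:R)^-1).

(** The largest volume of a box with lower corner [z] over which [g] varies by
    no more than the standard deviation of an average over that box. *)
Definition span z : nat := \max_(v | good z v) volume z v.

Lemma good_refl z : good z z.
Proof. by rewrite /good lle_refl subrr invr_ge0 sqrtr_ge0. Qed.

Lemma volume_refl z : volume z z = 1%N.
Proof. by rewrite /volume big1// => j _; rewrite subnn. Qed.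

Lemma span_ge z v : good z v -> (volume z v <= span z)%N.
Proof. by move=> h; exact: (leq_bigmax_cond (F := fun v => volume z v)). Qed.

Lemma span_gt0 z : (0 < span z)%N.
Proof. by rewrite -(volume_refl z) span_ge ?good_refl. Qed.

Lemma span_good z : exists2 v, good z v & volume z v = span z.
Proof.
have : (0 < #|[pred v | good z v]|)%N by apply/card_gt0P; exists z; rewrite inE good_refl.
by move=> /(eq_bigmax_cond (fun v => volume z v))[v]; rewrite inE => h e; exists v.
Qed.

Lemma volume_le_card z v : (volume z v <= cumside m d)%N.
Proof.
rewrite cumside_full; apply: leq_prod => j _.
by apply: leq_ltn_trans (ltn_ord (v j)); exact: leq_subr.
Qed.

Lemma span_le z : (span z <= cumside m d)%N.
Proof. by apply/bigmax_leqP => v _; exact: volume_le_card. Qed.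

(** Lowering one coordinate by one divides the volume by two at most. *)
Lemma volume_between z v (t : nat) : lle z v -> (0 < t)%N -> (t <= volume z v)%N ->
  exists2 v', lle z v' & (t <= volume z v' <= 2 * t)%N.
Proof.
elim: {v}(volume z v) {-2}v (leqnn (volume z v)) => [|N IH] v vN zv t0 tv.
  by move: vN; rewrite leqn0 => /eqP e; move: (volume_gt0 z v); rewrite e.
have [h|h] := leqP (volume z v) (2 * t); first by exists v => //; rewrite tv.
have [j zvj] : exists j, (z j < v j)%N.
  apply/existsP; rewrite -[X in is_true X]negbK; apply/negP; rewrite negb_exists => /forallP h'.
  move: h; rewrite /volume big1 => [|j _]; first by rewrite ltnNge (leq_trans t0)// leq_pmull.
  by have := h' j; rewrite -leqNgt -subn_eq0 => /eqP ->.
pose v' : lattice n := [ffun i => insubd (v i) (if i == j then (v i).-1 else v i)] : {dffun forall j : 'I_d, 'I_(n j)}.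
have v'E i : v' i = (if i == j then (v i).-1 else v i) :> nat.
  rewrite ffunE val_insubd; case: ifPn => //; case: eqP => // _ /negP[].
  by apply: leq_ltn_trans (leq_pred _) (ltn_ord _).
have zv' : lle z v'.
  apply/lleP => i; rewrite v'E; case: eqP => [->|_]; last by move/lleP: zv.
  by rewrite -ltnS prednK// (leq_ltn_trans _ zvj).
have e : volume z v' = ((v j - z j) * \prod_(i < d | i != j) (v i - z i).+1)%N.
  rewrite /volume (bigD1 j)//= v'E eqxx; congr (_ * _)%N.
    by rewrite -subn1 subnAC subn1 prednK// subn_gt0.
  by apply: eq_bigr => i /negbTE ij; rewrite v'E ij.
have e2 : volume z v = ((v j - z j).+1 * \prod_(i < d | i != j) (v i - z i).+1)%N.
  by rewrite /volume (bigD1 j).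
have P0 : (0 < \prod_(i < d | i != j) (v i - z i).+1)%N by exact: prodn_cond_gt0.
have k0 : (0 < v j - z j)%N by rewrite subn_gt0.
apply: (IH v') => //.
  by rewrite -ltnS; apply: leq_trans vN; rewrite e e2 ltn_pmul2r.
rewrite -(leq_pmul2l (ltn0Sn 1)); apply: leq_trans (ltnW h) _.
by rewrite e e2 mulnA leq_mul2r; apply/orP; right; rewrite mul2n -addnn -addn1 leq_add2l.
Qed.

Lemma volume_shift e z : shiftable e z -> volume z (shift e z) = (\prod_j (e j).+1)%N.
Proof. by move=> zs; apply: eq_bigr => j _; rewrite shiftE// addnC addnK. Qed.

Definition count_constant : R := d%:R * (2 + 2 ^+ d).

(** Below the level [1 / (2 D^2)] nothing is counted. Above it, shift by
    [floor(lam m_j)]: either the shift leaves the box, or [g] increases by more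
    than [t^(-1/2)] along it, and the increments telescope. *)
Lemma card_span_lt (t : nat) : (1 <= t <= cumside m d)%N ->
  #|[set z | (1 < D * Num.sqrt (volume z top)%:R) && (span z < t)%N]%SET|%:R
    <= count_constant * (cumside m d)%:R * Hfun d m D t%:R.
Proof.
move=> /andP[t1 tN]; set B := [set z | _]%SET.
have tR0 : 0 < t%:R :> R by rewrite ltr0n.
have N0 : 0 <= (cumside m d)%:R :> R by [].
have d1 : 1 <= d%:R :> R by rewrite ler1n.
have P2 : 1 <= 2 ^+ d :> R by rewrite exprn_ege1// ler1n.
have ht : 1 <= (t%:R : R) <= (cumside m d)%:R by rewrite ler1n t1 ler_nat.
have [s [lam [/andP[s1 sd] lam0 lt [la lb] ->]]] := Hfun_level ht; last exact: D0.
have sqt0 : 0 <= Num.sqrt t%:R :> R by exact: sqrtr_ge0.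
have K1 : 1 <= count_constant by rewrite /count_constant; nra.
have K0 : 0 <= count_constant by exact: le_trans K1.
have H0 : 0 <= Num.min 1 (D * Num.sqrt t%:R * lam).
  by rewrite le_min ler01 !mulr_ge0// ltW.
have [small|large] := ltrP (2 * t%:R * D ^+ 2) 1.
  rewrite (_ : B = finset.set0) ?cards0 ?mulr_ge0//.
  apply/finset.setP => z; rewrite !inE; apply/negP => /andP[big zt].
  have Dg0 : 0 < D by rewrite lt_neqAle D0 andbT; apply/eqP => D00; move: big; rewrite -D00 mul0r ltr10.
  have tv : (t <= volume z top)%N.
    rewrite -(ler_nat R) -(@ler_pM2l _ (D ^+ 2)) ?exprn_gt0//.
    have : 1 < D ^+ 2 * (volume z top)%:R.
      rewrite -[X in _ < _ * X]sqr_sqrtr// -exprMn.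
      by rewrite expr_gt1// mulr_ge0 ?sqrtr_ge0.
    nra.
  have [v zv /andP[tv1 tv2]] := volume_between (topP z) t1 tv.
  have : good z v.
    rewrite /good zv /=; apply: (@le_trans _ _ D).
      by have := gD z; have := gD v; lra.
    rewrite -[leLHS]invrK lef_pV2 ?posrE ?invr_gt0 ?sqrtr_gt0 ?ltr0n ?volume_gt0//.
    rewrite -(@ler_pXn2r _ 2) ?nnegrE ?sqrtr_ge0 ?invr_ge0//.
    rewrite sqr_sqrtr// -(@ler_pM2l _ (D ^+ 2)) ?exprn_gt0// -exprMn divff ?gt_eqF// expr1n.
    have : (volume z v)%:R <= 2 * t%:R :> R by rewrite -natrM ler_nat.
    by have := sqr_ge0 D; nra.
  by move/span_ge => h; move: zt; rewrite ltnNge (leq_trans tv1).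
pose e (j : 'I_d) := Num.truncn (lam * (m j.+1)%:R).
have eR j : (e j)%:R <= lam * (m j.+1)%:R < (e j).+1%:R.
  by apply: truncn_itv; rewrite mulr_ge0// ltW.
pose V := (\prod_j (e j).+1)%N.
have tE : t%:R = \prod_(j < d) (if (j < s)%N then lam * (m j.+1)%:R else 1).
  rewrite -lt -cumside_ord//.
  have -> : lam ^+ s = \prod_(j < d) (if (j < s)%N then lam else 1).
    rewrite -(big_mkord xpredT (fun j => if (j < s)%N then lam else 1)).
    by rewrite -big_mkcond -(big_nat_widen 0 s d xpredT)// prodr_const_nat subn0.
  by rewrite -big_split/=; apply: eq_bigr => j _; case: ifP; rewrite ?mulr1.
have tV : t%:R <= V%:R :> R.
  rewrite tE /V natr_prod; apply: ler_prod => j _.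
  have /andP[e1 e2] := eR j.
  case: ifP => js; last by rewrite ler01 ler1n.
  by rewrite (ltW e2) mulr_ge0// ltW.
have Vt : V%:R <= 2 ^+ d * t%:R :> R.
  rewrite tE /V natr_prod.
  have -> : 2 ^+ d = \prod_(j < d) 2 :> R by rewrite prodr_const card_ord.
  rewrite -big_split/=; apply: ler_prod => j _; rewrite ler0n /=.
  have /andP[e1 e2] := eR j; rewrite -natr1.
  case: ifP => js; first by have := la j.+1 js; lra.
  by have := lb j.+1; rewrite ltnS leqNgt js ltn_ord => /(_ isT); lra.
pose U := [set z : lattice n | ~~ shiftable e z]%SET.
have cU : #|U|%:R <= (cumside m d)%:R * (d%:R * lam).
  have := card_unshiftable (n := n) (R := R) e (fun j => m_gt0 j.+1).
  rewrite cumside_full => /le_trans; apply; rewrite ler_wpM2l//.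
  apply: (@le_trans _ _ (\sum_(j < d) lam)); last by rewrite sumr_const card_ord mulr_natl.
  apply: ler_sum => j _; rewrite ler_pdivrMr ?ltr0n//.
  by case/andP: (eR j).
have sV0 : 0 < Num.sqrt V%:R :> R by rewrite sqrtr_gt0; exact: lt_le_trans tV.
pose F := [set z : lattice n | shiftable e z && (span z < t)%N]%SET.
have cF : #|F|%:R <= #|U|%:R * D * Num.sqrt V%:R.
  rewrite -ler_pdivrMr//.
  apply: le_trans (sum_shift_le e gD).
  rewrite (bigID (fun z => span z < t)%N)/=.
  apply: (@le_trans _ _ (\sum_(z in F) (Num.sqrt V%:R)^-1)).
    by rewrite sumr_const mulr_natl.
  rewrite (eq_bigl (fun z => shiftable e z && (span z < t)%N)); last by move=> z; rewrite inE.
  apply: (@le_trans _ _ (\sum_(z | shiftable e z && (span z < t)%N) (g (shift e z) - g z))).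
    apply: ler_sum => z /andP[zs zt]; rewrite leNgt; apply/negP => h.
    have : good z (shift e z) by rewrite /good lle_shift//= volume_shift// ltW.
    move/span_ge; rewrite volume_shift// -/V => Vs.
    by move: tV; rewrite ler_nat leqNgt (leq_ltn_trans Vs zt).
  by rewrite lerDl sumr_ge0// => z /andP[zs _]; rewrite subr_ge0 gm// lle_shift.
have cB : (#|B| <= #|U| + #|F|)%N.
  apply: leq_trans (leq_card_setU _ _); apply: subset_leq_card; apply/fintype.subsetP => z.
  by rewrite !inE => /andP[_ ->]; rewrite andbT orNb.
have cBN : (#|B| <= cumside m d)%N.
  by rewrite cumside_full -(card_lattice n) max_card.
have sq2 : Num.sqrt V%:R <= 2 ^+ d * Num.sqrt t%:R :> R.
  apply: (@le_trans _ _ (Num.sqrt ((2 ^+ d) ^+ 2 * t%:R))).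
    apply: ler_wsqrtr; apply: le_trans Vt _.
    by rewrite ler_wpM2r// expr2 ler_peMr// exprn_ge0.
  by rewrite sqrtrM ?sqr_ge0// sqrtr_sqr ger0_norm// exprn_ge0.
have one : 1 <= 2 * (D * Num.sqrt t%:R).
  have x0 : 0 <= D * Num.sqrt t%:R by rewrite mulr_ge0.
  rewrite -(@ler_pXn2r _ 2) ?nnegrE ?mulr_ge0// expr1n !exprMn sqr_sqrtr//.
  by move: large; have := sqr_ge0 D; nra.
have Bmain : #|B|%:R <= count_constant * (cumside m d)%:R * (D * Num.sqrt t%:R * lam).
  apply: (@le_trans _ _ (#|U|%:R * (1 + D * Num.sqrt V%:R))).
    by rewrite mulrDr mulr1 mulrA; apply: le_trans (lerD (lexx _) cF); rewrite -natrD ler_nat.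
  apply: (@le_trans _ _ (#|U|%:R * ((2 + 2 ^+ d) * (D * Num.sqrt t%:R)))).
    rewrite ler_wpM2l// mulrDl lerD// mulrCA ler_wpM2l//.
  rewrite /count_constant.
  rewrite [leRHS](_ : _ = (cumside m d)%:R * (d%:R * lam) * ((2 + 2 ^+ d) * (D * Num.sqrt t%:R))); last by ring.
  by rewrite ler_wpM2r// !mulr_ge0// addr_ge0.
case: (lerP 1 (D * Num.sqrt t%:R * lam)) => _; last exact: Bmain.
rewrite mulr1; apply: (@le_trans _ _ (cumside m d)%:R); first by rewrite ler_nat.
by rewrite ler_peMl.
Qed.
End Levels.

(** * Stieltjes integrals of decreasing powers *)

Section StieltjesBounds.
Context {R : realType}.
Variables (F : cumulative R R) (r : R).
Hypothesis r0 : 0 <= r.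
Local Notation mu := (lebesgue_stieltjes_measure F).
Local Notation w t := (t `^ (- r)).

Lemma stieltjes_itv_oc a b : a <= b -> mu `]a, b] = (F b - F a)%:E.
Proof.
move=> ab; rewrite /lebesgue_stieltjes_measure /= /measure_extension measurable_mu_extE/=; last exact: is_ocitv.
exact: wlength_itv_bnd.
Qed.

Lemma powRN_antitone a b : 0 < a -> a <= b -> w b <= w a.
Proof.
move=> a0 ab; rewrite !powRN lef_pV2 ?posrE ?powR_gt0//; last exact: lt_le_trans ab.
by apply: ge0_ler_powR; rewrite ?nnegrE ?(ltW a0)// (le_trans _ ab)// ltW.
Qed.

Lemma powRN_le1 a : 1 <= a -> w a <= 1.
Proof.
by move=> a1; apply: le_trans (powRN_antitone ltr01 a1) _; rewrite powR1.
Qed.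

Lemma stieltjes_integrable (D : set R) b : measurable D -> D `<=` `[1, b] ->
  mu.-integrable D (EFin \o (fun t => w t)).
Proof.
move=> mD Db.
have [b1|b1] := lerP 1 b; last first.
  rewrite (_ : D = set0); first exact: integrable_set0.
  by apply/seteqP; split=> // x /Db; rewrite /= in_itv/= => /andP[x1 xb]; move: (le_trans x1 xb); rewrite leNgt b1.
apply: measurable_bounded_integrable => //.
- apply: (@le_lt_trans _ _ (mu `]0, b])).
    apply: le_measure; rewrite ?inE//.
    apply: subset_trans Db _ => x /=; rewrite !in_itv/= => /andP[x1 ->].
    by rewrite andbT (lt_le_trans ltr01).
  by rewrite stieltjes_itv_oc ?ltry// (le_trans ler01).
- by apply: measurable_funTS; exact: measurable_powR.
- exists 1; split; first exact: num_real.
  move=> M M1 x /Db; rewrite /= in_itv/= => /andP[x1 _].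
  rewrite ger0_norm ?powR_ge0//; apply: le_trans (ltW M1).
  exact: powRN_le1.
Qed.

Let sub_oc (a b : R) : 1 <= a -> `]a, b] `<=` `[1, b].
Proof.
by move=> a1 x /=; rewrite !in_itv/= => /andP[ax ->]; rewrite (le_trans a1 (ltW ax)).
Qed.

Let oc_integrable (a b : R) : 1 <= a -> mu.-integrable `]a, b] (EFin \o (fun t => w t)).
Proof. by move=> a1; apply: (@stieltjes_integrable _ b) => //; exact: sub_oc. Qed.

Lemma fine_stieltjes_itv_oc a b : a <= b -> fine (mu `]a, b]) = F b - F a.
Proof. by move=> ab; rewrite stieltjes_itv_oc. Qed.

Let cst_integrable (a b c : R) : mu.-integrable `]a, b] (EFin \o cst c).
Proof.
apply/integrableP; split; first by apply/measurable_EFinP; exact: measurable_cst.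
rewrite (_ : (fun x => _) = cst `|c|%:E)// integral_cst//=; have [ab|ba] := lerP a b; last first.
  by rewrite set_itv_ge ?bnd_simp -?leNgt ?(ltW ba)// measure0 mule0.
by rewrite stieltjes_itv_oc// -EFinM ltry.
Qed.

Lemma stieltjes_integral_ge a b : 1 <= a -> a <= b ->
  w b * (F b - F a) <= \int[mu]_(t in `]a, b]) w t.
Proof.
move=> a1 ab; rewrite -fine_stieltjes_itv_oc// -Rintegral_cst//.
apply: le_Rintegral => //; [exact: cst_integrable|exact: oc_integrable|].
move=> x /=; rewrite in_itv/= => /andP[ax xb]; apply: powRN_antitone => //.
by apply: lt_trans ax; exact: lt_le_trans a1.
Qed.

Lemma stieltjes_integral_le a b : 1 <= a -> a <= b ->
  \int[mu]_(t in `]a, b]) w t <= w a * (F b - F a).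
Proof.
move=> a1 ab; rewrite -fine_stieltjes_itv_oc// -Rintegral_cst//.
apply: le_Rintegral => //; [exact: oc_integrable|exact: cst_integrable|].
move=> x /=; rewrite in_itv/= => /andP[ax xb]; apply: powRN_antitone (ltW ax).
exact: lt_le_trans a1.
Qed.

Lemma stieltjes_integral_cat a b c : 1 <= a -> a <= b -> b <= c ->
  \int[mu]_(t in `]a, c]) w t =
  \int[mu]_(t in `]a, b]) w t + \int[mu]_(t in `]b, c]) w t.
Proof.
move=> a1 ab bc.
rewrite (@itv_bndbnd_setU _ _ _ (BRight b)) ?bnd_simp//.
rewrite Rintegral_setU//.
  rewrite -(@itv_bndbnd_setU _ _ _ (BRight b)) ?bnd_simp//; exact: oc_integrable.
apply/disj_set2P; rewrite -subset0 => x [] /=.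
by rewrite !in_itv/= => /andP[_ xb] /andP[bx _]; move: (lt_le_trans bx xb); rewrite ltxx.
Qed.

Lemma stieltjes_integral_ge0 (D : set R) : 0 <= \int[mu]_(t in D) w t.
Proof. by apply: Rintegral_ge0 => x _; exact: powR_ge0. Qed.

Lemma stieltjes_integral_cc b : 1 <= b ->
  \int[mu]_(t in `[1, b]) w t =
  \int[mu]_(t in [set 1]) w t + \int[mu]_(t in `]1, b]) w t.
Proof.
move=> b1; rewrite -set_itv1 (@itv_bndbnd_setU _ _ _ (BRight 1)) ?bnd_simp//.
rewrite Rintegral_setU//.
  rewrite -(@itv_bndbnd_setU _ _ _ (BRight 1)) ?bnd_simp//.
  exact: (@stieltjes_integrable _ b).
apply/disj_set2P; rewrite -subset0 => x [] /=.
by rewrite !in_itv/= => /andP[_ xb] /andP[bx _]; move: (lt_le_trans bx xb); rewrite ltxx.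
Qed.

Lemma stieltjes_sum_le (N : nat) : (0 < N)%N ->
  \sum_(1 <= k < N) w k.+1%:R * (F k.+1%:R - F k%:R) <=
  \int[mu]_(t in `[1, N%:R]) w t.
Proof.
move=> N0; rewrite stieltjes_integral_cc ?ler1n//.
apply: (@le_trans _ _ (\int[mu]_(t in `]1, N%:R]) w t)); last first.
  by rewrite lerDr stieltjes_integral_ge0.
case: N N0 => // N _; elim: N => [|N IH].
  by rewrite big_geq// stieltjes_integral_ge0.
rewrite big_nat_recr//= (@stieltjes_integral_cat _ N.+1%:R) ?ler1n ?ler_nat//.
by apply: lerD => //; apply: stieltjes_integral_ge; rewrite ?ler1n ?ler_nat.
Qed.

(** An atom at the left end point is excluded by [F 0 = F 1]. *)
Lemma stieltjes_integral_cc_oc b : F 0 = F 1 -> 1 <= b ->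
  \int[mu]_(t in `[1, b]) w t = \int[mu]_(t in `]1, b]) w t.
Proof.
move=> F01 b1; rewrite stieltjes_integral_cc//.
suff -> : \int[mu]_(t in [set 1]) w t = 0 by rewrite add0r.
have m1 : mu [set 1] = 0%E.
  apply/eqP; rewrite eq_le measure_ge0 andbT.
  apply: (@le_trans _ _ (mu `]0, 1])).
    apply: le_measure; rewrite ?inE//.
    by move=> x ->; rewrite /= in_itv/= ltr01 lexx.
  by rewrite stieltjes_itv_oc// F01 subrr.
rewrite /Rintegral null_set_integral//.
apply: (measurable_int mu); apply: (@stieltjes_integrable _ 1) => // x ->.
by rewrite /= in_itv/= lexx.
Qed.
End StieltjesBounds.

(** * Summing over the levels *)

Section SpanSum.
Context {R : realType} (d : nat) (m : nat -> nat).
Hypothesis m_gt0 : forall s, (0 < m s)%N.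
Hypothesis m_end : m d.+1 = 1%N.
Hypothesis m_sorted : forall s, (1 <= s < d)%N -> (m s.+1 <= m s)%N.
Hypothesis d_gt0 : (0 < d)%N.
Notation n := (fun j : 'I_d => m j.+1).
Variables (D : R) (g : lattice n -> R) (top : lattice n).
Hypothesis D0 : 0 <= D.
Hypothesis gD : forall z, 0 <= g z <= D.
Hypothesis gm : forall u v, lle u v -> g u <= g v.
Hypothesis topP : forall z, lle z top.
Variable r : R.
Hypothesis r0 : 0 <= r.

Local Notation w t := (t `^ (- r)).
Local Notation N := (cumside m d).
Local Notation H := (fun k : nat => Hfun d m D k%:R).

Lemma telescope_weight (u : nat -> R) (s M : nat) : (1 <= s <= M)%N ->
  u s = u M + \sum_(1 <= k < M) (u k - u k.+1) * (s < k.+1)%N%:R.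
Proof.
move=> /andP[s1 sM].
rewrite (@big_cat_nat _ _ _ s)//= big_nat_cond big1 ?add0r; last first.
  by move=> k /andP[/andP[_ ks] _]; rewrite ltnS leqNgt ks mulr0.
rewrite (eq_big_nat _ _ (F2 := fun k => u k - u k.+1)); last first.
  by move=> k /andP[sk _]; rewrite ltnS sk mulr1.
have := telescope_sumr u sM => e.
have -> : \sum_(s <= k < M) (u k - u k.+1) = - \sum_(s <= k < M) (u k.+1 - u k).
  by rewrite -sumrN; apply: eq_bigr => k _; rewrite opprB.
by rewrite e; ring.
Qed.

(** Summation by parts: the differences pass from the weights to [h]. *)
Lemma abel_weight (u h : nat -> R) (M : nat) :
  \sum_(1 <= k < M.+1) (u k - u k.+1) * h k.+1 + u M.+1 * h M.+1 =
  u 1%N * h 1%N + \sum_(1 <= k < M.+1) u k * (h k.+1 - h k).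
Proof.
elim: M => [|M IH]; first by rewrite !big_geq// add0r addr0.
rewrite big_nat_recr//= [in RHS]big_nat_recr//= addrA -IH; ring.
Qed.

Lemma weight_antitone (k l : nat) : (0 < k)%N -> (k <= l)%N -> w l%:R <= w k%:R :> R.
Proof. by move=> k0 kl; apply: powRN_antitone; rewrite ?ltr0n ?ler_nat. Qed.

Lemma count_constant_ge2 : 2 <= count_constant (R := R) d.
Proof.
have d1 : 1 <= d%:R :> R by rewrite ler1n.
have P2 : 1 <= 2 ^+ d :> R by rewrite exprn_ege1// ler1n.
by rewrite /count_constant; nra.
Qed.

(** The points from which the box up to the far corner satisfies the criterion
    contribute [bnd]. For the others the sum is a mean over the levels of the
    counts of [card_span_lt], which summation by parts turns into a Stieltjes
    sum. *)
Lemma sum_span_le (int bnd : R) : 0 <= int ->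
  \sum_(1 <= k < N) w k.+1%:R * (H k.+1 - H k) <= int ->
  \sum_z w (volume z top)%:R <= bnd ->
  \sum_z w (span g z)%:R <=
    count_constant d * 2 `^ r * N%:R * (H 1%N + int + N%:R^-1 * bnd).
Proof.
move=> int0 hint hbnd; set K := count_constant d.
have K2 : 2 <= K by exact: count_constant_ge2.
have N0 : (0 < N)%N by exact: cumside_gt0.
have NR0 : 0 < N%:R :> R by rewrite ltr0n.
have w0 t : 0 <= w t :> R by exact: powR_ge0.
have H0 k : 0 <= H k.
  rewrite /Hfun /Hpiece le_min ler01 /=.
  by rewrite mulr_ge0 ?powR_ge0// mulr_ge0// sqrtr_ge0.
have Hnd k : H k <= H k.+1.
  by apply: Hfun_nd => //; rewrite ler_nat.
pose Q z := 1 < D * Num.sqrt (volume z top)%:R.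
have pa : \sum_(z | ~~ Q z) w (span g z)%:R <= bnd.
  apply: le_trans hbnd; apply: (@le_trans _ _ (\sum_(z | ~~ Q z) w (volume z top)%:R)).
    apply: ler_sum => z; rewrite -leNgt => Qz.
    apply: weight_antitone; first exact: volume_gt0.
    apply: span_ge; rewrite /good topP /=.
    have v0 : 0 < Num.sqrt (volume z top)%:R :> R by rewrite sqrtr_gt0 ltr0n volume_gt0.
    rewrite -[leRHS]mul1r ler_pdivlMr//; apply: le_trans Qz.
    by rewrite ler_wpM2r ?(ltW v0)//; have := gD top; have := gD z; lra.
  by rewrite [leRHS](bigID Q)/= lerDr sumr_ge0.
have Nbnd : N%:R * w N%:R <= bnd.
  apply: le_trans hbnd; have -> : N%:R * w N%:R = \sum_(z : lattice n) w N%:R.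
    by rewrite sumr_const card_lattice -cumside_full mulr_natl.
  apply: ler_sum => z _; apply: weight_antitone; first exact: volume_gt0.
  exact: volume_le_card.
have pb : \sum_(z | Q z) w (span g z)%:R <=
    bnd + K * N%:R * \sum_(1 <= k < N) (w k%:R - w k.+1%:R) * H k.+1.
  under eq_bigr => z _ do rewrite (@telescope_weight (fun k => w k%:R) _ N) ?span_gt0 ?span_le//.
  rewrite big_split/=; apply: lerD.
    apply: le_trans Nbnd; rewrite sumr_const -[leLHS]mulr_natl ler_wpM2r//.
    by rewrite ler_nat cumside_full -(card_lattice n) max_card.
  rewrite exchange_big/= mulr_sumr.
  apply: ler_sum_nat => k /andP[k1 kN].
  rewrite -mulr_sumr mulrCA; apply: ler_wpM2l.
    by rewrite subr_ge0 weight_antitone.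
  apply: le_trans (card_span_lt m_gt0 m_end m_sorted d_gt0 D0 gD gm topP (t := k.+1) _); last by rewrite /= kN.
  rewrite -natr_sum ler_nat -sum1_card big_mkcond [leqRHS]big_mkcond/=.
  by apply: leq_sum => z _; rewrite inE /Q; case: (_ < _ * _); case: (_ < k.+1)%N.
have two : 1 <= 2 `^ r :> R.
  apply: (@le_trans _ _ (2 `^ 0)); first by rewrite powRr0.
  by apply: ler_powR => //; rewrite ler1n.
have pc : \sum_(1 <= k < N) (w k%:R - w k.+1%:R) * H k.+1 <= 2 `^ r * (H 1%N + int).
  have e : (N = N.-1.+1)%N by rewrite prednK.
  have := abel_weight (fun k => w k%:R) H N.-1; rewrite -e powR1 mul1r => ab.
  apply: (@le_trans _ _ (H 1%N + \sum_(1 <= k < N) w k%:R * (H k.+1 - H k))).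
    by rewrite -ab lerDl mulr_ge0.
  rewrite mulrDr; apply: lerD; first by rewrite ler_peMl.
  apply: le_trans (ler_wpM2l (powR_ge0 2 r) hint).
  rewrite mulr_sumr; apply: ler_sum_nat => k /andP[k1 kN].
  rewrite mulrA; apply: ler_wpM2r; first by rewrite subr_ge0.
  have kR : 0 < k%:R :> R by rewrite ltr0n.
  (* the Stieltjes sum has the weight at the right end of each unit step *)
  have -> : w k%:R = 2 `^ r * w (2 * k%:R).
    by rewrite powRM// mulrA -powRD ?subrr ?powRr0 ?mul1r// ?pnatr_eq0 ?implybT.
  apply: ler_wpM2l; first exact: powR_ge0.
  by apply: powRN_antitone => //; rewrite -natrM ler_nat mul2n -addnn -addn1 leq_add2l.
rewrite (bigID Q)/=.
have bnd0 : 0 <= bnd by apply: le_trans hbnd; exact: sumr_ge0.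
have -> : K * 2 `^ r * N%:R * (H 1%N + int + N%:R^-1 * bnd) =
   K * N%:R * (2 `^ r * (H 1%N + int)) + K * 2 `^ r * bnd.
  by field; rewrite gt_eqF.
have KN : 0 <= K * N%:R by rewrite mulr_ge0//; lra.
have := ler_wpM2l KN pc.
have : 2 * bnd <= K * 2 `^ r * bnd by rewrite ler_wpM2r//; nra.
by move: pa pb; lra.
Qed.
End SpanSum.

(** * The largest average *)

Section AverageMaximal.
Context {disp : measure_display} {T : measurableType disp} {R : realType}.
Variables (P : probability T R) (I : finType) (X : I -> {RV P >-> R}).
Variables (p sigma : R).
Hypothesis p2 : 2 <= p.
Hypothesis indX : independent_rvs X.
Hypothesis X0 : forall i, ('E_P[X i] = 0)%E.
Hypothesis sigma0 : 0 < sigma.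
Hypothesis Xp : forall i, P.-integrable setT (EFin \o (fun w => `|X i w| `^ p)).
Hypothesis Xm : forall i, \int[P]_w `|X i w| `^ p <= sigma `^ p.
Variables (d : nat) (c : 'I_d -> I -> nat) (lo : 'I_d -> nat) (L : nat) (B : {set I}).
Hypothesis lo0 : forall j, (0 < lo j)%N.
Hypothesis cardB : forall k : 'I_d -> nat,
  (#|B :&: [set i | all (fun j => (c j i < k j)%N) (enum 'I_d)]%SET|
     <= \prod_(j <- enum 'I_d) k j)%N.

Definition maximal_constant (e : nat) (r : R) : R := expR (4 * r) ^+ e * expR (5 * r * (r / 2)).

Notation Y := (maxfun X c lo L (enum 'I_d) B).
Notation s := (sigma / Num.sqrt (\prod_(j < d) lo j)%N%:R).

Lemma scale_gt0 : 0 < s.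
Proof. by rewrite divr_gt0// sqrtr_gt0 ltr0n prodn_gt0. Qed.

Lemma prod_powR (K : Type) (l : seq K) (u : K -> R) r : (forall k, 0 <= u k) ->
  \prod_(k <- l) u k `^ r = (\prod_(k <- l) u k) `^ r.
Proof.
move=> u0; elim: l => [|k l IH]; first by rewrite !big_nil powR1.
by rewrite !big_cons IH -powRM// prodr_ge0.
Qed.

(** The largest average has, up to a constant, the moment of the average over the
    smallest box alone. *)
Lemma average_maximal :
  \int[P]_w (Y w `^ p) <= maximal_constant d p * s `^ p.
Proof.
have p2' := p2.
have a1 : all (fun j => (0 < lo j)%N) (enum 'I_d) by apply/allP => j _; exact: lo0.
have a2 : bounded c (enum 'I_d) B 1.
  by apply: bounded_card; [exact: enum_uniq|move=> k; rewrite mul1n; exact: cardB].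
apply: le_trans (maximal_inequality p2 indX X0 sigma0 Xp Xm L a1 a2) _.
rewrite size_enum_ord mulr1 prod_powR; last by move=> k; rewrite invr_ge0.
rewrite big_enum /= -mulrA -powRM; last 2 first.
- by rewrite mulr_ge0 ?expR_ge0 ?sqr_ge0.
- by rewrite prodr_ge0// => k _; rewrite invr_ge0.
rewrite -mulrA powRM ?expR_ge0//; last first.
  by rewrite mulr_ge0 ?sqr_ge0// prodr_ge0// => k _; rewrite invr_ge0.
rewrite -expRM mulrA; apply: ler_wpM2l.
  by rewrite mulr_ge0 ?exprn_ge0 ?expR_ge0.
have -> : sigma ^+ 2 * \prod_(j < d) (lo j)%:R^-1 = s ^+ 2.
  by rewrite expr_div_n sqr_sqrtr// natr_prod prodfV.
rewrite -powR_mulrn ?(ltW scale_gt0)// -powRrM.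
by rewrite le_eqVlt; apply/orP; left; apply/eqP; congr (_ `^ _); lra.
Qed.

Lemma deviation_growth q : 0 <= q -> q <= p -> growth X [set: I]%SET p (fun w => (s + Y w) `^ q).
Proof.
move=> q0 qp.
have gY : growth X [set: I]%SET 1 Y by apply: growth_setT; exact: growth_maxfun.
have g1 : growth X [set: I]%SET 1 (fun w => s + Y w).
  by apply: growthD => //; apply: growth_le (growth_cst _ _ _).
have := growth_powR g1 q0; rewrite mul1r => /(growth_le qp); congr growth.
apply/funext => w; rewrite ger0_norm// addr_ge0 ?maxfun_ge0//.
by rewrite ltW ?scale_gt0.
Qed.

Lemma deviation_moment q : 0 <= q -> q <= p ->
  \int[P]_w ((s + Y w) `^ q) <= expR q * (2 + maximal_constant d p) * s `^ q.
Proof.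
move=> q0 qp; have p2' := p2; have s0 := scale_gt0; have s0' := ltW s0.
have sp0 : 0 < s `^ p by exact: powR_gt0.
have gY : growth X [set: I]%SET p (fun w => Y w `^ p).
  exact: growth_maxfun_powR.
have g1 (k : R) : growth X [set: I]%SET p (cst k).
  by apply: growth_le (growth_cst _ _ _); lra.
have E2 : 2 `^ q <= expR q by rewrite -[leRHS]/(expR q) -[q in leRHS]mul1r; apply: powR_le_expR => //; exact: expR_ge2.
apply: (@le_trans _ _ (\int[P]_w (expR q * s `^ q * (2 + (s `^ p)^-1 * Y w `^ p)))).
  apply: (@Ex_le _ _ _ P I X p p2 Xp p) => //; first exact: deviation_growth.
    by apply: growthMl; apply: growthD; [exact: g1|exact: growthMl].
  move=> w; have Y0 : 0 <= Y w by exact: maxfun_ge0.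
  apply: le_trans (powR_addr_le s0' Y0 q0) _.
  rewrite -mulrA; apply: ler_pM; rewrite ?powR_ge0 ?addr_ge0 ?powR_ge0//.
  have := powR_interp Y0 s0 q0 qp.
  have -> : (Y w / s) `^ p = (s `^ p)^-1 * Y w `^ p.
    by rewrite powRM ?invr_ge0// mulrC -(powR_inv1 s0') -powRrM mulN1r powRN.
  by move: (s `^ q) (Y w `^ q) => u v; lra.
rewrite (@Ex_Zl _ _ _ P I X p p2 Xp p)//; last by apply: growthD; [exact: g1|exact: growthMl].
rewrite (@Ex_D _ _ _ P I X p p2 Xp p)//; [|exact: g1|exact: growthMl].
rewrite (@Ex_Zl _ _ _ P I X p p2 Xp p)// Rintegral_cst//= probability_setT/= mulr1.
rewrite [leRHS]mulrAC ler_wpM2l ?mulr_ge0 ?expR_ge0 ?powR_ge0// lerD2l.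
by rewrite mulrC ler_pdivrMr//; exact: average_maximal.
Qed.
End AverageMaximal.

(** * Pointwise bounds for block estimators *)

Section BlockDeviation.
Context {R : realType} (d : nat) (n : 'I_d -> nat) (N : nat) (x : 'I_N -> lattice n).
Hypothesis xbij : bijective x.
Variable f : lattice n -> R.
Hypothesis fm : forall u v, lle u v -> f u <= f v.
Implicit Types (u v z : lattice n) (e : 'I_N -> R).

Lemma npts_volume u v : lle u v -> npts x u v = volume u v.
Proof.
move=> uv; rewrite -card_box// /npts -(on_card_preimset (f := x)).
  by congr #|pred_of_set _|; apply/finset.setP => i; rewrite !inE.
exact: onW_bij.
Qed.

Lemma ybar_le e u v M : lle u v ->
  (volume u v)%:R^-1 * `|\sum_(i | x i \in box u v) e i| <= M ->
  ybar x (fun i => f (x i) + e i) u v <= f v + M.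
Proof.
move=> uv h; rewrite /ybar npts_volume// big_split/= mulrDl.
have v0 : 0 < (volume u v)%:R :> R by rewrite ltr0n volume_gt0.
apply: lerD.
  rewrite ler_pdivrMr// mulrC -npts_volume// /npts.
  apply: (@le_trans _ _ (\sum_(i | x i \in box u v) f v)).
    by apply: ler_sum => i; rewrite inE => /andP[_ h']; exact: fm.
  rewrite sumr_const mulr_natl le_eqVlt; apply/orP; left; apply/eqP.
  by congr (_ *+ _); apply: eq_card => i; rewrite [RHS]inE.
by apply: le_trans h; rewrite mulrC ler_wpM2l ?invr_ge0// ler_norm.
Qed.

Lemma ybar_ge e u v M : lle u v ->
  (volume u v)%:R^-1 * `|\sum_(i | x i \in box u v) e i| <= M ->
  f u - M <= ybar x (fun i => f (x i) + e i) u v.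
Proof.
move=> uv h; rewrite /ybar npts_volume// big_split/= mulrDl.
have v0 : 0 < (volume u v)%:R :> R by rewrite ltr0n volume_gt0.
apply: lerD.
  rewrite ler_pdivlMr// mulrC -npts_volume// /npts.
  apply: (@le_trans _ _ (\sum_(i | x i \in box u v) f u)).
    rewrite sumr_const mulr_natl le_eqVlt; apply/orP; left; apply/eqP.
    by congr (_ *+ _); apply: eq_card => i; rewrite [LHS]inE.
  by apply: ler_sum => i; rewrite inE => /andP[h' _]; exact: fm.
rewrite lerNl; apply: le_trans h; rewrite -mulNr mulrC ler_wpM2l ?invr_ge0//.
by rewrite -normrN ler_norm.
Qed.

(** Fixing the upper corner [v] bounds both the max-min and the min-max value
    from above, whatever lower corner is selected. *)
Lemma block_value_le e z v r M : lle z v ->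
  is_block_value x (fun i => f (x i) + e i) z r ->
  (forall u, lle u z ->
     (volume u v)%:R^-1 * `|\sum_(i | x i \in box u v) e i| <= M) ->
  r <= f v + M.
Proof.
move=> zv /andP[_ rle] h; apply: le_trans rle _; rewrite ge_max.
have hy u : lle u z -> ybar x (fun i => f (x i) + e i) u v <= f v + M.
  by move=> uz; apply: ybar_le; [exact: lle_trans uz zv|exact: h].
apply/andP; split.
  rewrite /fmaxmin /max_below /min_above.
  apply/bigmax_leP; split => [|u uz]; apply: (bigmin_inf v) => //; first exact: hy (lle_refl z).
  exact: hy.
rewrite /fminmax /max_below /min_above.
apply: (bigmin_inf v) => //; apply/bigmax_leP; split; first exact: hy (lle_refl z).
exact: hy.
Qed.

Lemma block_value_ge e u z r M : lle u z ->
  is_block_value x (fun i => f (x i) + e i) z r ->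
  (forall v, lle z v ->
     (volume u v)%:R^-1 * `|\sum_(i | x i \in box u v) e i| <= M) ->
  f u - M <= r.
Proof.
move=> uz /andP[rge _] h; apply: le_trans rge; rewrite le_min.
have hy v : lle z v -> f u - M <= ybar x (fun i => f (x i) + e i) u v.
  by move=> zv; apply: ybar_ge; [exact: lle_trans uz zv|exact: h].
apply/andP; split.
  rewrite /fmaxmin /max_below /min_above.
  apply: (bigmax_sup u) => //; apply/bigmin_geP; split; first exact: hy (lle_refl z).
  exact: hy.
rewrite /fminmax /max_below /min_above.
apply/bigmin_geP; split => [|v zv]; apply: (bigmax_sup u) => //; first exact: hy (lle_refl z).
exact: hy.
Qed.

Lemma card_le_bound k l (Q : pred 'I_k) (h : 'I_k -> nat) :
  {in Q &, injective h} -> (forall i, Q i -> (h i < l)%N) -> (#|Q| <= l)%N.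
Proof.
case: l => [|l] hi hl.
  by rewrite leqn0; apply/eqP/eq_card0 => i; apply/negP => /hl.
rewrite -[leqRHS]card_ord; apply: (@leq_card_in _ _ (fun i => inord (h i) : 'I_l.+1)).
move=> i j iQ jQ /(congr1 val); rewrite /= !inordK; [exact: hi| |]; exact: hl.
Qed.

Lemma card_below v (k : 'I_d -> nat) :
  (#|[set i | lle (x i) v]%SET :&:
     [set i | all (fun j => (v j - x i j < k j)%N) (enum 'I_d)]%SET|
     <= \prod_(j <- enum 'I_d) k j)%N.
Proof.
pose Q j (l : 'I_(n j)) := (l <= v j)%N && (v j - l < k j)%N.
apply: (@leq_trans #|x @^-1: [set z : lattice n | [forall j, Q j (z j)]]%SET|).
  apply: subset_leq_card; apply/fintype.subsetP => i; rewrite !inE => /andP[/lleP h1 /allP h2].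
  by apply/forallP => j; rewrite /Q h1 h2// mem_enum.
rewrite on_card_preimset; last exact: onW_bij.
rewrite card_lattice_prod big_enum; apply: leq_prod => j _.
apply: (@card_le_bound _ _ _ (fun l => v j - l)%N) => [l l'|l /andP[]//].
rewrite /Q !unfold_in /= => /andP[l1 _] /andP[l2 _] e.
by apply: val_inj; rewrite /= -(subKn l1) e subKn.
Qed.

Lemma card_above u (k : 'I_d -> nat) :
  (#|[set i | lle u (x i)]%SET :&:
     [set i | all (fun j => (x i j - u j < k j)%N) (enum 'I_d)]%SET|
     <= \prod_(j <- enum 'I_d) k j)%N.
Proof.
pose Q j (l : 'I_(n j)) := (u j <= l)%N && (l - u j < k j)%N.
apply: (@leq_trans #|x @^-1: [set z : lattice n | [forall j, Q j (z j)]]%SET|).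
  apply: subset_leq_card; apply/fintype.subsetP => i; rewrite !inE => /andP[/lleP h1 /allP h2].
  by apply/forallP => j; rewrite /Q h1 h2// mem_enum.
rewrite on_card_preimset; last exact: onW_bij.
rewrite card_lattice_prod big_enum; apply: leq_prod => j _.
apply: (@card_le_bound _ _ _ (fun l => l - u j)%N) => [l l'|l /andP[]//].
rewrite /Q !unfold_in /= => /andP[l1 _] /andP[l2 _] e.
by apply: val_inj; rewrite /= -(subnK l1) e subnK.
Qed.

Lemma box_below u v i : lle u v -> (x i \in box u v) =
  (i \in [set i | lle (x i) v]%SET :&:
     [set i | all (fun j => (v j - x i j < (v j - u j).+1)%N) (enum 'I_d)]%SET).
Proof.
move=> /lleP uv; rewrite !inE andbC; case: lleP => //= h.
apply/lleP/allP => [h' j _|h' j].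
  by rewrite ltnS leq_sub2l.
by have := h' j; rewrite mem_enum ltnS leq_sub2lE// => /(_ isT).
Qed.

Lemma box_above u v i : lle u v -> (x i \in box u v) =
  (i \in [set i | lle u (x i)]%SET :&:
     [set i | all (fun j => (x i j - u j < (v j - u j).+1)%N) (enum 'I_d)]%SET).
Proof.
move=> /lleP uv; rewrite !inE; case: lleP => //= h.
apply/lleP/allP => [h' j _|h' j].
  by rewrite ltnS leq_sub2r.
by have := h' j; rewrite mem_enum ltnS leq_sub2rE// => /(_ isT).
Qed.
End BlockDeviation.

Section PointMoments.
Context {disp : measure_display} {T : measurableType disp} {R : realType}.
Context {d : nat} {n : 'I_d -> nat} {N : nat}.
Variables (P : probability T R) (x : 'I_N -> lattice n) (eps : 'I_N -> {RV P >-> R}).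
Variables (p q sigma : R) (f : lattice n -> R).
Hypothesis p2 : 2 <= p.
Hypothesis q0 : 0 <= q.
Hypothesis qp : q <= p.
Hypothesis xbij : bijective x.
Hypothesis ind : independent_rvs eps.
Hypothesis eps0 : forall i, ('E_P[eps i] = 0)%E.
Hypothesis sigma0 : 0 < sigma.
Hypothesis epsp : forall i, P.-integrable setT (EFin \o (fun w => `|eps i w| `^ p)).
Hypothesis epsm : forall i, \int[P]_w `|eps i w| `^ p <= sigma `^ p.
Hypothesis fm : forall u v, lle u v -> f u <= f v.

Notation L := (\sum_j n j).+1.

Lemma dominated_moment (c : 'I_d -> 'I_N -> nat) (lo : 'I_d -> nat) (B : {set 'I_N}) (U : T -> R) :
  (forall j, 0 < lo j)%N ->
  (forall k : 'I_d -> nat,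
     (#|B :&: [set i | all (fun j => (c j i < k j)%N) (enum 'I_d)]%SET|
        <= \prod_(j <- enum 'I_d) k j)%N) ->
  measurable_fun setT U ->
  (forall w, 0 <= U w <= sigma / Num.sqrt (\prod_(j < d) lo j)%N%:R
      + maxfun eps c lo L (enum 'I_d) B w) ->
  (\int[P]_w (U w `^ q)%:E <= (expR q * (2 + maximal_constant d p)
      * (sigma / Num.sqrt (\prod_(j < d) lo j)%N%:R) `^ q)%:E)%E.
Proof.
move=> lo0 cardB mU U0.
have gG := deviation_growth eps sigma0 c L B lo0 q0 qp.
have iG := growth_int p2 epsp gG (lexx p).
apply: (@le_trans _ _ (\int[P]_w ((sigma / Num.sqrt (\prod_(j < d) lo j)%N%:R
      + maxfun eps c lo L (enum 'I_d) B w) `^ q)%:E)%E).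
  apply: ge0_le_integral => //.
  - by move=> w _; rewrite lee_fin powR_ge0.
  - by apply/measurable_EFinP; apply: (measurableT_comp (measurable_powR q)).
  - exact: (measurable_int P).
  - move=> w _; rewrite lee_fin; have /andP[u0 u1] := U0 w.
    by apply: ge0_ler_powR; rewrite ?nnegrE// (le_trans u0).
rewrite -[leLHS]fineK; last exact: integrable_fin_num.
rewrite lee_fin.
exact: (deviation_moment p2 ind eps0 sigma0 epsp epsm L lo0 cardB q0 qp).
Qed.

Let side_lt_L (u v : lattice n) j : ((v j - u j).+1 < L)%N.
Proof.
rewrite ltnS (bigD1 j)//=; apply: leq_trans (leq_addr _ _).
by apply: leq_ltn_trans (ltn_ord (v j)); exact: leq_subr.
Qed.

(** Once the upper corner is fixed at [v], the boxes that reach down from it are cut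
    out by upper bounds on the coordinatewise distances to [v]: this is the setting
    of the maximal inequality. *)
Lemma positive_part_moment z v (fh : {RV P >-> R}) : lle z v ->
  f v - f z <= sigma / Num.sqrt (volume z v)%:R ->
  (forall w, is_block_value x (fun i => f (x i) + eps i w) z (fh w)) ->
  (\int[P]_w (Num.max (fh w - f z) 0 `^ q)%:E <= (expR q * (2 + maximal_constant d p)
      * (sigma / Num.sqrt (volume z v)%:R) `^ q)%:E)%E.
Proof.
move=> zv hf hb.
apply: (@dominated_moment (fun j i => v j - x i j)%N (fun j => (v j - z j).+1) [set i | lle (x i) v]%SET) => //.
- by move=> k; exact: card_below.
- by apply: measurable_maxr => //; apply: measurable_funB.
move=> w; rewrite le_max lexx orbT /= ge_max.
set M := maxfun _ _ _ _ _ _ _; have M0 : 0 <= M by exact: maxfun_ge0.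
apply/andP; split; last by rewrite addr_ge0// divr_ge0 ?sqrtr_ge0// ltW.
have : fh w <= f v + M.
  apply: (block_value_le xbij fm zv (hb w)) => u uz.
  have uv := lle_trans uz zv.
  have := @maxfun_ge _ T R P _ eps _ (fun j i => v j - x i j)%N (fun j => (v j - z j).+1) L (enum 'I_d)
    [set i | lle (x i) v]%SET (fun j => (v j - u j).+1) w.
  rewrite /psum /volume big_enum/= => h; apply: le_trans (h _).
    rewrite le_eqVlt; apply/orP; left; apply/eqP; congr (_ * `|_|).
    by apply: eq_bigl => i; exact: box_below.
  move=> j _; rewrite side_lt_L andbT ltnS leq_sub2l//.
  by move/lleP: uz.
by move: hf; rewrite /volume; lra.
Qed.

Lemma negative_part_moment u z (fh : {RV P >-> R}) : lle u z ->
  f z - f u <= sigma / Num.sqrt (volume u z)%:R ->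
  (forall w, is_block_value x (fun i => f (x i) + eps i w) z (fh w)) ->
  (\int[P]_w (Num.max (f z - fh w) 0 `^ q)%:E <= (expR q * (2 + maximal_constant d p)
      * (sigma / Num.sqrt (volume u z)%:R) `^ q)%:E)%E.
Proof.
move=> uz hf hb.
apply: (@dominated_moment (fun j i => x i j - u j)%N (fun j => (z j - u j).+1) [set i | lle u (x i)]%SET) => //.
- by move=> k; exact: card_above.
- by apply: measurable_maxr => //; apply: measurable_funB.
move=> w; rewrite le_max lexx orbT /= ge_max.
set M := maxfun _ _ _ _ _ _ _; have M0 : 0 <= M by exact: maxfun_ge0.
apply/andP; split; last by rewrite addr_ge0// divr_ge0 ?sqrtr_ge0// ltW.
have : f u - M <= fh w.
  apply: (block_value_ge xbij fm uz (hb w)) => v zv.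
  have uv := lle_trans uz zv.
  have := @maxfun_ge _ T R P _ eps _ (fun j i => x i j - u j)%N (fun j => (z j - u j).+1) L (enum 'I_d)
    [set i | lle u (x i)]%SET (fun j => (v j - u j).+1) w.
  rewrite /psum /volume big_enum/= => h; apply: le_trans (h _).
    rewrite le_eqVlt; apply/orP; left; apply/eqP; congr (_ * `|_|).
    by apply: eq_bigl => i; exact: box_above.
  move=> j _; rewrite side_lt_L andbT ltnS leq_sub2r//.
  by move/lleP: zv.
by move: hf; rewrite /volume; lra.
Qed.
End PointMoments.

(** * Reading a box from its corners *)

Section UnitIntervals.
Context {R : realType}.
Local Notation mu := (@lebesgue_measure R).

Lemma sum_powR_le_integral (r : R) (M : nat) : 0 <= r ->
  \sum_(0 <= k < M) k.+1%:R `^ (- r) <= \int[mu]_(t in `[0, M%:R]) Num.max t 1 `^ (- r).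
Proof.
move=> r0; pose w t : R := Num.max t 1 `^ (- r).
have mw (D : set R) : measurable D -> measurable_fun D w.
  move=> mD; apply: measurable_funTS; apply: (measurableT_comp (measurable_powR (- r))).
  exact: measurable_maxr.
have w1 t : 0 <= w t <= 1.
  by rewrite powR_ge0 /=; apply: powRN_le1 => //; rewrite le_max lexx orbT.
have iw (a b : R) (c : bool) : mu.-integrable [set` Interval (BSide c a) (BRight b)] (EFin \o w).
  apply: measurable_bounded_integrable => //.
  - have [ab|ba] := leP (BSide c a) (BRight b : itv_bound R); last first.
      by rewrite set_itv_ge ?measure0 ?ltry// -leNgt ltW.
    by rewrite [X in (X < _)%E]lebesgue_measure_itv/=; case: ifP => _; rewrite ltry.
  - exact: mw.
  exists 1; split; first exact: num_real.
  move=> A A1 t _; have /andP[h0 h1] := w1 t.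
  by rewrite /= ger0_norm// (le_trans h1)// ltW.
elim: M => [|M IH]; first by rewrite big_geq// Rintegral_ge0// => t _; case/andP: (w1 t).
rewrite big_nat_recr//= (@itv_bndbnd_setU _ _ _ (BRight M%:R)) ?bnd_simp ?ler0n//; last first.
  by rewrite ler_nat.
rewrite Rintegral_setU//; last 2 first.
- by rewrite -itv_bndbnd_setU ?bnd_simp ?ler0n ?ler_nat//; exact: iw.
- apply/disj_set2P; rewrite -subset0 => t [] /=.
  by rewrite !in_itv/= => /andP[_ xb] /andP[bx _]; move: (lt_le_trans bx xb); rewrite ltxx.
apply: lerD => //.
have e : fine (mu `]M%:R, M.+1%:R]) = 1.
  by rewrite [X in fine X]lebesgue_measure_itv/= lte_fin ltr_nat ltnSn -EFinD/= -natrB// subSnn.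
have -> : M.+1%:R `^ (- r) = \int[mu]_(t in `]M%:R, M.+1%:R]) (M.+1%:R `^ (- r)).
  by rewrite Rintegral_cst// e mulr1.
apply: le_Rintegral; [by []| |exact: iw|].
  apply: measurable_bounded_integrable => //.
    by rewrite [X in (X < _)%E]lebesgue_measure_itv/=; case: ifP => _; rewrite ltry.
  exists `|M.+1%:R `^ (- r)|; split; first exact: num_real.
  by move=> A hA t _; exact: ltW.
move=> t /=; rewrite in_itv/= => /andP[t0 t1].
apply: powRN_antitone => //; first by rewrite lt_max ltr01 orbT.
by rewrite ge_max t1 ler1n.
Qed.

End UnitIntervals.

Section Transport.
Context {d : nat} {n : 'I_d -> nat} (a b : lattice n).
Hypothesis ab : lle a b.
Notation sides := (fun j : 'I_d => side a b j.+1).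
Implicit Types (z v : lattice sides).

Lemma side_ord (j : 'I_d) : side a b j.+1 = (b j - a j).+1.
Proof. by rewrite /side /= valK. Qed.

Let ab_le j : (a j <= b j)%N. Proof. by move/lleP: ab. Qed.

(** The box as a lattice in its own right, read from its lower and from its upper
    corner; the second reading reverses the order, so that it treats the negative
    errors as the first one treats the positive errors. *)
Definition from_below z : lattice n :=
  [ffun j => insubd (a j) (a j + z j)%N] : {dffun forall j : 'I_d, 'I_(n j)}.

Definition from_above z : lattice n :=
  [ffun j => insubd (b j) (b j - z j)%N] : {dffun forall j : 'I_d, 'I_(n j)}.

Let z_le z j : (z j <= b j - a j)%N.
Proof. by rewrite -ltnS -side_ord. Qed.

Lemma from_belowE z j : from_below z j = (a j + z j)%N :> nat.
Proof.
rewrite ffunE val_insubd; case: ifPn => // /negP[].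
by apply: leq_ltn_trans (ltn_ord (b j)); rewrite -leq_subRL// ?z_le.
Qed.

Lemma from_aboveE z j : from_above z j = (b j - z j)%N :> nat.
Proof.
rewrite ffunE val_insubd; case: ifPn => // /negP[].
by apply: leq_ltn_trans (ltn_ord (b j)); exact: leq_subr.
Qed.

Lemma from_below_lle z v : lle z v -> lle (from_below z) (from_below v).
Proof. by move=> /lleP h; apply/lleP => j; rewrite !from_belowE leq_add2l. Qed.

Lemma from_above_lle z v : lle z v -> lle (from_above v) (from_above z).
Proof. by move=> /lleP h; apply/lleP => j; rewrite !from_aboveE leq_sub2l. Qed.

Lemma volume_from_below z v : volume (from_below z) (from_below v) = volume z v.
Proof. by apply: eq_bigr => j _; rewrite !from_belowE subnDl. Qed.

Lemma volume_from_above z v : lle z v -> volume (from_above v) (from_above z) = volume z v.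
Proof.
move=> /lleP h; apply: eq_bigr => j _; rewrite !from_aboveE.
have := h j; have := z_le v j; have := ab_le j; lia.
Qed.

Lemma from_below_inj : injective from_below.
Proof.
move=> z v e; apply/ffunP => j; apply: val_inj => /=.
by apply: (@addnI (a j)); rewrite -!from_belowE e.
Qed.

Lemma from_above_inj : injective from_above.
Proof.
move=> z v e; apply/ffunP => j; apply: val_inj => /=.
have le (u : lattice sides) : (u j <= b j)%N by apply: leq_trans (z_le u j) _; exact: leq_subr.
have e' : (b j - z j = b j - v j)%N by rewrite -!from_aboveE e.
by rewrite -[LHS](subKn (le z)) e' subKn.
Qed.

Lemma from_below_box z : from_below z \in box a b.
Proof.
rewrite inE; apply/andP; split; apply/lleP => j; rewrite from_belowE ?leq_addr//.
by have := z_le z j; have := ab_le j; lia.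
Qed.

Lemma from_above_box z : from_above z \in box a b.
Proof.
rewrite inE; apply/andP; split; apply/lleP => j; rewrite from_aboveE ?leq_subr//.
by have := z_le z j; have := ab_le j; lia.
Qed.

Lemma card_box_sides : #|box a b| = #|lattice sides|.
Proof.
by rewrite card_box// card_lattice; apply: eq_bigr => j _; rewrite side_ord.
Qed.

Lemma imset_box (h : lattice sides -> lattice n) : injective h ->
  (forall z, h z \in box a b) -> box a b = h @: [set: lattice sides]%SET.
Proof.
move=> hi hb; apply/esym/eqP; rewrite eqEcard card_imset// cardsT card_box_sides leqnn andbT.
by apply/fintype.subsetP => _ /imsetP[z _ ->].
Qed.

Lemma sum_box (V : nmodType) (h : lattice sides -> lattice n) (F : lattice n -> V) :
  injective h -> (forall z, h z \in box a b) ->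
  \sum_(z in box a b) F z = \sum_z F (h z).
Proof.
move=> hi hb; rewrite (imset_box hi hb) big_imset/=; last by move=> ? ? _ _; exact: hi.
by apply: eq_bigl => z; rewrite inE.
Qed.

Lemma volume_sides : volume a b = cumside (side a b) d.
Proof. by rewrite cumside_full; apply: eq_bigr => j _; rewrite side_ord. Qed.

Lemma far_corner_lt (j : nat) : ((side a b j).-1 < side a b j)%N.
Proof. by rewrite prednK ?side_gt0. Qed.

Definition far_corner : lattice sides :=
  [ffun j : 'I_d => Ordinal (far_corner_lt j.+1)] : {dffun forall j : 'I_d, 'I_(sides j)}.

Lemma far_cornerP z : lle z far_corner.
Proof. by apply/lleP => j; rewrite ffunE /= -ltnS prednK ?side_gt0. Qed.

Lemma sum_volume_far_corner {R : realType} (r : R) : 0 <= r ->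
  \sum_z (volume z far_corner)%:R `^ (- r) <=
  \prod_(1 <= j < d.+1)
     \int[lebesgue_measure]_(t in `[0, (side a b j)%:R]) Num.max t 1 `^ (- r).
Proof.
move=> r0.
have -> : \sum_z (volume z far_corner)%:R `^ (- r) =
    \sum_(z : lattice sides) \prod_j ((far_corner j - z j).+1)%:R `^ (- r) :> R.
  by apply: eq_bigr => z _; rewrite prod_powR// -natr_prod.
rewrite (@sum_lattice_prod _ _ sides (fun j k => ((far_corner j - k).+1)%:R `^ (- r))).
rewrite big_add1 /= big_mkord; apply: ler_prod => j _; apply/andP; split.
  by apply: sumr_ge0 => k _; exact: powR_ge0.
apply: le_trans (sum_powR_le_integral (side a b j.+1) r0).
rewrite big_mkord (reindex_inj rev_ord_inj)/= le_eqVlt; apply/orP; left; apply/eqP.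
apply: eq_bigr => k _; rewrite ffunE /=; congr (_%:R `^ _).
by have := ltn_ord k; lia.
Qed.
End Transport.

(** * The risk bound *)

Section RiskConstant.
Context {R : realType}.

Definition risk_constant (q : R) (d : nat) : R :=
  2 * count_constant d * expR q * (expR q * (2 + maximal_constant d (Num.max q 2))).

Lemma maximal_constant_ge0 d (r : R) : 0 <= maximal_constant d r.
Proof. by rewrite mulr_ge0 ?exprn_ge0 ?expR_ge0. Qed.

Lemma count_constant_ge0 d : 0 <= count_constant (R := R) d.
Proof. by rewrite mulr_ge0// addr_ge0// exprn_ge0. Qed.

Lemma risk_constant_continuous d : continuous (risk_constant ^~ d).
Proof.
have cM (h k : R -> R) : continuous h -> continuous k -> continuous (fun q => h q * k q).
  by move=> ch ck q; apply: cvgM; [exact: ch|exact: ck].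
have cE (h : R -> R) : continuous h -> continuous (fun q => expR (h q)).
  move=> ch q; exact: (continuous_comp (ch q) (@continuous_expR R _)).
have cc (k : R) : continuous (fun _ : R => k) by move=> q; exact: cvg_cst.
have ci : continuous (fun q : R => q) by move=> q; exact: cvg_id.
have cp : continuous (fun q : R => Num.max q 2).
  by move=> q; apply: (@continuous_max R R idfun (cst 2)); [exact: ci|exact: cc].
have cX (h : R -> R) (e : nat) : continuous h -> continuous (fun q => h q ^+ e).
  move=> ch; elim: e => [|e IH]; first by under eq_fun do rewrite expr0; exact: cc.
  by under eq_fun do rewrite exprS; exact: cM.
apply: (@cM (fun q => 2 * count_constant d * expR q)); first by apply: cM => //; exact: cE.
apply: (@cM expR); first exact: cE.
move=> q; apply: cvgD; first exact: cvg_cst.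
apply: (@cM (fun q => expR (4 * Num.max q 2) ^+ d)).
  by apply: cX; apply: cE; exact: cM.
by apply: cE; apply: (@cM (fun q => 5 * Num.max q 2)); exact: cM.
Qed.

Lemma risk_constant_nd (q : R) (d1 d2 : nat) : 1 <= q -> (d1 <= d2)%N ->
  risk_constant q d1 <= risk_constant q d2.
Proof.
move=> q1 d12.
have e0 : 0 <= 2 + maximal_constant d1 (Num.max q 2).
  by rewrite addr_ge0 ?maximal_constant_ge0.
have p0 : 0 <= Num.max q 2 by rewrite le_max ler0n orbT.
apply: ler_pM; rewrite ?mulr_ge0 ?expR_ge0 ?count_constant_ge0//.
  rewrite ler_wpM2r ?expR_ge0// ler_wpM2l// /count_constant.
  apply: ler_pM; rewrite ?addr_ge0 ?exprn_ge0 ?ler_nat// lerD2l.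
  by apply: ler_weXn2l; rewrite ?ler1n.
rewrite ler_wpM2l ?expR_ge0// lerD2l ler_wpM2r ?expR_ge0//.
apply: ler_weXn2l => //.
by apply: le_trans (expR_ge1Dx _); rewrite lerDl mulr_ge0.
Qed.
End RiskConstant.

Section RiskBound.
Context {R : realType} {d : nat} {n : 'I_d -> nat}.
Context {disp : measure_display} {T : measurableType disp} {P : probability T R}.
Variables (N : nat) (x : 'I_N -> lattice n) (eps : 'I_N -> {RV P >-> R}).
Variables (f : lattice n -> R) (fhat : lattice n -> {RV P >-> R}).
Variables (q sigma : R) (a b : lattice n) (hs : sides_sorted a b) (Delta : {nonneg R}).
Hypothesis d0 : (0 < d)%N.
Hypothesis q1 : 1 <= q.
Hypothesis xbij : bijective x.
Hypothesis ind : independent_rvs eps.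
Hypothesis eps0 : forall i, ('E_P[eps i] = 0)%E.
Hypothesis sigma0 : 0 < sigma.
Hypothesis epsm : forall i, ('E_P[fun w => (`|eps i w| `^ Num.max q 2)%R]
   <= (sigma `^ Num.max q 2)%R%:E)%E.
Hypothesis fblock : forall z w,
  is_block_value x (fun i => f (x i) + eps i w) z (fhat z w).
Hypothesis fm : forall u v, lle u v -> f u <= f v.
Hypothesis ab : lle a b.
Hypothesis fab : (f b - f a) / sigma <= Delta%:num.

Notation sides := (fun j : 'I_d => side a b j.+1).
Notation p := (Num.max q 2).
Notation K := (expR q * (2 + maximal_constant d p)).

Let q0 : 0 <= q. Proof. by apply: le_trans q1; exact: ler01. Qed.
Let qp : q <= p. Proof. by rewrite le_max lexx. Qed.
Let p2 : 2 <= p. Proof. by rewrite le_max lexx orbT. Qed.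

Let epsp i : P.-integrable setT (EFin \o (fun w => `|eps i w| `^ p)).
Proof.
apply/integrableP; split.
  apply/measurable_EFinP; apply: (measurableT_comp (measurable_powR _)).
  exact: measurableT_comp.
apply: le_lt_trans (ltry (sigma `^ p)); have := epsm i; rewrite unlock => /(le_trans _); apply.
rewrite le_eqVlt; apply/orP; left; apply/eqP; apply: eq_integral => w _ /=.
by rewrite ger0_norm// powR_ge0.
Qed.

Let epsm' i : \int[P]_w `|eps i w| `^ p <= sigma `^ p.
Proof.
rewrite -lee_fin /Rintegral fineK; last by apply: integrable_fin_num => //; exact: epsp.
by have := epsm i; rewrite unlock.
Qed.

Let K0 : 0 <= K.
Proof. by rewrite mulr_ge0 ?expR_ge0// addr_ge0// maximal_constant_ge0. Qed.

(** The increase of [f] from the corner [a], in units of the noise level. *)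
Let rise_below (z : lattice sides) : R := (f (from_below z) - f a) / sigma.
Let rise_above (z : lattice sides) : R := (f b - f (from_above z)) / sigma.

Let in_box z : z \in box a b -> lle a z /\ lle z b.
Proof. by rewrite inE => /andP. Qed.

Let rise_below_bound z : 0 <= rise_below z <= Delta%:num.
Proof.
have [h1 h2] := in_box (from_below_box ab z).
rewrite divr_ge0 ?(ltW sigma0) ?subr_ge0 ?fm//=.
by apply: le_trans fab; rewrite ler_pM2r ?invr_gt0// lerB// fm.
Qed.

Let rise_above_bound z : 0 <= rise_above z <= Delta%:num.
Proof.
have [h1 h2] := in_box (from_above_box ab z).
rewrite divr_ge0 ?(ltW sigma0) ?subr_ge0 ?fm//=.
by apply: le_trans fab; rewrite ler_pM2r ?invr_gt0// lerB// fm.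
Qed.

Let rise_below_nd u v : lle u v -> rise_below u <= rise_below v.
Proof.
move=> uv; rewrite ler_pM2r ?invr_gt0// lerB// fm//; exact: from_below_lle.
Qed.

Let rise_above_nd u v : lle u v -> rise_above u <= rise_above v.
Proof.
move=> uv; rewrite ler_pM2r ?invr_gt0// lerB// fm//; exact: from_above_lle.
Qed.

Let scaleE k : (0 < k)%N ->
  (sigma / Num.sqrt k%:R) `^ q = sigma `^ q * k%:R `^ (- (q / 2)).
Proof.
move=> k0; have kR : 0 < k%:R :> R by rewrite ltr0n.
rewrite powRM ?invr_ge0 ?sqrtr_ge0 ?(ltW sigma0)//; congr (_ * _).
rewrite -powR12_sqrt ?(ltW kR)// -(powR_inv1 (powR_ge0 k%:R 2^-1)) -!powRrM.
by congr (_ `^ _); field.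
Qed.

Let pos z := (\int[P]_w (Num.max (fhat z w - f z) 0 `^ q)%:E)%E.
Let neg z := (\int[P]_w (Num.max (f z - fhat z w) 0 `^ q)%:E)%E.

(** The upper corner [v] of the selected box is the one that realizes the span:
    the bias [f v - f z] then does not exceed the noise of the average. *)
Let pos_le z : (pos (from_below z) <=
  (K * sigma `^ q * (span rise_below z)%:R `^ (- (q / 2)))%:E)%E.
Proof.
have [v /andP[zv hv] <-] := span_good rise_below z.
have V := volume_from_below ab z v.
have H := positive_part_moment p2 q0 qp xbij ind eps0 sigma0 epsp epsm' fm.
have := H _ _ (fhat (from_below z)) (from_below_lle ab zv).
rewrite V (scaleE (volume_gt0 _ _)) mulrA; apply; last by move=> w; exact: fblock.
rewrite -(@ler_pM2r _ sigma^-1) ?invr_gt0//.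
have -> : sigma / Num.sqrt (volume z v)%:R / sigma = (Num.sqrt (volume z v)%:R)^-1.
  by rewrite mulrAC divff ?gt_eqF// mul1r.
by apply: le_trans hv; rewrite /rise_below -mulrBl; apply: ler_wpM2r; [rewrite invr_ge0 ltW|lra].
Qed.

Let neg_le z : (neg (from_above z) <=
  (K * sigma `^ q * (span rise_above z)%:R `^ (- (q / 2)))%:E)%E.
Proof.
have [v /andP[zv hv] <-] := span_good rise_above z.
have V := volume_from_above ab zv.
have H := negative_part_moment p2 q0 qp xbij ind eps0 sigma0 epsp epsm' fm.
have := H _ _ (fhat (from_above z)) (from_above_lle zv).
rewrite V (scaleE (volume_gt0 _ _)) mulrA; apply; last by move=> w; exact: fblock.
rewrite -(@ler_pM2r _ sigma^-1) ?invr_gt0//.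
have -> : sigma / Num.sqrt (volume z v)%:R / sigma = (Num.sqrt (volume z v)%:R)^-1.
  by rewrite mulrAC divff ?gt_eqF// mul1r.
by apply: le_trans hv; rewrite /rise_above -mulrBl; apply: ler_wpM2r; [rewrite invr_ge0 ltW|lra].
Qed.

Let abs_le z :
  ('E_P[fun w => (`|fhat z w - f z| `^ q)%R] <= pos z + neg z)%E.
Proof.
have mm (u v : T -> R) : measurable_fun setT u -> measurable_fun setT v ->
    measurable_fun setT (fun w => (Num.max (u w - v w) 0 `^ q)%:E).
  move=> mu mv; apply/measurable_EFinP; apply: (measurableT_comp (measurable_powR q)).
  by apply: measurable_maxr => //; exact: measurable_funB.
have mf : measurable_fun setT (fun _ : T => f z) by exact: measurable_cst.
rewrite unlock /pos /neg -ge0_integralD//; last 4 first.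
- by move=> w _; rewrite lee_fin powR_ge0.
- exact: mm.
- by move=> w _; rewrite lee_fin powR_ge0.
- exact: mm.
apply: ge0_le_integral => //.
- apply/measurable_EFinP; apply: (measurableT_comp (measurable_powR q)).
  by apply: measurableT_comp => //; exact: measurable_funB.
- by apply: emeasurable_funD; exact: mm.
move=> w _; rewrite -EFinD lee_fin.
have [h|h] := lerP 0 (fhat z w - f z).
  by rewrite ger0_norm// lerDl powR_ge0.
by rewrite ltr0_norm// opprB (max_idPl _) ?lerDr ?powR_ge0//; lra.
Qed.

(** The same counting bound serves twice, for the positive errors read from [a]
    and for the negative errors read from [b]. *)
Lemma risk_bound :
  (\sum_(i | x i \in box a b)
      'E_P[fun w => (`|fhat (x i) w - f (x i)| `^ q)%R]
   <= (risk_constant q d * (npts x a b)%:R * sigma `^ q *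
        (Htilde hs Delta 1
         + \int[lebesgue_stieltjes_measure (Htilde hs Delta)]_(t in
              `[1, (npts x a b)%:R]) t `^ (- (q / 2))
         + (npts x a b)%:R^-1 *
           \prod_(1 <= j < d.+1)
             \int[lebesgue_measure]_(t in `[0, (side a b j)%:R])
               Num.max t 1 `^ (- (q / 2))))%R%:E)%E.
Proof.
rewrite npts_volume// volume_sides//.
set M := cumside (side a b) d.
set int := \int[_]_(t in _) _; set bnd := \prod_(_ <= _ < _) _.
have r0 : 0 <= q / 2 by rewrite divr_ge0.
have M0 : (0 < M)%N by apply: cumside_gt0; exact: side_gt0.
have int0 : 0 <= int by apply: Rintegral_ge0 => t _; exact: powR_ge0.
have hint : \sum_(1 <= k < M) k.+1%:R `^ (- (q / 2)) *
    (Hfun d (side a b) Delta%:num k.+1%:R - Hfun d (side a b) Delta%:num k%:R) <= int.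
  exact: (stieltjes_sum_le (Htilde hs Delta) r0 M0).
have hbnd : \sum_z (volume z (far_corner a b))%:R `^ (- (q / 2)) <= bnd.
  exact: sum_volume_far_corner.
have bnd0 : 0 <= bnd.
  by apply: le_trans hbnd; apply: sumr_ge0 => z _; exact: powR_ge0.
clearbody int bnd.
have D0 : 0 <= Delta%:num by [].
have SB1 := sum_span_le (@side_gt0 _ _ a b) (side_end a b) hs d0 D0
  rise_below_bound rise_below_nd (@far_cornerP _ _ a b) r0 int0 hint hbnd.
have SB2 := sum_span_le (@side_gt0 _ _ a b) (side_end a b) hs d0 D0
  rise_above_bound rise_above_nd (@far_cornerP _ _ a b) r0 int0 hint hbnd.
have e2 : 2 `^ (q / 2) <= expR q.
  apply: (@le_trans _ _ (expR (1 * (q / 2)))); first by apply: powR_le_expR => //; exact: expR_ge2.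
  by rewrite ler_expR; have := q0; lra.
have -> : (\sum_(i | x i \in box a b) 'E_P[fun w => (`|fhat (x i) w - f (x i)| `^ q)%R] =
    \sum_(z in box a b) 'E_P[fun w => (`|fhat z w - f z| `^ q)%R])%E.
  by rewrite (reindex x)//; exact: onW_bij.
apply: (@le_trans _ _ (\sum_(z in box a b) (pos z + neg z))%E).
  by apply: lee_sum => z _; exact: abs_le.
have ep : (\sum_(z in box a b) pos z = \sum_(z : lattice sides) pos (from_below z))%E.
  exact: (sum_box ab pos (from_below_inj ab) (from_below_box ab)).
have en : (\sum_(z in box a b) neg z = \sum_(z : lattice sides) neg (from_above z))%E.
  exact: (sum_box ab neg (@from_above_inj _ _ a b) (from_above_box ab)).
rewrite big_split/= [leLHS](congr2 adde ep en); apply: (@le_trans _ _ (\sum_z (K * sigma `^ q * (span rise_below z)%:R `^ (- (q / 2)))%:E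
   + \sum_z (K * sigma `^ q * (span rise_above z)%:R `^ (- (q / 2)))%:E)%E).
  by apply: leeD; apply: lee_sum => z _; [exact: pos_le|exact: neg_le].
rewrite !sumEFin -EFinD lee_fin -!mulr_sumr -mulrDr.
have Ks : 0 <= K * sigma `^ q by rewrite mulr_ge0 ?powR_ge0.
set A := _ + _ + _ in SB1 SB2 *.
have A0 : 0 <= A.
  rewrite !addr_ge0//.
    by rewrite /Htilde /Hfun /Hpiece le_min ler01 /= !mulr_ge0 ?sqrtr_ge0 ?powR_ge0.
  by apply: mulr_ge0 => //; rewrite invr_ge0.
apply: (@le_trans _ _ (K * sigma `^ q * (2 * (count_constant d * 2 `^ (q / 2) * M%:R * A)))).
  by apply: ler_wpM2l => //; move: SB1 SB2; rewrite /A; lra.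
have cA : 0 <= 2 * count_constant d * M%:R * A * (K * sigma `^ q).
  by rewrite mulr_ge0// !mulr_ge0// count_constant_ge0.
rewrite [leLHS](_ : _ = 2 `^ (q / 2) * (2 * count_constant d * M%:R * A * (K * sigma `^ q))); last by ring.
rewrite [leRHS](_ : _ = expR q * (2 * count_constant d * M%:R * A * (K * sigma `^ q))).
  by rewrite ler_wpM2r.
by rewrite /risk_constant; ring.
Qed.
End RiskBound.

(** * Stieltjes integrals under power growth *)

Section PowerGrowth.
Context {R : realType}.
Variables (F : cumulative R R) (r : R).
Hypothesis r0 : 0 <= r.
Hypothesis F0 : forall t, 0 <= F t.
Local Notation w t := (t `^ (- r)).
Local Notation I a b :=
  (\int[lebesgue_stieltjes_measure F]_(t in [set` Interval (BRight a) (BRight b)]) w t).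

Lemma integral_le_end a b : 1 <= a -> a <= b -> I a b <= w a * F b.
Proof.
move=> a1 ab; apply: le_trans (stieltjes_integral_le F r0 a1 ab) _.
by apply: ler_wpM2l; [exact: powR_ge0|rewrite gerBl].
Qed.

Lemma integral_mono a b c : 1 <= a -> a <= b -> b <= c -> I a b <= I a c.
Proof.
move=> a1 ab bc; rewrite (stieltjes_integral_cat F r0 a1 ab bc) lerDl.
exact: stieltjes_integral_ge0.
Qed.

Lemma powR_half_lt1 g : 0 < g -> 0 < 1 - 2 `^ (- g) :> R.
Proof.
move=> g0; rewrite subr_gt0 powRN invf_lt1 ?powR_gt0//.
rewrite /powR pnatr_eq0/= expR_gt1 mulr_gt0// ln_gt0// ltr1n//.
Qed.

Lemma dyadic_bound (b : R) : exists k : nat, b <= 2 ^+ k.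
Proof.
exists (Num.truncn `|b|).+1; apply: le_trans (ler_norm b) _.
have /andP[_ /ltW h] := truncn_itv (normr_ge0 b); apply: le_trans h _.
by rewrite -natrX ler_nat ltnW// ltn_expl.
Qed.

Definition growth_factor (g : R) : R := 2 `^ r / (1 - 2 `^ (- g)).

(** The bounds for the dyadic blocks grow geometrically, so that the last block
    dominates. *)
Lemma integral_growth h B b : 0 <= h -> r < B -> 1 <= b ->
  (forall u, 1 <= u -> F u <= h * u `^ B) ->
  I 1 b <= h * growth_factor (B - r) * b `^ (B - r).
Proof.
move=> h0 rB b1 Fh; set g := B - r; have g0 : 0 < g by rewrite /g subr_gt0.
have z0 := powR_half_lt1 g0.
have C0 : 0 <= growth_factor g by rewrite divr_ge0 ?powR_ge0// ltW.
have Ce : growth_factor g = growth_factor g * 2 `^ (- g) + 2 `^ r.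
  by rewrite /growth_factor; field; rewrite gt_eqF.
have C2 : 2 `^ r <= growth_factor g by rewrite {1}Ce lerDr mulr_ge0// powR_ge0.
have pw (x : R) : 0 < x -> x `^ B = x `^ g * x `^ r.
  by move=> x0; rewrite -powRD ?subrK// (gt_eqF x0) implybT.
have [k bk] := dyadic_bound b; elim: k b b1 bk => [|k IH] b b1 bk.
  have e : b = 1 by apply/eqP; rewrite eq_le b1 bk.
  rewrite e; apply: le_trans (stieltjes_integral_le F r0 (lexx 1) (lexx 1)) _.
  by rewrite subrr mulr0; apply: mulr_ge0; [exact: mulr_ge0|exact: powR_ge0].
have b0 : 0 < b by exact: lt_le_trans b1.
have [b2|b2] := lerP b 2.
  apply: le_trans (integral_le_end (lexx 1) b1) _; rewrite powR1 mul1r.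
  apply: le_trans (Fh _ b1) _; rewrite -mulrA ler_wpM2l// pw// mulrC ler_wpM2r ?powR_ge0//.
  apply: le_trans C2; apply: ge0_ler_powR; rewrite ?nnegrE ?(ltW b0)//.
have b2' : 1 <= b / 2 by rewrite ler_pdivlMr// mul1r ltW.
have bb : b / 2 <= b by lra.
rewrite (stieltjes_integral_cat F r0 (lexx 1) b2' bb).
have h1 : I 1 (b / 2) <= h * growth_factor g * (b / 2) `^ g.
  by apply: IH => //; rewrite ler_pdivrMr// -exprSr.
have h2 : I (b / 2) b <= (b / 2) `^ (- r) * (h * b `^ B).
  apply: le_trans (integral_le_end b2' bb) _.
  by apply: ler_wpM2l; [exact: powR_ge0|exact: Fh].
apply: le_trans (lerD h1 h2) _.
have inv2 (x : R) : (2^-1 : R) `^ x = 2 `^ (- x) by rewrite -powR_inv1// -powRrM mulN1r.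
have half x : (b / 2) `^ x = b `^ x * 2 `^ (- x).
  by rewrite powRM ?invr_ge0 ?(ltW b0)// inv2.
rewrite !half opprK pw// {2}Ce.
have rr : b `^ (- r) * b `^ r = 1.
  by rewrite -powRD ?addNr ?powRr0// (gt_eqF b0) implybT.
rewrite [leLHS](_ : _ = h * (growth_factor g * 2 `^ (- g) + 2 `^ r * (b `^ (- r) * b `^ r)) * b `^ g); last by ring.
by rewrite rr mulr1.
Qed.

Definition decay_factor (B g : R) : R := 2 `^ B / (1 - 2 `^ (- g)).

(** The bounds for the dyadic blocks decrease geometrically, so that the first block
    dominates. *)
Lemma integral_decay h B a b : 0 <= h -> 0 <= B -> B < r -> 1 <= a -> a <= b ->
  (forall u, 1 <= u -> F u <= h * u `^ B) ->
  I a b <= h * decay_factor B (r - B) * a `^ (B - r).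
Proof.
move=> h0 B0 Br a1 ab Fh; set g := r - B; have g0 : 0 < g by rewrite /g subr_gt0.
have z0 := powR_half_lt1 g0.
set C := decay_factor B g.
have C0 : 0 <= C by rewrite divr_ge0 ?powR_ge0// ltW.
have Ce : C = C * 2 `^ (- g) + 2 `^ B.
  by rewrite /C /decay_factor; field; rewrite gt_eqF.
have C2 : 2 `^ B <= C by rewrite {1}Ce lerDr mulr_ge0// powR_ge0.
have step x : 1 <= x -> w x * (h * (2 * x) `^ B) = h * 2 `^ B * x `^ (B - r).
  move=> x1; have x0 : 0 < x by exact: lt_le_trans x1.
  rewrite powRM ?(ltW x0)// powRD; last by rewrite (gt_eqF x0) implybT.
  ring.
have [k bk] : exists k : nat, b <= 2 ^+ k * a.
  have [k hk] := dyadic_bound b; exists k; apply: le_trans hk _.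
  by rewrite ler_peMr// exprn_ge0.
elim: k a a1 ab bk => [|k IH] a a1 ab bk.
  have -> : b = a by apply/eqP; rewrite eq_le ab andbT -[leRHS]mul1r -(expr0 2).
  apply: le_trans (stieltjes_integral_le F r0 a1 (lexx a)) _.
  by rewrite subrr mulr0; apply: mulr_ge0; [exact: mulr_ge0|exact: powR_ge0].
have a0 : 0 < a by exact: lt_le_trans a1.
have [b2|b2] := lerP b (2 * a).
  apply: le_trans (integral_le_end a1 ab) _.
  apply: (@le_trans _ _ (w a * (h * (2 * a) `^ B))).
    apply: ler_wpM2l; first exact: powR_ge0.
    apply: le_trans (Fh _ (le_trans a1 ab)) _; rewrite ler_wpM2l//.
    have b0 : 0 <= b by apply: le_trans ab; exact: ltW.
    by apply: ge0_ler_powR; rewrite ?nnegrE ?mulr_ge0 ?(ltW a0).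
  by rewrite step// ler_wpM2r ?powR_ge0// ler_wpM2l.
have a2 : 1 <= 2 * a by lra.
have aa : a <= 2 * a by lra.
rewrite (stieltjes_integral_cat F r0 a1 aa (ltW b2)).
have h1 : I (2 * a) b <= h * C * (2 * a) `^ (B - r).
  by apply: IH => //; [exact: ltW|rewrite mulrA -exprSr].
have h2 : I a (2 * a) <= w a * (h * (2 * a) `^ B).
  apply: le_trans (integral_le_end a1 aa) _.
  by apply: ler_wpM2l; [exact: powR_ge0|exact: Fh].
rewrite step// in h2.
apply: le_trans (lerD h2 h1) _.
rewrite powRM ?(ltW a0)// -(opprB r B) -/g.
rewrite [leLHS](_ : _ = h * (C * 2 `^ (- g) + 2 `^ B) * a `^ (- g)); last by ring.
by rewrite -Ce.
Qed.

(** At the critical exponent all dyadic blocks contribute alike. *)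
Lemma integral_critical h a b : 0 <= h -> 1 <= a -> a <= b ->
  (forall u, 1 <= u -> F u <= h * u `^ r) ->
  I a b <= h * 2 `^ r * (1 + ln (b / a) / ln 2).
Proof.
move=> h0 a1 ab Fh.
have l2 : 0 < ln 2 :> R by rewrite ln_gt0// ltr1n.
have step x : 1 <= x -> w x * (h * (2 * x) `^ r) = h * 2 `^ r.
  move=> x1; have x0 : 0 < x by exact: lt_le_trans x1.
  have e : x `^ (- r) * x `^ r = 1.
    by rewrite -powRD ?addNr ?powRr0// (gt_eqF x0) implybT.
  rewrite powRM ?(ltW x0)//.
  rewrite [LHS](_ : _ = h * 2 `^ r * (x `^ (- r) * x `^ r)); last by ring.
  by rewrite e mulr1.
have hr : 0 <= h * 2 `^ r by rewrite mulr_ge0 ?powR_ge0.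
have [k bk] : exists k : nat, b <= 2 ^+ k * a.
  have [k hk] := dyadic_bound b; exists k; apply: le_trans hk _.
  by rewrite ler_peMr// exprn_ge0.
have small x : 1 <= x -> x <= b -> b <= 2 * x -> I x b <= h * 2 `^ r * (1 + ln (b / x) / ln 2).
  move=> x1 xb b2; have x0 : 0 < x by exact: lt_le_trans x1.
  apply: le_trans (integral_le_end x1 xb) _.
  apply: (@le_trans _ _ (w x * (h * (2 * x) `^ r))).
    apply: ler_wpM2l; first exact: powR_ge0.
    apply: le_trans (Fh _ (le_trans x1 xb)) _; rewrite ler_wpM2l//.
    have b0 : 0 <= b by apply: le_trans xb; exact: ltW.
    by apply: ge0_ler_powR; rewrite ?nnegrE ?mulr_ge0 ?(ltW x0).
  by rewrite step// ler_peMr// lerDl divr_ge0 ?(ltW l2)// ln_ge0// ler_pdivlMr// mul1r.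
elim: k a a1 ab bk => [|k IH] a a1 ab bk.
  by apply: small => //; move: bk; rewrite expr0; lra.
have a0 : 0 < a by exact: lt_le_trans a1.
have [b2|b2] := lerP b (2 * a); first exact: small.
have a2 : 1 <= 2 * a by lra.
have aa : a <= 2 * a by lra.
rewrite (stieltjes_integral_cat F r0 a1 aa (ltW b2)).
have h1 : I (2 * a) b <= h * 2 `^ r * (1 + ln (b / (2 * a)) / ln 2).
  by apply: IH => //; [exact: ltW|rewrite mulrA -exprSr].
have h2 : I a (2 * a) <= w a * (h * (2 * a) `^ r).
  apply: le_trans (integral_le_end a1 aa) _.
  by apply: ler_wpM2l; [exact: powR_ge0|exact: Fh].
rewrite step// in h2.
apply: le_trans (lerD h2 h1) _.
have b0 : 0 < b by exact: lt_le_trans ab.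
have -> : ln (b / a) = ln 2 + ln (b / (2 * a)).
  rewrite -lnM ?posrE ?divr_gt0 ?mulr_gt0//.
  by congr ln; field; rewrite gt_eqF.
have -> : (ln 2 + ln (b / (2 * a))) / ln 2 = 1 + ln (b / (2 * a)) / ln 2.
  by rewrite mulrDl divff// gt_eqF.
by rewrite le_eqVlt; apply/orP; left; apply/eqP; ring.
Qed.
End PowerGrowth.

(** * Rates *)

Section Rates.
Context {R : realType} {d : nat} {n : 'I_d -> nat} (a b : lattice n).
Variables (hs : sides_sorted a b) (Delta : {nonneg R}) (q : R).
Hypothesis d0 : (0 < d)%N.
Hypothesis q1 : 1 <= q.

Notation m := (side a b).
Notation D := (Delta%:num).
Notation F := (Htilde hs Delta).
Notation N := ((cumside m d)%:R : R).
Notation kn := (knot R m).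
Notation r := (q / 2).
Notation I u v := (\int[lebesgue_stieltjes_measure F]_(t in
  [set` Interval (BRight u) (BRight v)]) t `^ (- r)).

(** On the [k]-th piece the function is [amplitude k * t `^ rate_exp k], as long
    as it is below one. *)
Definition amplitude (k : nat) : R := D / (cumside m k)%:R `^ k%:R^-1.
Definition rate_exp (k : nat) : R := 2^-1 + k%:R^-1.

Let m_gt0 j : (0 < m j)%N. Proof. exact: side_gt0. Qed.
Let mR_gt0 j : 0 < (m j)%:R :> R. Proof. by rewrite ltr0n. Qed.
Let c_gt0 k : 0 < (cumside m k)%:R :> R. Proof. by rewrite ltr0n cumside_gt0. Qed.
Let D_ge0 : 0 <= D. Proof. by []. Qed.
Let r_ge0 : 0 <= r. Proof. by rewrite divr_ge0// (le_trans _ q1). Qed.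
Let N_ge1 : 1 <= N. Proof. by rewrite ler1n cumside_gt0. Qed.

Lemma amplitude_ge0 k : 0 <= amplitude k.
Proof. by rewrite divr_ge0 ?powR_ge0. Qed.

Lemma piece_power k t : 0 < t ->
  D * Num.sqrt t * (t / (cumside m k)%:R) `^ k%:R^-1 = amplitude k * t `^ rate_exp k.
Proof.
move=> t0; rewrite /amplitude /rate_exp powRM ?invr_ge0 ?(ltW t0) ?(ltW (c_gt0 k))//.
rewrite powRD; last by rewrite (gt_eqF t0) implybT.
rewrite powR12_sqrt ?(ltW t0)//.
have -> : (cumside m k)%:R^-1 `^ k%:R^-1 = ((cumside m k)%:R `^ k%:R^-1)^-1 :> R.
  by rewrite -(powR_inv1 (ltW (c_gt0 k))) -powRrM mulN1r powRN.
ring.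
Qed.

Lemma Htilde_le1 t : F t <= 1.
Proof. by rewrite /Htilde /Hfun /Hpiece ge_min lexx. Qed.

Lemma Htilde_ge0 t : 0 <= F t.
Proof.
by rewrite /Htilde /Hfun /Hpiece le_min ler01 /= !mulr_ge0 ?sqrtr_ge0 ?powR_ge0.
Qed.

Lemma Htilde_le_power k u : (1 <= k <= d)%N -> 1 <= u -> F u <= amplitude k * u `^ rate_exp k.
Proof.
move=> kd u1; have u0 : 0 < u by exact: lt_le_trans u1.
have le v : 1 <= v <= N -> F v <= amplitude k * v `^ rate_exp k.
  move=> /[dup] hv /andP[v1 _]; rewrite -piece_power ?(lt_le_trans _ v1)//.
  by apply: Hfun_le_piece => //; [exact: side_end].
have [uN|Nu] := lerP u N; first by apply: le; rewrite u1.
have -> : F u = F N.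
  rewrite /Htilde /Hfun (_ : Num.min u N = N); last by apply/min_idPr; exact: ltW.
  by rewrite (_ : Num.min N N = N)// minxx.
apply: le_trans (le N _) _; first by rewrite N_ge1 lexx.
rewrite ler_wpM2l ?amplitude_ge0//; apply: ge0_ler_powR; rewrite ?nnegrE ?(ltW Nu) ?(ltW u0)//.
by rewrite addr_ge0 ?invr_ge0.
Qed.

Lemma Htilde01 : F 0 = F 1.
Proof.
rewrite /Htilde /Hfun.
have e t : t <= 1 -> Num.max 1 (Num.min t N) = 1.
  by move=> t1; apply/max_idPl; rewrite ge_min t1.
by rewrite !e.
Qed.

Lemma Hmass_oc : Hmass hs Delta q = F 1 + I 1 N.
Proof. by rewrite /Hmass (stieltjes_integral_cc_oc r_ge0 Htilde01 N_ge1). Qed.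

Lemma Hmass_le_end : Hmass hs Delta q <= F N.
Proof.
rewrite Hmass_oc; have := stieltjes_integral_le F r_ge0 (lexx 1) N_ge1.
rewrite powR1 mul1r => h; rewrite addrC -lerBrDr; exact: h.
Qed.

Lemma Hmass_le1 : Hmass hs Delta q <= 1.
Proof. exact: le_trans Hmass_le_end (Htilde_le1 _). Qed.

Lemma Hmass_Delta0 : D = 0 -> Hmass hs Delta q <= 0.
Proof.
move=> D00; apply: le_trans Hmass_le_end _.
have := @Htilde_le_power 1 N; rewrite /amplitude D00 !mul0r; apply => //.
Qed.

Lemma integral_tail_le t : 1 <= t -> t <= N -> I t N <= t `^ (- r).
Proof.
move=> t1 tN; apply: le_trans (integral_le_end r_ge0 Htilde_ge0 t1 tN) _.
by rewrite ler_piMr ?powR_ge0 ?Htilde_le1.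
Qed.

Lemma knot_ge1 s : (1 <= s <= d.+1)%N -> 1 <= kn s.
Proof.
case: s => [//|s]; elim: s => [|s IH] /= sd; first by rewrite knot_1.
apply: le_trans (IH (ltnW sd)) _; exact: (knot_leS _ m_gt0 (side_end a b) hs).
Qed.

Lemma root_pow (x : R) k : 0 < x -> (0 < k)%N -> (x ^- k) `^ k%:R^-1 = x^-1.
Proof.
move=> x0 k0; rewrite -exprVn -powR_mulrn ?invr_ge0 ?(ltW x0)// -powRrM mulfV ?pnatr_eq0 -?lt0n//.
by rewrite powRr1// invr_ge0 ltW.
Qed.

Lemma amplitude_knot s : (1 <= s <= d)%N ->
  amplitude s * kn s `^ rate_exp s = D * Num.sqrt (kn s) / (m s)%:R.
Proof.
move=> /andP[s1 sd]; have t1 : 1 <= kn s by apply: knot_ge1; rewrite s1 ltnW.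
rewrite -piece_power ?(lt_le_trans _ t1)//; congr (_ * _).
rewrite /knot mulrAC divff ?gt_eqF// mul1r.
by rewrite -[_ ^-1]/((m s)%:R ^- s) root_pow.
Qed.

Lemma amplitude_knotS s : (1 <= s <= d)%N ->
  amplitude s * kn s.+1 `^ rate_exp s = D * Num.sqrt (kn s.+1) / (m s.+1)%:R.
Proof.
move=> /andP[s1 sd]; have t1 : 1 <= kn s.+1 by apply: knot_ge1.
rewrite -piece_power ?(lt_le_trans _ t1)//; congr (_ * _).
rewrite (knotS m_gt0) mulrAC divff ?gt_eqF// mul1r.
by rewrite -[_ ^-1]/((m s.+1)%:R ^- s) root_pow.
Qed.

Let rate_exp_ge0 k : 0 <= rate_exp k.
Proof. by rewrite addr_ge0 ?invr_ge0. Qed.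

(** The level at which the [s]-th piece reaches one. *)
Definition cutoff (s : nat) : R := amplitude s `^ (- (2 * s%:R / (2 + s)%:R)).

Lemma cutoff_gt0 s : 0 < D -> 0 < cutoff s.
Proof. by move=> Dp; rewrite powR_gt0// divr_gt0// powR_gt0. Qed.

Lemma cutoff_eq s : 0 < D -> (0 < s)%N -> amplitude s * cutoff s `^ rate_exp s = 1.
Proof.
move=> Dp s0; have A0 : 0 < amplitude s by rewrite divr_gt0// powR_gt0.
have sR : s%:R != 0 :> R by rewrite pnatr_eq0 -lt0n.
have s2 : (2 + s)%:R != 0 :> R by rewrite pnatr_eq0.
rewrite -{1}(powRr1 (ltW A0)) -powRrM -powRD; last by rewrite (gt_eqF A0) implybT.
have -> : 1 + - (2 * s%:R / (2 + s)%:R) * rate_exp s = 0.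
  by move: s2; rewrite natrD /rate_exp => s2; field; rewrite sR s2.
by rewrite powRr0.
Qed.

Lemma cutoff_tail s : (0 < s)%N ->
  cutoff s `^ (- r) = amplitude s `^ (q * s%:R / (2 + s)%:R).
Proof.
move=> s0; have s2 : (2 + s)%:R != 0 :> R by rewrite pnatr_eq0.
by rewrite /cutoff -powRrM; congr (_ `^ _); field.
Qed.

Lemma knot_le_cutoff s t : 0 < D -> (0 < s)%N -> 0 < t ->
  amplitude s * t `^ rate_exp s <= 1 -> t <= cutoff s.
Proof.
move=> Dp s0 t0 h; rewrite leNgt; apply/negP => ct.
have A0 : 0 < amplitude s by rewrite divr_gt0// powR_gt0.
have : cutoff s `^ rate_exp s < t `^ rate_exp s.
  apply: gt0_ltr_powR; rewrite ?nnegrE ?(ltW (cutoff_gt0 s Dp)) ?(ltW t0)//.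
  by rewrite addr_gt0 ?invr_gt0 ?ltr0n.
rewrite -(ltr_pM2l A0) (cutoff_eq Dp s0) => /lt_le_trans /(_ h).
by rewrite ltxx.
Qed.

Let knot_small s : (1 <= s <= d)%N -> D <= (m s)%:R / Num.sqrt (kn s) ->
  amplitude s * kn s `^ rate_exp s <= 1.
Proof.
move=> sd; have t1 : 1 <= kn s by apply: knot_ge1; case/andP: sd => -> /leqW.
rewrite amplitude_knot// ler_pdivrMr// mul1r ler_pdivlMr//.
by rewrite sqrtr_gt0 (lt_le_trans ltr01).
Qed.

Let scale_exp (A t B x : R) : 0 < t -> A * t `^ (B - x) = A * t `^ B * t `^ (- x).
Proof. by move=> t0; rewrite powRD ?mulrA// (gt_eqF t0) implybT. Qed.

(** Up to the cutoff the integral is dominated by its upper end; beyond it, the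
    whole mass of the function, at most one, is charged to the weight at the
    cutoff, which is of the same order. *)
Lemma rate_middle s : (1 <= s <= d)%N -> r < rate_exp s ->
  D <= (m s)%:R / Num.sqrt (kn s) ->
  Hmass hs Delta q <= (2 + growth_factor r (rate_exp s - r))
     * (D / (cumside m s)%:R `^ s%:R^-1) `^ (q * s%:R / (2 + s)%:R).
Proof.
move=> sd rs Ds; rewrite -/(amplitude s).
have /andP[s1 s2] := sd.
have g0 : 0 <= growth_factor r (rate_exp s - r).
  by rewrite divr_ge0 ?powR_ge0// ltW// powR_half_lt1// subr_gt0.
have [D00|Dn0] := eqVneq D 0.
  by apply: le_trans (Hmass_Delta0 D00) _; rewrite mulr_ge0 ?powR_ge0// addr_ge0.
have Dp : 0 < D by rewrite lt_neqAle eq_sym Dn0.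
have A0 := amplitude_ge0 s.
have t1 : 1 <= kn s by apply: knot_ge1; rewrite s1 ltnW.
have tT : kn s <= cutoff s.
  by apply: knot_le_cutoff => //; [exact: lt_le_trans t1|exact: knot_small].
have T1 : 1 <= cutoff s by exact: le_trans tT.
have T0 : 0 < cutoff s by exact: lt_le_trans T1.
have e := cutoff_eq Dp s1.
rewrite -(cutoff_tail s1) Hmass_oc.
have G := integral_growth r_ge0 Htilde_ge0 A0 rs T1 (fun u => Htilde_le_power sd).
have {}G : I 1 (cutoff s) <= growth_factor r (rate_exp s - r) * cutoff s `^ (- r).
  apply: le_trans G _; rewrite mulrAC scale_exp// e mul1r mulrC.
  by [].
have H1 : F 1 <= cutoff s `^ (- r).
  apply: le_trans (Htilde_le_power sd (lexx 1)) _; rewrite powR1 mulr1.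
  have -> : amplitude s = cutoff s `^ (- rate_exp s).
    have x0 : cutoff s `^ rate_exp s != 0 by rewrite gt_eqF// powR_gt0.
    by apply: (mulIf x0); rewrite e powRN mulVf.
  by apply: ler_powR => //; rewrite lerN2 ltW.
have w0 := powR_ge0 (cutoff s) (- r).
have [NT|TN] := lerP N (cutoff s).
  have : I 1 N <= I 1 (cutoff s) by exact: (integral_mono _ r_ge0).
  by move: G H1; rewrite mulrDl; lra.
rewrite (stieltjes_integral_cat _ r_ge0 (lexx 1) T1 (ltW TN)).
have W := integral_tail_le T1 (ltW TN).
rewrite mulrDl [leRHS]addrC; apply: le_trans (lerD H1 (lerD G W)) _.
by rewrite le_eqVlt; apply/orP; left; apply/eqP; ring.
Qed.

Lemma knot_le_end s : (1 <= s <= d.+1)%N -> kn s <= N.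
Proof.
move=> /andP[s1 sd]; rewrite -(knot_end R m_gt0 (side_end a b)).
have H i : (s + i <= d.+1)%N -> kn s <= kn (s + i).
  elim: i => [|i IH]; first by rewrite addn0.
  rewrite addnS => si; apply: le_trans (IH (ltnW si)) _.
  apply: (knot_leS _ m_gt0 (side_end a b) hs).
  by rewrite (leq_trans s1 (leq_addr _ _)) -ltnS.
by have := H _ (eq_leq (subnKC sd)); rewrite subnKC.
Qed.

Lemma power_at (A B t M : R) : 0 < t -> A * t `^ B = D * Num.sqrt t / M ->
  A * t `^ (B - r) = D / (M * t `^ ((q - 1) / 2)).
Proof.
move=> t0 e; rewrite scale_exp// e -(powR12_sqrt (ltW t0)) invfM -powRN.
have -> : - ((q - 1) / 2) = 2^-1 + - r by field.
rewrite powRD; last by rewrite (gt_eqF t0) implybT.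
by rewrite !mulrA -!mulrA; congr (_ * _); rewrite mulrCA.
Qed.

Lemma critical_level s : (1 <= s <= d)%N ->
  amplitude s * kn s `^ (rate_exp s - r) = D / ((m s)%:R * kn s `^ ((q - 1) / 2)).
Proof.
move=> sd; apply: power_at; last exact: amplitude_knot.
by apply: lt_le_trans ltr01 _; apply: knot_ge1; case/andP: sd => -> /leqW.
Qed.

Lemma critical_levelS s : (1 <= s <= d)%N ->
  amplitude s * kn s.+1 `^ (rate_exp s - r) = D / ((m s.+1)%:R * kn s.+1 `^ ((q - 1) / 2)).
Proof.
move=> sd; apply: power_at; last exact: amplitude_knotS.
by apply: lt_le_trans ltr01 _; apply: knot_ge1; case/andP: sd.
Qed.

Lemma integral_point t : 1 <= t -> I t t <= 0.
Proof.
by move=> t1; apply: le_trans (stieltjes_integral_le F r_ge0 t1 (lexx t)) _; rewrite subrr mulr0.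
Qed.

Notation phi s := (D / ((m s)%:R * kn s `^ ((q - 1) / 2))).

Lemma phi_ge0 s : 0 <= phi s.
Proof. by rewrite divr_ge0// mulr_ge0// powR_ge0. Qed.

(** Before the knot [s] the previous piece grows faster than the weight decreases,
    so that the value at the knot dominates. *)
Lemma critical_head s : (1 <= s <= d)%N -> ((1 < s)%N -> r < rate_exp s.-1) ->
  F 1 + I 1 (kn s) <= (1 + `|growth_factor r (rate_exp s.-1 - r)|) * phi s.
Proof.
move=> sd; have p0 := phi_ge0 s.
case: s sd p0 => [//|[|s]] sd p0 hr.
  have e : kn 1 = 1 by rewrite knot_1.
  have i0 := integral_point (lexx 1).
  have : F 1 <= phi 1.
    rewrite -critical_level// e powR1.
    by have := Htilde_le_power sd (lexx 1); rewrite powR1.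
  rewrite e => h; apply: le_trans (lerD h i0) _; rewrite e in p0.
  by rewrite addr0 ler_peMl// lerDl.
have {hr}rs : r < rate_exp s.+1 by apply: hr.
have sd' : (1 <= s.+1 <= d)%N by rewrite /= ltnW//; case/andP: sd.
have t1 : 1 <= kn s.+2 by apply: knot_ge1; case/andP: sd => _ /leqW ->.
rewrite mulrDl mul1r; apply: lerD.
  apply: le_trans (Htilde_le_power sd' (lexx 1)) _; rewrite powR1 mulr1.
  rewrite -critical_levelS// ler_peMr ?amplitude_ge0//.
  apply: (@le_trans _ _ (kn s.+2 `^ 0)); first by rewrite powRr0.
  by apply: ler_powR => //; rewrite subr_ge0 ltW.
apply: le_trans (integral_growth r_ge0 Htilde_ge0 (amplitude_ge0 _) rs t1 (fun u => Htilde_le_power sd')) _.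
rewrite mulrAC critical_levelS// mulrC; apply: ler_wpM2r => //.
exact: ler_norm.
Qed.

Lemma tail_subcritical s : (1 <= s <= d)%N -> rate_exp s < r ->
  I (kn s) N <= `|decay_factor (rate_exp s) (r - rate_exp s)| * phi s.
Proof.
move=> sd rs; have t1 : 1 <= kn s by apply: knot_ge1; case/andP: sd => -> /leqW.
have tN : kn s <= N by apply: knot_le_end; case/andP: sd => -> /leqW.
apply: le_trans (integral_decay r_ge0 Htilde_ge0 (amplitude_ge0 _) (rate_exp_ge0 s) rs t1 tN (fun u => Htilde_le_power sd)) _.
rewrite mulrAC critical_level// mulrC; apply: ler_wpM2r; first exact: phi_ge0.
exact: ler_norm.
Qed.

Notation ratio1 s := ((m s)%:R / (m s.+1)%:R : R).
Notation ratio2 s := (((m s)%:R / (cumside m s)%:R `^ (s + 2)%:R^-1)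
            / D `^ (2 / (s + 2)%:R) : R).

Lemma knotS_ratio s : kn s.+1 = kn s * ratio1 s ^+ s.
Proof.
rewrite (knotS m_gt0) /knot expr_div_n.
have h1 : (m s)%:R ^+ s != 0 :> R by rewrite expf_neq0// gt_eqF.
have h2 : (m s.+1)%:R ^+ s != 0 :> R by rewrite expf_neq0// gt_eqF.
by field; rewrite h1 h2.
Qed.

Lemma ratio2_gt0 s : 0 < D -> 0 < ratio2 s.
Proof. by move=> Dp; rewrite divr_gt0 ?powR_gt0// divr_gt0// powR_gt0. Qed.

Lemma cutoff_ratio s : 0 < D -> (0 < s)%N -> cutoff s = kn s * ratio2 s ^+ s.
Proof.
move=> Dp s0; have c0 := c_gt0 s.
have r2 := ratio2_gt0 s Dp.
have k0 : 0 < kn s by rewrite divr_gt0// exprn_gt0.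
have A0 : 0 < amplitude s by rewrite divr_gt0// powR_gt0.
apply: ln_inj; rewrite ?posrE ?cutoff_gt0 ?(mulr_gt0 k0) ?exprn_gt0//.
rewrite lnM ?posrE ?exprn_gt0// lnXn// /cutoff ln_powR /amplitude /knot.
rewrite !ln_div ?posrE ?divr_gt0 ?powR_gt0 ?exprn_gt0// !ln_powR lnXn//.
rewrite -(mulr_natr (ln _ - _ - _)) -(mulr_natr (ln (m s)%:R)) !natrD.
have sR : s%:R != 0 :> R by rewrite pnatr_eq0 -lt0n.
have s2 : s%:R + 2 != 0 :> R by rewrite -(natrD _ s 2) pnatr_eq0 addn2.
have s2' : 2 + s%:R != 0 :> R by rewrite addrC.
by field; rewrite ?sR ?s2 ?s2'.
Qed.

(** On the [s]-th piece the function grows exactly as fast as the weight decreases: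
    each dyadic range between the knot [s] and the end [v] of the piece, or the
    cutoff if it comes first, contributes alike. The quotient of [v] by the knot is
    [rho ^+ s]. *)
Lemma tail_critical s : (1 <= s <= d)%N -> rate_exp s = r -> 0 < D ->
  D <= (m s)%:R / Num.sqrt (kn s) ->
  I (kn s) N <= (2 `^ r * (1 + s%:R / ln 2) + 1
     + `|decay_factor (rate_exp s.+1) (r - rate_exp s.+1)|)
     * (phi s * log_plus (Num.min (ratio1 s) (ratio2 s))).
Proof.
move=> sd rs Dp Ds; have /andP[s1 s2] := sd.
have t1 : 1 <= kn s by apply: knot_ge1; rewrite s1 leqW.
have t0 : 0 < kn s by exact: lt_le_trans t1.
have tS1 : 1 <= kn s.+1 by apply: knot_ge1.
have tSN : kn s.+1 <= N by apply: knot_le_end.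
have tT : kn s <= cutoff s by apply: knot_le_cutoff => //; exact: knot_small.
have tS : kn s <= kn s.+1 by exact: (knot_leS _ m_gt0 (side_end a b) hs).
have A0 := amplitude_ge0 s.
have pA : phi s = amplitude s by rewrite -critical_level// rs subrr powRr0 mulr1.
have l2 : 0 < ln 2 :> R by rewrite ln_gt0// ltr1n.
have r1p : 0 < ratio1 s by rewrite divr_gt0.
have r2p := ratio2_gt0 s Dp.
set rho := Num.min (ratio1 s) (ratio2 s).
have rho0 : 0 < rho by rewrite lt_min r1p.
pose v := kn s * rho ^+ s.
have [vS vT vv] : [/\ v <= kn s.+1, v <= cutoff s & v = kn s.+1 \/ v = cutoff s].
  rewrite knotS_ratio (cutoff_ratio Dp s1) /v /rho.
  split; first by rewrite ler_pM2l// lerXn2r ?nnegrE ?(ltW rho0) ?(ltW r1p)// ge_min lexx.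
    by rewrite ler_pM2l// lerXn2r ?nnegrE ?(ltW rho0) ?(ltW r2p)// ge_min lexx orbT.
  by case: lerP => _; [left|right].
have tv : kn s <= v by case: vv => ->.
have vN : v <= N by exact: le_trans tSN.
have v1 : 1 <= v by exact: le_trans tv.
have LL : 1 <= log_plus rho by rewrite /log_plus le_max lexx.
have LR : ln rho <= log_plus rho by rewrite /log_plus le_max lexx orbT.
have sn : 0 <= s%:R / ln 2 :> R by rewrite divr_ge0// ltW.
have I1 : I (kn s) v <= amplitude s * 2 `^ r * ((1 + s%:R / ln 2) * log_plus rho).
  have Fl u : 1 <= u -> F u <= amplitude s * u `^ r by rewrite -rs; exact: Htilde_le_power.
  apply: le_trans (integral_critical r_ge0 Htilde_ge0 A0 t1 tv Fl) _.
  apply: ler_wpM2l; first by rewrite mulr_ge0 ?powR_ge0.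
  have -> : v / kn s = rho ^+ s by rewrite /v mulrAC divff ?mul1r// gt_eqF.
  rewrite lnXn// -(mulr_natr (ln rho)) mulrDl mul1r; apply: lerD => //.
  by rewrite -mulrA mulrC; apply: ler_wpM2l.
have I2 : I v N <= amplitude s * (1 + `|decay_factor (rate_exp s.+1) (r - rate_exp s.+1)|).
  have dec0 := normr_ge0 (decay_factor (rate_exp s.+1) (r - rate_exp s.+1) : R).
  case: vv => ve; rewrite ve.
    have [sd'|] := ltnP s d; last first.
      move=> ds; have -> : s = d by apply/eqP; rewrite eqn_leq s2 ds.
      rewrite (knot_end R m_gt0 (side_end a b)); apply: le_trans (integral_point N_ge1) _.
      by rewrite mulr_ge0 ?amplitude_ge0// addr_ge0.
    have sd1 : (1 <= s.+1 <= d)%N by [].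
    have rs1 : rate_exp s.+1 < r.
      by rewrite -rs /rate_exp ltrD2l ltf_pV2 ?posrE ?ltr0n// ltr_nat.
    apply: le_trans (tail_subcritical sd1 rs1) _.
    rewrite -critical_levelS// rs subrr powRr0 mulr1 mulrC ler_wpM2l//.
    by rewrite lerDr.
  apply: le_trans (integral_tail_le _ _) _; rewrite -?ve//.
  have e := cutoff_eq Dp s1; rewrite rs -ve in e.
  have -> : v `^ (- r) = amplitude s.
    have x0 : v `^ r != 0 by rewrite gt_eqF// powR_gt0// (lt_le_trans ltr01).
    by apply: (mulIf x0); rewrite e powRN mulVf.
  by rewrite ler_peMr// lerDl.
rewrite (stieltjes_integral_cat _ r_ge0 t1 tv vN) pA.
apply: le_trans (lerD I1 I2) _.
set X := `|_|; have X0 : 0 <= X by exact: normr_ge0.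
have : amplitude s * (1 + X) <= amplitude s * ((1 + X) * log_plus rho).
  by rewrite ler_wpM2l// ler_peMr// addr_ge0.
move=> h; apply: le_trans (lerD (lexx _) h) _.
by rewrite le_eqVlt; apply/orP; left; apply/eqP; ring.
Qed.

Definition critical_constant (s : nat) : R :=
  1 + `|growth_factor r (rate_exp s.-1 - r)| + `|decay_factor (rate_exp s) (r - rate_exp s)|
  + (2 `^ r * (1 + s%:R / ln 2) + 1 + `|decay_factor (rate_exp s.+1) (r - rate_exp s.+1)|).

Lemma critical_constant_ge0 s : 0 <= critical_constant s.
Proof.
have l2 : 0 < ln 2 :> R by rewrite ln_gt0// ltr1n.
have l0 : 0 <= s%:R / ln 2 :> R by rewrite divr_ge0// ltW.
by rewrite /critical_constant !addr_ge0// mulr_ge0 ?powR_ge0// addr_ge0.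
Qed.

Lemma rate_critical s : (1 <= s <= d)%N -> q != 1 -> rate_exp s <= r ->
  ((1 < s)%N -> r < rate_exp s.-1) ->
  D <= (m s)%:R / Num.sqrt (kn s) ->
  Hmass hs Delta q <= critical_constant s * phi s * Lambda m q D s.
Proof.
move=> sd qn rs hr Ds; have /andP[s1 s2] := sd.
have p0 := phi_ge0 s.
have l2 : 0 < ln 2 :> R by rewrite ln_gt0// ltr1n.
have L1 : 1 <= Lambda m q D s.
  by rewrite /Lambda; apply: exprn_ege1; rewrite /log_plus le_max lexx.
have C1 : 0 <= 2 `^ r * (1 + s%:R / ln 2) + 1 + `|decay_factor (rate_exp s.+1) (r - rate_exp s.+1)|.
  by rewrite !addr_ge0// mulr_ge0 ?powR_ge0// addr_ge0// divr_ge0// (ltW l2).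
have C0 := critical_constant_ge0 s.
have [D00|Dn0] := eqVneq D 0.
  apply: le_trans (Hmass_Delta0 D00) _.
  by apply: mulr_ge0; [exact: mulr_ge0|exact: le_trans L1].
have Dp : 0 < D by rewrite lt_neqAle eq_sym Dn0.
have t1 : 1 <= kn s by apply: knot_ge1; rewrite s1 leqW.
have tN : kn s <= N by apply: knot_le_end; rewrite s1 leqW.
have head := critical_head sd hr.
rewrite Hmass_oc (stieltjes_integral_cat _ r_ge0 (lexx 1) t1 tN) addrA.
set U := 1 + _ in head; have U0 : 0 <= U by rewrite addr_ge0.
have pL : phi s <= phi s * Lambda m q D s by rewrite ler_peMr.
have pL0 : 0 <= phi s * Lambda m q D s by exact: le_trans pL.
have headL : U * phi s <= U * (phi s * Lambda m q D s) by rewrite ler_wpM2l.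
apply: le_trans (lerD (le_trans head headL) (lexx _)) _.
rewrite /critical_constant -/U -(mulrA _ (phi s)); clearbody U.
set V := `|decay_factor (rate_exp s) _|; have V0 : 0 <= V by exact: normr_ge0.
set W := 2 `^ r * _ + 1 + _ in C1 *.
have [lt|eq] : rate_exp s < r \/ rate_exp s = r.
  by move: rs; rewrite le_eqVlt => /predU1P[->|]; [right|left].
  rewrite -(addrA U) (mulrDl U) lerD2l; apply: le_trans (tail_subcritical sd lt) _.
  rewrite -/V (mulrDl V); apply: le_trans (ler_wpM2l V0 pL) _.
  by rewrite lerDl mulr_ge0.
have sR : s%:R != 0 :> R by rewrite pnatr_eq0 -lt0n.
have flag : (q != 1) && (2 / (q - 1) == s%:R).
  rewrite qn /=; apply/eqP.
  have -> : q - 1 = 2 / s%:R.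
    have : q = 2 * rate_exp s by rewrite eq; field.
    by move=> ->; rewrite /rate_exp; field.
  by field.
have := tail_critical sd eq Dp Ds.
have -> : log_plus (Num.min (ratio1 s) (ratio2 s)) = Lambda m q D s.
  by rewrite /Lambda flag expr1 (negbTE Dn0).
move=> h; rewrite -(addrA U) (mulrDl U) lerD2l; apply: le_trans h _.
by rewrite -/W; apply: ler_wpM2r => //; rewrite lerDr.
Qed.
End Rates.

Section CriticalIndex.
Context {R : realType}.
Variables (q : R) (d : nat).
Hypothesis q1 : 1 <= q.

Lemma below_s_crit s : (1 <= s < s_crit q d)%N -> (s <= d)%N /\ q / 2 < rate_exp s.
Proof.
move=> /andP[s1]; rewrite /s_crit /rate_exp.
have sR : 0 < s%:R :> R by rewrite ltr0n.
case: eqVneq => [->|qn]; first by rewrite ltnS => ->; split => //; rewrite -[ltLHS]addr0 mul1r ltrD2l invr_gt0.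
have q10 : 0 < q - 1 by rewrite subr_gt0 lt_neqAle eq_sym qn.
rewrite leq_min => /andP[sc sd]; split => //.
have x0 : 0 < 2 / (q - 1) by rewrite divr_gt0.
have c0 : 0 <= Num.ceil (2 / (q - 1)) by rewrite ceil_ge0// (lt_trans _ x0)// oppr_lt0.
have : s%:R < 2 / (q - 1).
  have : (s%:Z < Num.ceil (2 / (q - 1)))%R by rewrite -(gez0_abs c0) ltz_nat.
  by rewrite ceil_gt_int -pmulrn.
rewrite ltr_pdivlMr// => h.
have : (q - 1) / 2 < s%:R^-1.
  by rewrite ltr_pdivrMr// mulrC ltr_pdivlMr// mulrC.
lra.
Qed.

Lemma at_s_crit s : s = s_crit q d -> (s <= d)%N ->
  [/\ q != 1, (1 <= s)%N, rate_exp s <= q / 2 & (1 < s)%N -> q / 2 < rate_exp s.-1].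
Proof.
move=> sE sd.
have hr : (1 < s)%N -> q / 2 < rate_exp s.-1.
  move=> s1; apply: (proj2 (@below_s_crit s.-1 _)).
  by rewrite -sE -ltnS prednK ?s1 ?leqnn// ltnW.
move: (sE); rewrite /s_crit; case: eqVneq => [_ sd'|qn].
  by move: sd; rewrite sd' ltnn.
have q10 : 0 < q - 1 by rewrite subr_gt0 lt_neqAle eq_sym qn.
have x0 : 0 < 2 / (q - 1) by rewrite divr_gt0.
have c0 : 0 < Num.ceil (2 / (q - 1)) by rewrite ceil_gt0.
rewrite /minn; case: ltnP => _ se; last by move: sd; rewrite se ltnn.
have s1 : (1 <= s)%N by rewrite se absz_gt0 gt_eqF.
split => //.
have : 2 / (q - 1) <= s%:R.
  have := ceil_ge (2 / (q - 1)); rewrite -(gez0_abs (ltW c0)) -se.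
  by rewrite -pmulrn.
have sR : 0 < s%:R :> R by rewrite ltr0n.
rewrite ler_pdivrMr// => h.
have : s%:R^-1 <= (q - 1) / 2.
  by rewrite ler_pdivlMr// mulrC ler_pdivrMr// mulrC.
rewrite /rate_exp; lra.
Qed.
End CriticalIndex.

(** * The theorem *)

Section ConstantRates.
Context {R : realType}.

(** Sums instead of maxima, so as to dominate the constants of all the pieces. *)
Definition rate_constant (q : R) (d : nat) : R :=
  1 + \sum_(s < d.+1) (2 + `|growth_factor (q / 2) (rate_exp s - q / 2)|)
    + \sum_(s < d.+1) critical_constant q s.

Lemma sum_term_le (d : nat) (F : nat -> R) s : (forall i, 0 <= F i) ->
  (s <= d)%N -> F s <= \sum_(i < d.+1) F i.
Proof.
by move=> F0 sd; rewrite (bigD1 (Ordinal (sd : (s < d.+1)%N)))//= lerDl sumr_ge0.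
Qed.

Lemma rate_constant_ge (q : R) d s : (s <= d)%N ->
  [/\ 1 <= rate_constant q d,
      2 + growth_factor (q / 2) (rate_exp s - q / 2) <= rate_constant q d &
      critical_constant q s <= rate_constant q d].
Proof.
move=> sd.
have g0 i : 0 <= 2 + `|growth_factor (q / 2) (rate_exp i - q / 2)| by rewrite addr_ge0.
have G := sum_term_le g0 sd; have C := sum_term_le (critical_constant_ge0 q) sd.
have := le_trans (g0 s) G; have := le_trans (critical_constant_ge0 q s) C.
have := ler_norm (growth_factor (q / 2) (rate_exp s - q / 2)).
by rewrite /rate_constant; split; lra.
Qed.
End ConstantRates.
Theorem theorem2 (R : realType) :
  (exists C : R -> nat -> R,
    [/\ forall d : nat, {within `[1, +oo[, continuous (fun q => C q d)},
        forall (q : R) (d1 d2 : nat),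
          1 <= q -> (d1 <= d2)%N -> C q d1 <= C q d2 &
        forall (d : nat) (q : R) (n : 'I_d -> nat)
          (disp : measure_display) (T : measurableType disp)
          (P : probability T R)
          (x : 'I_(\prod_(j < d) n j) -> lattice n)
          (eps : 'I_(\prod_(j < d) n j) -> {RV P >-> R})
          (f : lattice n -> R) (fhat : lattice n -> {RV P >-> R})
          (sigma : R) (a b : lattice n) (hs : sides_sorted a b)
          (Delta : {nonneg R}),
        (0 < d)%N -> 1 <= q -> (forall j, (0 < n j)%N) ->
        bijective x ->
        independent_rvs eps ->
        (forall i, 'E_P[eps i] = 0)%E ->
        0 < sigma ->
        (forall i, 'E_P[fun w => (`|eps i w| `^ Num.max q 2)%R]
                   <= (sigma `^ Num.max q 2)%R%:E)%E ->
        (forall z w,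
          is_block_value x (fun i => f (x i) + eps i w) z (fhat z w)) ->
        (forall u v, lle u v -> f u <= f v) ->
        lle a b ->
        (f b - f a) / sigma <= Delta%:num ->
        (\sum_(i | x i \in box a b)
            'E_P[fun w => (`|fhat (x i) w - f (x i)| `^ q)%R]
         <= (C q d * (npts x a b)%:R * sigma `^ q *
              (Htilde hs Delta 1
               + \int[lebesgue_stieltjes_measure (Htilde hs Delta)]_(t in
                    `[1, (npts x a b)%:R]) t `^ (- (q / 2))
               + (npts x a b)%:R^-1 *
                 \prod_(1 <= j < d.+1)
                   \int[lebesgue_measure]_(t in `[0, (side a b j)%:R])
                     Num.max t 1 `^ (- (q / 2))))%R%:E)%E])
  /\
  (forall (q : R) (d : nat), 1 <= q -> (0 < d)%N ->
    exists C : R,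
    forall (n : 'I_d -> nat) (a b : lattice n) (hs : sides_sorted a b)
      (Delta : {nonneg R}),
    lle a b ->
    let m := side a b in
    let t := knot R m in
    let D := Delta%:num in
    [/\ (m 1%N)%:R <= D -> Hmass hs Delta q <= C,
        forall s : nat, (1 <= s < s_crit q d)%N ->
          (m s.+1)%:R / Num.sqrt (t s.+1) <= D <= (m s)%:R / Num.sqrt (t s) ->
          Hmass hs Delta q
          <= C * (D / (cumside m s)%:R `^ s%:R^-1) `^ (q * s%:R / (2 + s)%:R) &
        forall s : nat, s = s_crit q d -> (s <= d)%N ->
          D <= (m s)%:R / Num.sqrt (t s) ->
          Hmass hs Delta q
          <= C * (D / ((m s)%:R * t s `^ ((q - 1) / 2))) * Lambda m q D s]).
Proof.
split.
  exists risk_constant; split.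
  - by move=> d; apply: continuous_subspaceT; exact: risk_constant_continuous.
  - move=> q d1 d2; exact: risk_constant_nd.
  - move=> d q n disp T P x eps f fhat sigma a b hs Delta.
    move=> d0 q1 _ xbij ind eps0 sigma0 epsm fblock fm ab fab.
    exact: (@risk_bound R d n disp T P _ x eps f fhat q sigma a b hs Delta
      d0 q1 xbij ind eps0 sigma0 epsm fblock fm ab fab).
move=> q d q1 d0; exists (rate_constant q d) => n a b hs Delta _ m t D; split.
- move=> _; apply: le_trans (Hmass_le1 hs Delta q1) _.
  by have [] := rate_constant_ge q (leqnn d).
- move=> s sc /andP[_ Ds]; have /andP[s1 _] := sc.
  have [sd rs] := below_s_crit q1 sc.
  have [_ h _] := rate_constant_ge q sd.
  have sd1 : (1 <= s <= d)%N by rewrite s1.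
  apply: le_trans (rate_middle hs d0 q1 sd1 rs Ds) _.
  by apply: ler_wpM2r h; exact: powR_ge0.
- move=> s sE sd Ds; have [qn s1 rs hr] := at_s_crit q1 sE sd.
  have [_ _ h] := rate_constant_ge q sd.
  have sd1 : (1 <= s <= d)%N by rewrite s1.
  apply: le_trans (rate_critical hs d0 q1 sd1 qn rs hr Ds) _.
  apply: ler_wpM2r; first by rewrite /Lambda exprn_ge0// le_max ler01.
  by apply: ler_wpM2r h; rewrite divr_ge0// mulr_ge0// powR_ge0.
Qed.
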